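(* Let $p\in[1,\infty]$, $r>0$ and $Q,\widetilde Q\in\mathbb{U}_{p,r}^{2\times2}$. Then the difference of the characteristic determinants admits the representation $$\Delta_Q(\lambda)-\Delta_{\widetilde Q}(\lambda)=\int_0^1g_1(t)e^{ib_1\lambda t}\,dt+\int_0^1g_2(t)e^{ib_2\lambda t}\,dt,\qquad\lambda\in\mathbb{C},$$ with $g_j:=g_{j,Q}-g_{j,\widetilde Q}\in L^p[0,1]$, $j\in\{1,2\}$. Moreover, there is a constant $C=C(p,r,B,A)>0$, not depending on $Q,\widetilde Q$, such that $$\|g_1\|_p+\|g_2\|_p=\|g_{1,Q}-g_{1,\widetilde Q}\|_p+\|g_{2,Q}-g_{2,\widetilde Q}\|_p\le C\cdot\|Q-\widetilde Q\|_p .$$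
   Context: Fix real numbers $b_1<0<b_2$ and $B=\operatorname{diag}(b_1,b_2)$. A potential matrix is $Q=\begin{pmatrix}0&Q_{12}\\Q_{21}&0\end{pmatrix}$ with entries in $L^1[0,1]$; $\|Q\|_p$ is its norm in $L^p([0,1];\mathbb{C}^{2\times 2})$, and $\mathbb{U}_{p,r}^{2\times2}$ is the set of potential matrices with $\|Q\|_p\le r$. Fix linearly independent boundary conditions $U_j(y)=a_{j1}y_1(0)+a_{j2}y_2(0)+a_{j3}y_1(1)+a_{j4}y_2(1)=0$, $j\in\{1,2\}$, with coefficient matrix $A=(a_{jk})\in\mathbb{C}^{2\times4}$. Let $\Phi_Q(\cdot,\lambda)=(\Phi_1(\cdot,\lambda)\ \Phi_2(\cdot,\lambda))$ be the fundamental matrix of $-iB^{-1}y'+Q(x)y=\lambda y$, $x\in[0,1]$, with $\Phi_Q(0,\lambda)=I_2$, with columns $\Phi_1,\Phi_2$. The characteristic determinant is $\Delta_Q(\lambda)=\det\bigl(U_j(\Phi_k(\cdot,\lambda))\bigr)_{j,k=1}^2$, and $\Delta_0$ is the one for $Q=0$. For each summable potential matrix $Q$ there are (uniquely determined) functions $g_{1,Q},g_{2,Q}\in L^1[0,1]$ with $$\Delta_Q(\lambda)=\Delta_0(\lambda)+\int_0^1g_{1,Q}(t)e^{ib_1\lambda t}\,dt+\int_0^1g_{2,Q}(t)e^{ib_2\lambda t}\,dt,\quad\lambda\in\mathbb{C};$$ these are the functions $g_{j,Q}$ in the claim. *)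

(* Defs.v *)
From HB Require Import structures.
From mathcomp Require Import all_boot all_order all_algebra.
From mathcomp Require Import all_classical all_reals all_analysis.
From mathcomp Require Import complex.

Set Implicit Arguments.
Unset Strict Implicit.
Unset Printing Implicit Defensive.
Import Order.TTheory GRing.Theory Num.Theory.
Import numFieldNormedType.Exports.
Local Open Scope classical_set_scope.
Local Open Scope ring_scope.
Local Open Scope complex_scope.

Section Defs.
Variable R : realType.
Local Notation C := R[i].
Local Notation Re := (@complex.Re R).
Local Notation Im := (@complex.Im R).
Local Notation mu := (@lebesgue_measure R).
Local Notation I01 := (`[0%R, 1%R]%classic : set R).

Definition cexp (z : C) : C :=
  (expR (Re z) * cos (Im z)) +i* (expR (Re z) * sin (Im z)).

Definition cintegral (D : set R) (f : R -> C) : C :=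
  (\int[mu]_(t in D) Re (f t)) +i* (\int[mu]_(t in D) Im (f t)).

(* Elements of L^p[0,1] are represented by functions on the whole line, whose
   values outside [0,1] are irrelevant: [\_] truncates them to 0. *)
Definition Lpnorm (p : \bar R) (f : R -> C) : \bar R :=
  Lnorm mu p (EFin \o ((fun t => Normc.normc (f t)) \_ I01)).

Definition inLp (p : \bar R) (f : R -> C) : Prop :=
  [/\ measurable_fun I01 (fun t => Re (f t)),
      measurable_fun I01 (fun t => Im (f t))
    & (Lpnorm p f < +oo)%E].

(* C^{2x2} carries the maximum norm; on matrices with zero diagonal it coincides
   with the operator norm induced by any l^q norm on C^2. *)
Definition mxmod (M : 'M[C]_2) : R :=
  \big[Num.max/0]_(i < 2) \big[Num.max/0]_(j < 2) Normc.normc (M i j).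

Definition mxLpnorm (p : \bar R) (Q : R -> 'M[C]_2) : \bar R :=
  Lnorm mu p (EFin \o ((fun t => mxmod (Q t)) \_ I01)).

Definition potential (Q : R -> 'M[C]_2) : Prop :=
  (forall x, 0 <= x <= 1 -> forall i, Q x i i = 0) /\
  (forall i j, inLp 1%E (fun x => Q x i j)).

Definition Uball (p : \bar R) (r : R) (Q : R -> 'M[C]_2) : Prop :=
  potential Q /\ (mxLpnorm p Q <= r%:E)%E.

Definition abs_continuous01 (f : R -> C) : Prop :=
  forall e : R, 0 < e -> exists2 d : R, 0 < d &
    forall (n : nat) (a b : 'I_n -> R),
      (forall i, 0 <= a i /\ a i <= b i /\ b i <= 1) ->
      trivIset [set: 'I_n] (fun i => `]a i, b i[%classic) ->
      \sum_(i < n) (b i - a i) < d ->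
      \sum_(i < n) Normc.normc (f (b i) - f (a i)) < e.

Definition has_cderiv (f : R -> C) (x : R) (v : C) : Prop :=
  is_derive x 1 (fun t => Re (f t)) (Re v) /\
  is_derive x 1 (fun t => Im (f t)) (Im v).

Definition Bmx (b1 b2 : R) : 'M[C]_2 :=
  diag_mx (\row_(j < 2) (if j == ord0 then b1 else b2)%:C).

(* Solutions are understood in the Caratheodory sense: absolutely continuous on
   [0,1], with the equation holding almost everywhere. *)
Definition is_fundamental (b1 b2 : R) (Q : R -> 'M[C]_2) (lambda : C)
    (Phi : R -> 'M[C]_2) : Prop :=
  [/\ forall j k, abs_continuous01 (fun x => Phi x j k),
      {ae mu, forall x, 0 < x < 1 -> exists2 D : 'M[C]_2,
         forall j k, has_cderiv (fun t => Phi t j k) x (D j k) &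
         - 'i *: (invmx (Bmx b1 b2) *m D) + Q x *m Phi x = lambda *: Phi x}
    & Phi 0 = 1%:M].

Definition fundamental (b1 b2 : R) (Q : R -> 'M[C]_2) (lambda : C) :
    R -> 'M[C]_2 :=
  xget (fun=> 0) [set Phi | is_fundamental b1 b2 Q lambda Phi].

Definition bform (A : 'M[C]_(2, 4)) (y : R -> 'cV[C]_2) : 'cV[C]_2 :=
  A *m (col_mx (y 0) (y 1) : 'cV_4).

Definition charDet (b1 b2 : R) (A : 'M[C]_(2, 4)) (Q : R -> 'M[C]_2)
    (lambda : C) : C :=
  \det (\matrix_(j < 2, k < 2)
    bform A (fun x => col k (fundamental b1 b2 Q lambda x)) j ord0).

Definition fourier01 (b : R) (g : R -> C) (lambda : C) : C :=
  cintegral I01 (fun t => g t * cexp ('i * b%:C * lambda * t%:C)).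

Definition is_charDensity (b1 b2 : R) (A : 'M[C]_(2, 4)) (Q : R -> 'M[C]_2)
    (g : (R -> C) * (R -> C)) : Prop :=
  [/\ inLp 1%E g.1, inLp 1%E g.2 &
    forall lambda, charDet b1 b2 A Q lambda =
      charDet b1 b2 A (fun=> 0) lambda
      + fourier01 b1 g.1 lambda + fourier01 b2 g.2 lambda].

(* The pair (g_{1,Q}, g_{2,Q}), determined up to equality a.e. on [0,1]; it
   exists for every potential matrix, and the value (0,0) is taken otherwise. *)
Definition charDensity (b1 b2 : R) (A : 'M[C]_(2, 4)) (Q : R -> 'M[C]_2) :
    (R -> C) * (R -> C) :=
  xget ((fun=> 0), (fun=> 0)) [set g | is_charDensity b1 b2 A Q g].

End Defs.

(* Main.v *)
(* Iterating the Volterra equation writes an entry of the fundamental matrix as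
   e^{i b_i lambda x} (c + int_0^x k(x, tau) e^{i lambda (b_j - b_i) tau} d tau), where the
   density k is a sum of Picard terms, dominated by the same series for a scalar weight w.
   Jensen's inequality and induction on the partial sums bound the L^p norm of the majorant
   by |w|_p exp (int w); with w = |Q| + |Q~| + |Q - Q~| / D it dominates the difference of
   the densities of Q and Q~ up to the factor D, which is the stability estimate.  By
   Liouville's formula det Phi(1) does not depend on Q, so Delta_Q - Delta_0 is linear in
   the entries of Phi(1): it is the transform of a density at the frequencies
   b_1 + (b_2 - b_1) tau, which are those of the claim after cutting [0, 1] at the zero of
   this affine function.  Finally g_{1,Q} and g_{2,Q} are unique, because evaluating at
   lambda = - i eta and applying the polynomials (1 - z^n)^(2^n) to exponentials isolates
   the integrals of g_j over half-lines. *)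
Require Import Defs.
From mathcomp Require Import all_boot all_order all_algebra.
From mathcomp Require Import all_classical all_reals all_analysis.
From mathcomp Require Import complex measurable_realfun ess_sup_inf.
From mathcomp Require Import ring lra.
Set Implicit Arguments.
Unset Strict Implicit.
Unset Printing Implicit Defensive.
Import Order.TTheory GRing.Theory Num.Theory.
Import numFieldNormedType.Exports.
Local Open Scope ring_scope.
Local Open Scope classical_set_scope.

(** * Absolutely continuous functions *)

Section AbsCont.
Variable R : realType.
Implicit Types (f g : R -> R).
Local Notation mu := (@lebesgue_measure R).

(** Two objects in the statement are obtained by choice: [fundamental], among absolutely continuous
    solutions of an equation that holds almost everywhere, and [charDensity], among integrable
    pairs. Nothing can be said about either before it is determined, at x = 1 and almost everywhere
    respectively; hence two uniqueness results accompany the two constructions. The first rests on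
    the fact that an absolutely continuous function whose derivative vanishes almost everywhere is
    constant. Once e^{i b_i lambda x} is factored out of component i, lambda occurs only in the
    exponentials e^{i lambda (b_j - b_i) t}, and the one at t - tau is a product of two others. A
    substitution in each iteration therefore carries the dependence on lambda out of the kernels.
    The estimate runs over partial sums and not over single Picard terms, because the recursion of
    the partial sums, divided by the expected bound, becomes an average with total mass at most one,
    to which Jensen's inequality applies without loss. The weight is divided by a bound of the
    distance of the potentials, which may be zero; so that bound is any larger number, and a limit
    closes the proof. *)

Definition acont01 f := forall e : R, 0 < e -> exists2 d : R, 0 < d &
  forall (n : nat) (a b : 'I_n -> R),
    (forall i, 0 <= a i /\ a i <= b i /\ b i <= 1) ->
    trivIset [set: 'I_n] (fun i => `]a i, b i[) ->
    \sum_(i < n) (b i - a i) < d ->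
    \sum_(i < n) `|f (b i) - f (a i)| < e.

(* Real induction on [y] in the spirit of Cousin's lemma: past a point of [E] the
   increment of [f] is charged to a new interval inside [U], past any other point
   to [e] times the length. *)
Lemma zero_derive_decomp f (E U : set R) (e x : R) :
  0 < e -> 0 <= x -> open U -> E `<=` U ->
  (forall s : R, 0 <= s <= x -> ~ E s -> is_derive s 1 f 0) ->
  exists n : nat, exists a b : nat -> R,
  [/\ forall i, (i < n)%N -> [/\ 0 <= a i, a i <= b i, b i <= x & `]a i, b i[ `<=` U],
      forall i j, (i < j)%N -> (j < n)%N -> b i <= a j &
      `|f x - f 0| <= e * x + \sum_(i < n) `|f (b i) - f (a i)| ].
Proof.
move=> e0 x0 oU EU f'0.
pose P y := exists n : nat, exists a b : nat -> R,
  [/\ forall i, (i < n)%N -> [/\ 0 <= a i, a i <= b i, b i <= y & `]a i, b i[ `<=` U],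
      forall i j, (i < j)%N -> (j < n)%N -> b i <= a j &
      `|f y - f 0| <= e * y + \sum_(i < n) `|f (b i) - f (a i)| ].
have P0 : P 0.
  exists 0%N, (fun=> 0), (fun=> 0); split => //.
  by rewrite big_ord0 subrr normr0 mulr0 addr0.
pose A := [set y | 0 <= y <= x /\ P y].
have A0 : A 0 by split => //; rewrite lexx.
have hsA : has_sup A.
  by split; [exists 0|exists x => y [/andP[]]].
set s := sup A.
have s0 : 0 <= s by apply: ub_le_sup => //; exact: hsA.2.
have sx : s <= x by apply: sup_le_ub; [exists 0|move=> y [/andP[]]].
(* One radius serves twice: it carries [P] from a point just left of the supremum [s] to [s] itself,
   and then beyond [s]. *)
have step : exists2 d : R, 0 < d & forall y z, s - d < y <= s -> s <= z < s + d ->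
    0 <= y -> P y -> P z.
  have [Es|nEs] := pselect (E s).
    have /nbhs_ballP[d /= d0 dU] : nbhs s U by apply: open_nbhs_nbhs; split => //; exact: EU.
    exists d => // y z /andP[y1 y2] /andP[z1 z2] y0 [n [a [b [H1 H2 H3]]]].
    exists n.+1, (fun i => if i == n then y else a i), (fun i => if i == n then z else b i).
    split => [i|i j ij jn|].
    - rewrite ltnS leq_eqVlt; case: eqP => [_ _|_ /=].
        split => //; first exact: le_trans z1.
        move=> t /=; rewrite in_itv/= => /andP[t1 t2]; apply: dU.
        by rewrite /ball /= ltr_distlC; lra.
      by move=> /H1[? ? ? ?]; split => //; lra.
    - have -> : (i == n) = false by apply/negbTE; rewrite neq_ltn (leq_trans ij)//.
      move: jn; rewrite ltnS leq_eqVlt; case: eqP => [jn _|_ /= jn]; last exact: H2.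
      by rewrite jn in ij; have [] := H1 i ij.
    - rewrite big_ord_recr/= eqxx.
      under eq_bigr => i _ do rewrite (_ : (i == n :> nat) = false) ?(ltn_eqF (ltn_ord i))//.
      have : `|f z - f 0| <= `|f z - f y| + `|f y - f 0|.
        by rewrite (le_trans _ (ler_normD _ _))// addrA subrK.
      have : e * y <= e * z by rewrite ler_pM2l//; lra.
      lra.
  have : h^-1 *: (f (s + h) - f s) @[h --> 0^'] --> (0:R).
    have [D1 D2] : is_derive s 1 f 0 by apply: f'0 => //; rewrite s0.
    have D3 : h^-1 *: (f (h *: 1 + s) - f s) @[h --> 0^'] --> derive f s 1 := D1.
    rewrite D2 in D3; have <- // : (fun h : R => h^-1 *: (f (h *: 1 + s) - f s)) =
      (fun h : R => h^-1 *: (f (s + h) - f s)).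
    by apply/funext => h; rewrite [h *: 1]mulr1 [h + s]addrC.
  move=> /cvgrPdist_le /(_ _ e0) /nbhs_ballP[d /= d0 hd].
  have key h : `|h| < d -> `|f (s + h) - f s| <= e * `|h|.
    move=> hh; have [->|h0] := eqVneq h 0; first by rewrite addr0 subrr !normr0 mulr0.
    have := hd h; rewrite /ball /= sub0r normrN => /(_ hh h0).
    by rewrite sub0r normrN normrZ normfV mulrC ler_pdivrMr ?normr_gt0.
  exists d => // y z /andP[y1 y2] /andP[z1 z2] y0 [n [a [b [H1 H2 H3]]]].
  exists n, a, b; split => // [i /H1[? ? ? ?]|]; first by split => //; lra.
  have := key (z - s); rewrite ger0_norm; last lra.
  have := key (y - s); rewrite ler0_norm; last lra.
  rewrite [s + _]addrC subrK [s + _]addrC subrK.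
  move=> /(_ ltac:(lra)) k1 /(_ ltac:(lra)) k2.
  have : `|f z - f 0| <= `|f z - f s| + `|f s - f y| + `|f y - f 0|.
    have -> : f z - f 0 = (f z - f s) + (f s - f y) + (f y - f 0) by ring.
    by rewrite (le_trans (ler_normD _ _))// lerD2r ler_normD.
  rewrite [`|f s - f y|]distrC.
  have : e * (z - s) + e * - (y - s) = e * z - e * y by ring.
  lra.
have [d d0 hd] := step.
have [y [/andP[y0 yx] Py] sy] := sup_adherent d0 hsA.
have ys : y <= s by apply: ub_le_sup; [exact: hsA.2|split => //; rewrite y0].
have Pz z : s <= z < s + d -> P z by move=> zs; apply: (hd y); rewrite ?sy.
suff -> : x = s by apply: Pz; rewrite lexx ltrDl.
apply/eqP; rewrite eq_le sx andbT leNgt; apply/negP => sltx.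
pose z := Num.min x (s + d / 2).
have sz : s < z by rewrite lt_min sltx ltrDl divr_gt0.
have zsd : z < s + d by rewrite gt_min ltrD2l ltr_pdivrMr//; apply/orP; right; lra.
have : z <= s.
  apply: ub_le_sup; first exact: hsA.2.
  split; last by apply: Pz; rewrite ltW.
  by rewrite (le_trans s0 (ltW sz)) ge_min lexx.
by rewrite leNgt sz.
Unshelve. all: by end_near. Qed.

(** Outer regularity encloses the exceptional null set in an open set of measure below the modulus
    of absolute continuity. The intervals supplied by [zero_derive_decomp] are disjoint and lie in
    that open set, so their increments add up to less than e / 2; the remaining increments
    contribute at most e x / 2. *)
Lemma acont01_zero_derive f : acont01 f ->
  {ae mu, forall x : R, 0 < x < 1 -> is_derive x 1 f 0} ->
  forall x : R, 0 <= x <= 1 -> f x = f 0.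
Proof.
move=> acf [N [mN N0 hN]] x /andP[x0 x1].
apply/eqP; rewrite -subr_eq0 -normr_le0; apply/ler_addgt0Pr => e e0.
have e2 : 0 < e / 2 by rewrite divr_gt0.
have [d d0 hd] := acf _ e2.
(* The endpoints join the exceptional set, as the derivative is only known in the open interval. *)
pose E := N `|` [set 0; 1].
have mE : measurable E by apply: measurableU => //; apply: measurableU.
have muE : mu E = 0%E.
  apply/eqP; rewrite eq_le measure_ge0 andbT.
  rewrite (le_trans (measureU2 _ _ _))//; first exact: measurableU.
  rewrite -[leRHS]adde0 leeD//; first by rewrite [leLHS]N0.
  rewrite (le_trans (measureU2 _ _ _))//.
  by rewrite [X in (X + _)%E]lebesgue_measure_set1 add0e [leLHS]lebesgue_measure_set1.
have muEy : (mu E < +oo)%E by rewrite [ltLHS]muE ltry.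
have [U [oU EU muU]] := lebesgue_regularity_outer mE muEy d0.
have mU : measurable U by exact: open_measurable.
have {}muU : (mu U < d%:E)%E.
  rewrite -(setDUK EU) (le_lt_trans (measureU2 _ _ _))//; first exact: measurableD.
  by rewrite [X in (X + _)%E]muE add0e.
have [|n [a [b [H1 H2 H3]]]] := @zero_derive_decomp f E U (e / 2) x e2 x0 oU EU.
  move=> s /andP[s0 s1] nEs.
  have [s0'|s0'] := eqVneq s 0; first by exfalso; apply: nEs; right; left.
  have [s1'|s1'] := eqVneq s 1; first by exfalso; apply: nEs; right; right.
  apply: contrapT => ns; apply: nEs; left; apply: hN => /= h; apply: ns; apply: h.
  by rewrite !lt_neqAle s0 (le_trans s1 x1) eq_sym s0' s1'.
have tI : trivIset [set: 'I_n] (fun i => `]a i, b i[ : set R).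
  apply/trivIsetP => /= i j _ _; rewrite neq_ltn => /orP[ij|ij];
    apply/disjoints_subset => t /=; rewrite !in_itv/= => /andP[t1 t2];
    apply/negP; rewrite negb_and -!leNgt.
    by rewrite (le_trans (ltW t2) (H2 _ _ ij (ltn_ord _))).
  by rewrite (le_trans (H2 _ _ ij (ltn_ord _)) (ltW t1)) orbT.
have : \sum_(i < n) `|f (b i) - f (a i)| < e / 2.
  apply: hd => //.
    by move=> i; have [? ? ? ?] := H1 i (ltn_ord i); split => //; split => //; lra.
  rewrite -lte_fin (le_lt_trans _ muU)// -sumEFin.
  under eq_bigr => i _.
    have [_ ab _ _] := H1 i (ltn_ord i).
    have <- : mu `]a i, b i[ = (b i - a i)%:E.
      rewrite lebesgue_measure_itv/= lte_fin; case: ltgtP ab => // -> _.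
      by rewrite subrr.
    over.
  rewrite -measure_bigsetU_ord// le_measure ?inE//.
    by apply: bigsetU_measurable => i _.
  apply: (big_ind (fun X : set R => X `<=` U)) => [//|X Y XU YU|i _].
    by rewrite subUset.
  by have [_ _ _] := H1 i (ltn_ord i).
move=> ?; rewrite add0r (le_trans H3)//.
have : e / 2 * x <= e / 2 by rewrite ler_piMr// ltW.
lra.
Qed.

(** The closure properties below (sums, differences, products, Lipschitz images) all reduce to such
    a comparison of increments. *)
Lemma acont01_dom2 f g h (L : R) : acont01 g -> acont01 h ->
  (forall a b : R, 0 <= a -> a <= b -> b <= 1 ->
     `|f b - f a| <= L * (`|g b - g a| + `|h b - h a|)) -> acont01 f.
Proof.
move=> acg ach fgh e e0.
pose M := `|L| + 1.
have M0 : 0 < M by rewrite ltr_wpDl.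
have e2 : 0 < e / (2 * M) by rewrite divr_gt0// mulr_gt0.
have [d d0 hd] := acg _ e2; have [d' d'0 hd'] := ach _ e2.
exists (Num.min d d'); first by rewrite lt_min d0.
move=> n a b ab tI; rewrite lt_min => /andP[sd sd'].
have := hd _ _ _ ab tI sd; have := hd' _ _ _ ab tI sd'.
rewrite !ltr_pdivlMr ?mulr_gt0// => h1 h2.
apply: (@le_lt_trans _ _ (M * (\sum_(i < n) `|g (b i) - g (a i)| +
                             \sum_(i < n) `|h (b i) - h (a i)|))).
  rewrite -big_split mulr_sumr ler_sum// => i _; have [a0 [ab1 b1]] := ab i.
  rewrite (le_trans (fgh _ _ a0 ab1 b1))// ler_wpM2r ?addr_ge0//.
  by rewrite (le_trans (ler_norm _))// lerDl.
lra.
Qed.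

Lemma acont01_dom f g (L : R) : acont01 g ->
  (forall a b : R, 0 <= a -> a <= b -> b <= 1 -> `|f b - f a| <= L * `|g b - g a|) ->
  acont01 f.
Proof.
move=> acg fg; have [L0|L0] := leP 0 L.
  apply: (acont01_dom2 (L := L) acg acg) => a b a0 ab b1.
  by rewrite (le_trans (fg _ _ a0 ab b1))// ler_wpM2l// lerDl.
apply: (acont01_dom2 (L := 0) acg acg) => a b a0 ab b1.
by rewrite (le_trans (fg _ _ a0 ab b1))// mul0r mulr_le0_ge0// ltW.
Qed.

Lemma acont01_id : acont01 id.
Proof.
move=> e e0; exists e => // n a b ab _; rewrite [ltRHS]/=; apply: le_lt_trans.
by rewrite ler_sum// => i _; have [_ [? _]] := ab i; rewrite ger0_norm ?subr_ge0.
Qed.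

Lemma acont01_lip f (L : R) :
  (forall a b : R, 0 <= a -> a <= b -> b <= 1 -> `|f b - f a| <= L * (b - a)) -> acont01 f.
Proof.
move=> fl; apply: (acont01_dom (L := L) acont01_id) => a b a0 ab b1.
by rewrite /= [X in _ * X]ger0_norm ?subr_ge0//; exact: fl.
Qed.

Lemma acont01D f g : acont01 f -> acont01 g -> acont01 (f \+ g).
Proof.
move=> acf acg; apply: (acont01_dom2 (L := 1) acf acg) => a b _ _ _ /=.
by rewrite mul1r opprD addrACA ler_normD.
Qed.

Lemma acont01B f g : acont01 f -> acont01 g -> acont01 (f \- g).
Proof.
move=> acf acg; apply: (acont01_dom2 (L := 1) acf acg) => a b _ _ _ /=.
by rewrite mul1r opprD addrACA (le_trans (ler_normD _ _))// -opprD normrN.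
Qed.

(** Walking from 0 in steps of d / 2, where d is the modulus for e = 1, changes the function by at
    most 1 per step, and boundedly many steps reach 1. *)
Lemma acont01_bounded f : acont01 f ->
  exists2 M, 0 <= M & forall x : R, 0 <= x <= 1 -> `|f x| <= M.
Proof.
move=> acf; have [d d0 hd] := acf 1 ltr01.
have key (x y : R) : 0 <= x -> x <= y -> y <= 1 -> y - x < d -> `|f y| <= `|f x| + 1.
  move=> x0 xy y1 yxd; have := hd 1%N (fun=> x) (fun=> y).
  rewrite !big_ord1 => h.
  have {h} : `|f y - f x| < 1 by apply: h => //; apply/trivIsetP => i j _ _; rewrite !ord1.
  by have := ler_normD (f y - f x) (f x); rewrite subrK; lra.
have ind (k : nat) (x : R) : 0 <= x -> x <= 1 -> x <= k%:R * (d / 2) -> `|f x| <= `|f 0| + k%:R.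
  elim: k x => [|k IH] x x0 x1; first by rewrite mul0r addr0 => x0'; have -> : x = 0 by lra.
  have [xk _|xk xk1] := leP x (k%:R * (d / 2)).
    by rewrite (le_trans (IH _ x0 x1 xk))// lerD2l ler_nat.
  have kd : 0 <= k%:R * (d / 2) by rewrite mulr_ge0// divr_ge0// ltW.
  have := IH _ kd (le_trans (ltW xk) x1) (lexx _).
  have := key _ _ kd (ltW xk) x1.
  by move: xk1; rewrite -natr1 mulrDl mul1r => xk1 /(_ ltac:(lra)); lra.
exists (`|f 0| + (Num.bound (2 / d))%:R); first exact: addr_ge0.
move=> x /andP[x0 x1]; apply: ind => //; rewrite (le_trans x1)//.
have : 2 / d < (Num.bound (2 / d))%:R.
  by rewrite archi_boundP// divr_ge0// ltW.
by rewrite ltr_pdivrMr// mulrA ler_pdivlMr// mul1r => /ltW.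
Qed.

Lemma acont01M f g : acont01 f -> acont01 g -> acont01 (f \* g).
Proof.
move=> acf acg; have [M M0 hM] := acont01_bounded acf.
have [M' M'0 hM'] := acont01_bounded acg.
apply: (acont01_dom2 (L := M + M') acf acg) => a b a0 ab b1 /=.
have -> : f b * g b - f a * g a = (f b - f a) * g b + f a * (g b - g a) by ring.
rewrite (le_trans (ler_normD _ _))// !normrM mulrDr lerD//.
  rewrite mulrC ler_wpM2r// (le_trans (hM' b _)) ?lerDr//.
  by rewrite b1 (le_trans a0).
rewrite ler_wpM2r// (le_trans (hM a _)) ?lerDl//.
by rewrite a0 (le_trans ab).
Qed.

(** Absolute continuity of the integral as a set function, applied to the union of the intervals;
    passing between open and half-open intervals costs only null sets. *)
Lemma acont01_integral f : mu.-integrable setT (EFin \o f) ->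
  acont01 (fun x => \int[mu]_(t in `]-oo, x]) f t).
Proof.
move=> intf e e0; have [d [d0 hd]] := integral_normr_continuous intf e0.
exists d => // n a b ab tI sd.
have intfi (A : set R) : measurable A -> mu.-integrable A (EFin \o f).
  by move=> mA; apply: integrableS intf.
have muA i : mu `]a i, b i] = (b i - a i)%:E.
  rewrite lebesgue_measure_itv/= lte_fin; have [_ [+ _]] := ab i.
  by case: ltgtP => // -> _; rewrite subrr.
pose A := \big[setU/set0]_(i < n) (`]a i, b i[ : set R).
have mA : measurable A by apply: bigsetU_measurable.
have muAd : (mu A < d%:E)%E.
  rewrite [ltLHS]measure_bigsetU_ord//=.
  rewrite (le_lt_trans _ (_ : (\sum_(i < n) (b i - a i))%:E < d%:E)%E)// -sumEFin.
  rewrite lee_sum// => i _; rewrite -muA le_measure ?inE//.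
  by apply: subset_itvl; rewrite bnd_simp.
apply: le_lt_trans (hd _ mA muAd).
have intn : mu.-integrable setT (EFin \o Num.norm \o f).
  have -> : EFin \o Num.norm \o f = abse \o (EFin \o f) by [].
  exact: integrable_abse.
rewrite /Rintegral /A integral_bigsetU_EFin ?index_enum_uniq//; first last.
- by apply: measurable_funTS; have /measurable_int := intn.
- exact: sub_trivIset tI.
have intni i : mu.-integrable `]a i, b i[ (EFin \o Num.norm \o f) by apply: integrableS intn.
rewrite -sum_fine; last by move=> i _; apply: integrable_fin_num (intni i).
rewrite ler_sum// => i _; have [_ [abi _]] := ab i.
rewrite Rintegral_itvB ?bnd_simp//; last exact: intfi.
rewrite -Rintegral_itv_bndo_bndc; last exact: intfi.
by apply: le_normr_Rintegral => //; exact: intfi.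
Qed.

End AbsCont.

(** * Integrals of complex-valued functions *)

Section ComplexIntegral.
Variable R : realType.
Local Notation C := R[i].
Local Notation Re := (@complex.Re R).
Local Notation Im := (@complex.Im R).
Local Notation mu := (@lebesgue_measure R).
Implicit Types (z w : C).

Lemma ReD z w : Re (z + w) = Re z + Re w. Proof. by case: z; case: w. Qed.
Lemma ImD z w : Im (z + w) = Im z + Im w. Proof. by case: z; case: w. Qed.
Lemma ReN z : Re (- z) = - Re z. Proof. by case: z. Qed.
Lemma ImN z : Im (- z) = - Im z. Proof. by case: z. Qed.
Lemma ReM z w : Re (z * w) = Re z * Re w - Im z * Im w.
Proof. by case: z; case: w. Qed.
Lemma ImM z w : Im (z * w) = Re z * Im w + Im z * Re w.
Proof. by case: z; case: w. Qed.
Definition ReImE := (ReD, ImD, ReN, ImN, ReM, ImM).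

Lemma ReIm_eq z w : Re z = Re w -> Im z = Im w -> z = w.
Proof. by case: z; case: w => ? ? ? ? /= -> ->. Qed.

Lemma Re_sum I (s : seq I) (P : pred I) (F : I -> C) :
  Re (\sum_(i <- s | P i) F i) = \sum_(i <- s | P i) Re (F i).
Proof. by apply: (big_morph Re ReD). Qed.
Lemma Im_sum I (s : seq I) (P : pred I) (F : I -> C) :
  Im (\sum_(i <- s | P i) F i) = \sum_(i <- s | P i) Im (F i).
Proof. by apply: (big_morph Im ImD). Qed.

(* An l^1 modulus: unlike [normc] it bounds integrals by a componentwise argument. *)
Definition cabs1 z : R := `|Re z| + `|Im z|.
Local Notation N := cabs1.

Lemma cabs1_ge0 z : 0 <= N z. Proof. exact: addr_ge0. Qed.
Lemma cabs1_0 : N 0 = 0. Proof. by rewrite /N /= normr0 addr0. Qed.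
Lemma cabs1D z w : N (z + w) <= N z + N w.
Proof. by rewrite /N !ReImE addrACA lerD// ler_normD. Qed.
Lemma cabs1M z w : N (z * w) <= N z * N w.
Proof.
rewrite /N !ReImE (le_trans (lerD (ler_normB _ _) (ler_normD _ _)))//.
by rewrite !normrM; lra.
Qed.
Lemma cabs1_sum I (s : seq I) (P : pred I) (F : I -> C) :
  N (\sum_(i <- s | P i) F i) <= \sum_(i <- s | P i) N (F i).
Proof.
elim/big_ind2 : _ => [|x x' y y' h h'|//]; first by rewrite cabs1_0.
by rewrite (le_trans (cabs1D _ _))// lerD.
Qed.
Lemma normc_ReIm z : Normc.normc z = Num.sqrt (Re z ^+ 2 + Im z ^+ 2).
Proof. by case: z. Qed.
Lemma normc_le_cabs1 z : Normc.normc z <= N z.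
Proof.
rewrite normc_ReIm -(ler_pXn2r (n := 2)) ?nnegrE ?sqrtr_ge0 ?cabs1_ge0//.
rewrite sqr_sqrtr ?addr_ge0 ?sqr_ge0// sqrrD !real_normK ?num_real//.
by rewrite lerD2r lerDl mulrn_wge0// mulr_ge0.
Qed.
Lemma Re_le_normc z : `|Re z| <= Normc.normc z.
Proof. by rewrite normc_ReIm -sqrtr_sqr ler_wsqrtr// lerDl sqr_ge0. Qed.
Lemma Im_le_normc z : `|Im z| <= Normc.normc z.
Proof. by rewrite normc_ReIm -sqrtr_sqr ler_wsqrtr// lerDr sqr_ge0. Qed.
Lemma cabs1_le_normc z : N z <= 2 * Normc.normc z.
Proof. by rewrite mulr_natl mulr2n lerD// ?Re_le_normc ?Im_le_normc. Qed.
Lemma normc_ge0 z : 0 <= Normc.normc z.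
Proof. by rewrite normc_ReIm sqrtr_ge0. Qed.

Section Measurability.
Context d (T : measurableType d).
Implicit Types f g : T -> C.

Definition cmeas f := measurable_fun setT (fun t => Re (f t)) /\
  measurable_fun setT (fun t => Im (f t)).

Lemma cmeas_cst z : cmeas (fun=> z). Proof. by split; exact: measurable_cst. Qed.
Lemma cmeasD f g : cmeas f -> cmeas g -> cmeas (fun t => f t + g t).
Proof.
move=> [? ?] [? ?]; split.
  by under eq_fun do rewrite ReD; exact: measurable_funD.
by under eq_fun do rewrite ImD; exact: measurable_funD.
Qed.
Lemma cmeasM f g : cmeas f -> cmeas g -> cmeas (fun t => f t * g t).
Proof.
move=> [? ?] [? ?]; split.
  by under eq_fun do rewrite ReM; apply: measurable_funB; exact: measurable_funM.
by under eq_fun do rewrite ImM; apply: measurable_funD; exact: measurable_funM.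
Qed.
Lemma cmeasN f : cmeas f -> cmeas (fun t => - f t).
Proof.
move=> [? ?]; split.
  by under eq_fun do rewrite ReN; exact: measurableT_comp.
by under eq_fun do rewrite ImN; exact: measurableT_comp.
Qed.
Lemma cmeasB f g : cmeas f -> cmeas g -> cmeas (fun t => f t - g t).
Proof. by move=> mf mg; apply: cmeasD => //; exact: cmeasN. Qed.
Lemma cmeas_if (b : T -> bool) f g : measurable_fun setT b -> cmeas f -> cmeas g ->
  cmeas (fun t => if b t then f t else g t).
Proof.
move=> mb [? ?] [? ?]; split.
  by under eq_fun do rewrite (fun_if Re); exact: measurable_fun_ifT.
by under eq_fun do rewrite (fun_if Im); exact: measurable_fun_ifT.
Qed.
Lemma cmeas_sum n (f : nat -> T -> C) : (forall i, cmeas (f i)) ->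
  cmeas (fun t => \sum_(i < n) f i t).
Proof.
move=> mf; elim: n => [|n IH].
  by under eq_fun do rewrite big_ord0; exact: cmeas_cst.
by under eq_fun do rewrite big_ord_recr; exact: cmeasD.
Qed.
Lemma measurable_cabs1 f : cmeas f -> measurable_fun setT (fun t => N (f t)).
Proof. by move=> [? ?]; apply: measurable_funD; exact: measurableT_comp. Qed.

End Measurability.

Lemma cmeas_comp d d' (T : measurableType d) (T' : measurableType d') (g : T' -> T) (f : T -> C) :
  measurable_fun setT g -> cmeas f -> cmeas (fun t => f (g t)).
Proof.
by move=> mg [h1 h2]; split; [exact: (measurableT_comp h1 mg)|exact: (measurableT_comp h2 mg)].
Qed.

Lemma measurable_cabs1E d (T : measurableType d) (f : T -> C) : cmeas f ->
  measurable_fun setT (fun t => (N (f t))%:E).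
Proof. by move=> mf; apply/measurable_EFinP; exact: measurable_cabs1. Qed.

Lemma ge0_le_integralT d (T : measurableType d) (m : {measure set T -> \bar R})
    (f g : T -> \bar R) :
  (forall t, (0 <= f t)%E) -> measurable_fun setT f -> measurable_fun setT g ->
  (forall t, (f t <= g t)%E) -> (\int[m]_t f t <= \int[m]_t g t)%E.
Proof. by move=> f0 mf mg fg; exact: ge0_le_integral. Qed.

(** Integration is always over the whole line: functions on [0, 1] are extended by zero and a
    variable upper limit is an [if] in the integrand, so that reflections, shifts and exchanges of
    order need no bookkeeping of domains. *)
Definition cint (f : R -> C) : C := cintegral setT f.

Definition cintegrable (f : R -> C) := cmeas f /\
  (\int[mu]_t (N (f t))%:E < +oo)%E.

Lemma cintegrable_Re f : cintegrable f -> mu.-integrable setT (fun t => (Re (f t))%:E).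
Proof.
move=> [mf foo]; apply/integrableP; split; first by apply/measurable_EFinP; exact: mf.1.
apply: le_lt_trans foo; apply: ge0_le_integralT => //.
- by apply/measurable_EFinP; apply: measurableT_comp => //; exact: mf.1.
- exact: measurable_cabs1E.
- by move=> t; rewrite lee_fin lerDl.
Qed.
Lemma cintegrable_Im f : cintegrable f -> mu.-integrable setT (fun t => (Im (f t))%:E).
Proof.
move=> [mf foo]; apply/integrableP; split; first by apply/measurable_EFinP; exact: mf.2.
apply: le_lt_trans foo; apply: ge0_le_integralT => //.
- by apply/measurable_EFinP; apply: measurableT_comp => //; exact: mf.2.
- exact: measurable_cabs1E.
- by move=> t; rewrite lee_fin lerDr.
Qed.

Lemma cintegrable_le f (G : R -> \bar R) : cmeas f -> measurable_fun setT G ->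
  (forall t, ((N (f t))%:E <= G t)%E) -> (\int[mu]_t G t < +oo)%E -> cintegrable f.
Proof.
move=> mf mG fG Goo; split => //; apply: le_lt_trans Goo.
apply: ge0_le_integralT => //.
- by move=> t; rewrite lee_fin cabs1_ge0.
- exact: measurable_cabs1E.
Qed.

Lemma cintD f g : cintegrable f -> cintegrable g ->
  cint (fun t => f t + g t) = cint f + cint g.
Proof.
move=> fi gi; apply: ReIm_eq; rewrite !ReImE /=.
  by under eq_Rintegral do rewrite ReD; rewrite RintegralD//; exact: cintegrable_Re.
by under eq_Rintegral do rewrite ImD; rewrite RintegralD//; exact: cintegrable_Im.
Qed.

Lemma cintZ z f : cintegrable f -> cint (fun t => z * f t) = z * cint f.
Proof.
move=> fi; have h1 := cintegrable_Re fi; have h2 := cintegrable_Im fi.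
have Z (a : R) (h : R -> R) : mu.-integrable setT (EFin \o h) ->
  mu.-integrable setT (EFin \o (fun t => a * h t)).
  by move=> ih; apply: eq_integrable (integrableZl measurableT a ih) => // x _ /=; rewrite EFinM.
apply: ReIm_eq; rewrite !ReImE /=.
  under eq_Rintegral do rewrite ReM.
  by rewrite RintegralB// ?RintegralZl//; exact: Z.
under eq_Rintegral do rewrite ImM.
by rewrite RintegralD// ?RintegralZl//; exact: Z.
Qed.

Lemma cintegrableZ z f : cintegrable f -> cintegrable (fun t => z * f t).
Proof.
move=> [mf foo]; have mz : cmeas (fun t => z * f t) by exact: cmeasM (cmeas_cst _ _) mf.
apply: (@cintegrable_le _ (fun t => (N z)%:E * (N (f t))%:E)%E) => //.
- by apply: measurable_funeM; apply/measurable_EFinP; exact: measurable_cabs1.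
- by move=> t; rewrite -EFinM lee_fin cabs1M.
- rewrite ge0_integralZl//; last 3 first.
  + by apply/measurable_EFinP; exact: measurable_cabs1.
  + by move=> t _; rewrite lee_fin cabs1_ge0.
  + by rewrite lee_fin cabs1_ge0.
  by rewrite lte_mul_pinfty// lee_fin cabs1_ge0.
Qed.

Lemma cintegrableD f g : cintegrable f -> cintegrable g -> cintegrable (fun t => f t + g t).
Proof.
move=> [mf foo] [mg goo].
have mNf : measurable_fun setT (fun t => (N (f t))%:E).
  by apply/measurable_EFinP; exact: measurable_cabs1.
have mNg : measurable_fun setT (fun t => (N (g t))%:E).
  by apply/measurable_EFinP; exact: measurable_cabs1.
apply: (@cintegrable_le _ (fun t => (N (f t))%:E + (N (g t))%:E)%E) => //.
- exact: cmeasD.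
- exact: emeasurable_funD.
- by move=> t; rewrite -EFinD lee_fin cabs1D.
- rewrite ge0_integralD//; first by rewrite lte_add_pinfty.
    by move=> t _; rewrite lee_fin cabs1_ge0.
  by move=> t _; rewrite lee_fin cabs1_ge0.
Qed.

Lemma cint0 : cint (fun=> 0) = 0.
Proof.
by apply: ReIm_eq => /=; rewrite Rintegral_cst// mul0r.
Qed.

Lemma cintegrable0 : cintegrable (fun=> 0).
Proof.
split; first exact: cmeas_cst.
by under eq_integral do rewrite cabs1_0; rewrite integral0.
Qed.

Lemma cint_sum n (f : nat -> R -> C) : (forall i, cintegrable (f i)) ->
  cintegrable (fun t => \sum_(i < n) f i t) /\
  cint (fun t => \sum_(i < n) f i t) = \sum_(i < n) cint (f i).
Proof.
move=> fi; elim: n => [|n [IH1 IH2]].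
  under eq_fun do rewrite big_ord0; rewrite big_ord0 cint0; split => //.
  exact: cintegrable0.
under eq_fun do rewrite big_ord_recr; rewrite big_ord_recr/= -IH2; split.
  exact: cintegrableD.
by rewrite cintD.
Qed.

Lemma eq_cint f g : f =1 g -> cint f = cint g.
Proof. by move=> /funext ->. Qed.

Lemma cintB f g : cintegrable f -> cintegrable g ->
  cint (fun t => f t - g t) = cint f - cint g.
Proof.
move=> fi gi; rewrite -[in RHS]mulN1r -cintZ// -cintD//; last exact: cintegrableZ.
by apply: eq_cint => t; rewrite mulN1r.
Qed.

(** For the l^1 modulus this is the real inequality for each component, added up. Integrability can
    be left out because an infinite right-hand side makes the claim trivial. *)
Lemma cabs1_cint_le f : cmeas f -> ((N (cint f))%:E <= \int[mu]_t (N (f t))%:E)%E.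
Proof.
move=> mf; have [foo|] := ltP (\int[mu]_t (N (f t))%:E)%E +oo%E; last first.
  by rewrite leye_eq => /eqP ->; rewrite leey.
have fi : cintegrable f by [].
rewrite /cint/cintegral /N /= EFinD.
have -> : (\int[mu]_t (`|Re (f t)| + `|Im (f t)|)%:E = 
  \int[mu]_t (`|Re (f t)|)%:E + \int[mu]_t (`|Im (f t)|)%:E)%E.
  under eq_integral do rewrite EFinD; rewrite ge0_integralD//.
    by apply/measurable_EFinP; apply: measurableT_comp => //; exact: mf.1.
  by apply/measurable_EFinP; apply: measurableT_comp => //; exact: mf.2.
rewrite !EFin_normr_Rintegral//; last 2 first.
- exact: cintegrable_Im.
- exact: cintegrable_Re.
apply: leeD; apply: le_abse_integral => //; apply/measurable_EFinP.
  exact: mf.1.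
exact: mf.2.
Qed.

Lemma measurable_integral_param d (T : measurableType d) (f : T * R -> \bar R) :
  measurable_fun setT f -> (forall p, (0 <= f p)%E) ->
  measurable_fun setT (fun x => \int[mu]_y f (x, y))%E.
Proof. by move=> mf f0; exact: (@measurable_fun_fubini_tonelli_F _ _ T _ R mu f). Qed.

Lemma integral_Tonelli (f : R * R -> \bar R) :
  measurable_fun setT f -> (forall p, (0 <= f p)%E) ->
  (\int[mu]_x \int[mu]_y f (x, y) = \int[mu]_y \int[mu]_x f (x, y))%E.
Proof. by move=> mf f0; exact: (@fubini_tonelli _ _ _ _ R mu mu f mf f0). Qed.

Lemma measurable_Rintegral_param d (T : measurableType d) (f : T * R -> R) :
  measurable_fun setT f -> measurable_fun setT (fun x => \int[mu]_y (f (x, y))).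
Proof.
move=> mf; apply: measurableT_comp; first exact: fine_measurable.
have mf' : measurable_fun setT (EFin \o f) by exact/measurable_EFinP.
under eq_fun do rewrite integralE.
apply: emeasurable_funB.
  have -> : (fun x => \int[mu]_y ((EFin \o (fun y => f (x, y)))^\+ y))%E =
            (fun x => \int[mu]_y ((EFin \o f)^\+ (x, y)))%E.
    by apply/funext => x; apply: eq_integral => y _; rewrite !funeposE.
  by apply: measurable_fun_fubini_tonelli_F => //; exact: measurable_funepos.
have -> : (fun x => \int[mu]_y ((EFin \o (fun y => f (x, y)))^\- y))%E =
          (fun x => \int[mu]_y ((EFin \o f)^\- (x, y)))%E.
  by apply/funext => x; apply: eq_integral => y _; rewrite !funenegE.
by apply: measurable_fun_fubini_tonelli_F => //; exact: measurable_funeneg.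
Qed.

Lemma cmeas_cint_param d (T : measurableType d) (f : T * R -> C) :
  cmeas f -> cmeas (fun x => cint (fun y => f (x, y))).
Proof.
by move=> [? ?]; split => /=;
  [exact: (measurable_Rintegral_param (f := fun p => Re (f p)))|
   exact: (measurable_Rintegral_param (f := fun p => Im (f p)))].
Qed.

(** A real-valued inner integral agrees with the extended one only on sections that are integrable.
    Almost all of them are, and the outer integral ignores the rest. *)
Lemma Rintegral_Fubini (f : R * R -> R) :
  (mu \x mu)%E.-integrable setT (EFin \o f) ->
  \int[mu]_x (\int[mu]_y f (x, y)) = \int[mu]_y (\int[mu]_x f (x, y)).
Proof.
move=> fi; rewrite {1 3}/Rintegral; congr fine.
transitivity (\int[mu]_x \int[mu]_y (f (x, y))%:E)%E.
  apply: ae_eq_integral => //.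
  - apply/measurable_EFinP; apply: measurable_Rintegral_param.
    by apply/measurable_EFinP; exact: measurable_int fi.
  - exact: (measurable_fubini_F fi).
  - have := ae_integrable1 fi; apply: filterS => x ix _.
    by rewrite fineK//; exact: integrable_fin_num ix.
rewrite [LHS](Fubini fi); apply/esym.
apply: ae_eq_integral => //.
- apply/measurable_EFinP.
  apply: (@measurable_Rintegral_param _ _ (fun p => f (p.2, p.1))).
  apply: (measurableT_comp (f := f)); last exact: measurable_swap.
  by apply/measurable_EFinP; exact: measurable_int fi.
- exact: (measurable_fubini_G fi).
- have := ae_integrable2 fi; apply: filterS => x ix _.
  by rewrite fineK//; exact: integrable_fin_num ix.
Qed.

Lemma cint_Fubini (f : R * R -> C) : cmeas f ->
  (\int[mu]_x \int[mu]_y (N (f (x, y)))%:E < +oo)%E ->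
  cint (fun x => cint (fun y => f (x, y))) = cint (fun y => cint (fun x => f (x, y))).
Proof.
move=> mf foo.
have h (g : R * R -> R) : measurable_fun setT g -> (forall p, `|g p| <= N (f p)) ->
  (mu \x mu)%E.-integrable setT (EFin \o g).
  move=> mg gN; apply/integrable12ltyP; first exact/measurable_EFinP.
  apply: le_lt_trans foo; apply: ge0_le_integralT => //.
  - by move=> x; exact: integral_ge0.
  - apply: (@measurable_integral_param _ R (abse \o (EFin \o g))) => //.
      by apply: measurableT_comp => //; exact/measurable_EFinP.
    by move=> p; rewrite abse_ge0.
  - have := measurable_integral_param (measurable_cabs1E mf) ; apply.
    by move=> x; rewrite lee_fin cabs1_ge0.
  - move=> x; apply: ge0_le_integralT => //.
    + apply: measurableT_comp => //; apply/measurable_EFinP.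
      by apply: (measurableT_comp mg).
    + apply: measurable_cabs1E.
      exact: (cmeas_comp (measurable_pair1 x) mf).
    + by move=> y; rewrite lee_fin; exact: gN.
apply: ReIm_eq => /=.
  by apply: (Rintegral_Fubini (f := fun p => Re (f p))); apply: h;
    [exact: mf.1|move=> z; rewrite lerDl].
by apply: (Rintegral_Fubini (f := fun p => Im (f p))); apply: h;
    [exact: mf.2|move=> z; rewrite lerDr].
Qed.

End ComplexIntegral.

(** * Affine changes of variable on the line *)

Section AffineChange.
Variable R : realType.
Local Notation mu := (@lebesgue_measure R).

Lemma measurable_affine (a b : R) : measurable_fun setT (fun t : R => a * t + b).
Proof. by apply: measurable_funD => //; exact: measurable_funM. Qed.

Lemma lebesgue_measure_affine_itv (a b x y : R) : a != 0 ->
  mu `]x, y] = (`|a|%:E * mu ((fun t : R => a * t + b)%R @^-1` `]x, y]))%E.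
Proof.
move=> a0; have [agt0|ale0] := ltP 0 a.
  have -> : (fun t : R => a * t + b) @^-1` `]x, y] = `](x - b) / a, (y - b) / a].
    apply/seteqP; split => t /=; rewrite !in_itv/= ltr_pdivrMr// ler_pdivlMr//
      -ltrBlDr -lerBrDr; by rewrite mulrC.
  rewrite !lebesgue_measure_itv/= !lte_fin ltr_pM2r ?invr_gt0// ltrD2r gtr0_norm//.
  case: ifPn => _; last by rewrite mule0.
  by rewrite -!EFinB -EFinM; congr EFin; field.
have alt0 : a < 0 by rewrite lt_neqAle a0.
have -> : (fun t : R => a * t + b) @^-1` `]x, y] = `[(y - b) / a, (x - b) / a[.
  apply/seteqP; split => t /=; rewrite !in_itv/= ler_ndivrMr// ltr_ndivlMr//
    -ltrBlDr -lerBrDr andbC; by rewrite mulrC.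
rewrite !lebesgue_measure_itv/= !lte_fin ltr_nM2r ?invr_lt0// ltrD2r ltr0_norm//.
case: ifPn => _; last by rewrite mule0.
by rewrite -!EFinB -EFinM; congr EFin; field.
Qed.

(** The image of Lebesgue measure under the affine map, multiplied by |a|, agrees with Lebesgue
    measure on half-open intervals, hence on all Borel sets. *)
Lemma ge0_integral_affine (a b : R) (f : R -> \bar R) : a != 0 ->
  measurable_fun setT f -> (forall t, 0 <= f t)%E ->
  (\int[mu]_t f t = `|a|%:E * \int[mu]_t f (a * t + b)%R)%E.
Proof.
move=> a0 mf f0.
have mphi := measurable_affine a b.
have := @ge0_integral_pushforward _ _ (measurableTypeR R) (measurableTypeR R) R _ mphi mu setT f measurableT mf (fun t _ => f0 t).
rewrite preimage_setT => <-.
pose k := NngNum (normr_ge0 a).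
rewrite -[X in X%:E](_ : k%:num = `|a|)//.
rewrite -ge0_integral_mscale//; apply: eq_measure_integral => A mA _.
apply: lebesgue_measure_unique => // _ [[x y] _ <-]; exact: lebesgue_measure_affine_itv.
Qed.

Lemma integral_reflect (x : R) (f : R -> \bar R) :
  measurable_fun setT f -> (forall t, 0 <= f t)%E ->
  (\int[mu]_t f (x - t)%R = \int[mu]_t f t)%E.
Proof.
move=> mf f0; rewrite (@ge0_integral_affine (-1) x f) ?oppr_eq0// normrN normr1 mul1e.
by apply: eq_integral => t _; rewrite mulN1r addrC.
Qed.

Lemma ge0_integral_affineV (a b : R) (f : R -> \bar R) : a != 0 ->
  measurable_fun setT f -> (forall t, 0 <= f t)%E ->
  (\int[mu]_t f (a * t + b)%R = `|a|^-1%:E * \int[mu]_t f t)%E.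
Proof.
move=> a0 mf f0; rewrite (@ge0_integral_affine a b f)// muleA -EFinM.
by rewrite mulVf ?normr_eq0// mul1e.
Qed.

Lemma integrable_affine (a b : R) (f : R -> R) : a != 0 ->
  mu.-integrable setT (EFin \o f) -> mu.-integrable setT (EFin \o (fun t => f (a * t + b))).
Proof.
move=> a0 /integrableP[mf foo].
have mf' : measurable_fun setT (EFin \o (fun t => f (a * t + b))).
  exact: (measurableT_comp mf (measurable_affine a b)).
apply/integrableP; split => //.
have := @ge0_integral_affineV a b (abse \o (EFin \o f)) a0
  (measurableT_comp (@abse_measurable _ setT) mf) (fun=> abse_ge0 _).
by move=> ->; rewrite lte_mul_pinfty// lee_fin invr_ge0.
Qed.

Lemma Rintegral_affine (a b : R) (f : R -> R) : a != 0 ->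
  mu.-integrable setT (EFin \o f) ->
  \int[mu]_t f t = `|a| * \int[mu]_t f (a * t + b).
Proof.
move=> a0 fi; have fi' := integrable_affine b a0 fi; rewrite /Rintegral.
have mf' : measurable_fun setT (EFin \o f) by exact: measurable_int fi.
rewrite -[X in X * _]/(fine `|a|%:E) -fineM//; last exact: integrable_fin_num.
congr fine; rewrite integralE [in RHS]integralE.
rewrite (@ge0_integral_affine a b _ a0 (measurable_funepos mf'))//.
rewrite (@ge0_integral_affine a b _ a0 (measurable_funeneg mf'))//.
rewrite -muleBr//; last first.
  apply: fin_num_adde_defl; rewrite fin_numN.
  apply: integrable_fin_num => //.
  by apply: eq_integrable (integrable_funeneg measurableT fi') => // t _; rewrite !funenegE.
congr (_ * (_ - _))%E; apply: eq_integral => t _.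
  by rewrite !funeposE.
by rewrite !funenegE.
Qed.

Lemma cintegrable_affine (a b : R) (f : R -> R[i]) : a != 0 -> cintegrable f ->
  cintegrable (fun t => f (a * t + b)).
Proof.
move=> a0 [mf foo]; split; first exact: cmeas_comp (measurable_affine a b) mf.
rewrite (@ge0_integral_affineV a b (fun t => (cabs1 (f t))%:E) a0 (measurable_cabs1E mf)).
  by rewrite lte_mul_pinfty// lee_fin invr_ge0.
by move=> t; rewrite lee_fin cabs1_ge0.
Qed.

Lemma cint_affine (a b : R) (f : R -> R[i]) : a != 0 -> cintegrable f ->
  cint f = `|a|%:C%C * cint (fun t => f (a * t + b)).
Proof.
move=> a0 fi; apply: ReIm_eq; rewrite !ReImE /= mul0r ?addr0 ?subr0.
  by rewrite (@Rintegral_affine a b (fun t => complex.Re (f t)))//; exact: cintegrable_Re.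
by rewrite (@Rintegral_affine a b (fun t => complex.Im (f t)))//; exact: cintegrable_Im.
Qed.

Lemma cint_reflect (x : R) (f : R -> R[i]) : cintegrable f ->
  cint (fun t => f (x - t)) = cint f.
Proof.
move=> fi; rewrite [RHS](@cint_affine (-1) x) ?oppr_eq0// normrN normr1 mul1r.
by apply: eq_cint => t; rewrite mulN1r addrC.
Qed.
End AffineChange.

(** * Complex series and termwise integration *)

Section ComplexSeries.
Variable R : realType.
Local Notation C := R[i].
Local Notation mu := (@lebesgue_measure R).
Local Notation N := (@cabs1 R).

(* Componentwise convergence, which avoids putting a topology on [R[i]]. *)
Definition ccvg (z : nat -> C) (l : C) :=
  (complex.Re (z n) @[n --> \oo] --> complex.Re l) /\
  (complex.Im (z n) @[n --> \oo] --> complex.Im l).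

Lemma ccvg_unique z l l' : ccvg z l -> ccvg z l' -> l = l'.
Proof.
by move=> [h1 h2] [h1' h2']; apply: ReIm_eq;
  [exact: cvg_unique h1 h1'|exact: cvg_unique h2 h2'].
Qed.

Lemma ccvg_shift z l : ccvg z l -> ccvg (fun n => z n.+1) l.
Proof.
move=> [h1 h2]; split.
  by move: h1; rewrite -(cvg_shiftS (fun n => complex.Re (z n))).
by move: h2; rewrite -(cvg_shiftS (fun n => complex.Im (z n))).
Qed.

Lemma ccvgD z l z' l' : ccvg z l -> ccvg z' l' -> ccvg (fun n => z n + z' n) (l + l').
Proof.
move=> [h1 h2] [h1' h2']; split.
  by rewrite ReD; under eq_fun do rewrite ReD; exact: cvgD.
by rewrite ImD; under eq_fun do rewrite ImD; exact: cvgD.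
Qed.

Lemma ccvg_cst l : ccvg (fun=> l) l. Proof. by split; exact: cvg_cst. Qed.

Lemma ccvgMl a z l : ccvg z l -> ccvg (fun n => a * z n) (a * l).
Proof.
move=> [h1 h2]; split.
  rewrite ReM; under eq_fun do rewrite ReM.
  by apply: cvgB; apply: cvgM => //; exact: cvg_cst.
rewrite ImM; under eq_fun do rewrite ImM.
by apply: cvgD; apply: cvgM => //; exact: cvg_cst.
Qed.

Lemma cabs1_ccvg_le z l (M : R) : ccvg z l -> (forall n, N (z n) <= M) -> N l <= M.
Proof.
move=> [h1 h2] hM.
have : (`|complex.Re (z n)| + `|complex.Im (z n)|) @[n --> \oo] --> N l.
  by apply: cvgD; apply: cvg_norm.
move=> h; rewrite -(cvg_lim _ h)//; apply: limr_le; first by apply/cvg_ex; exists (N l).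
by near=> n; exact: hM.
Unshelve. all: by end_near. Qed.

Definition csum (f : nat -> C) : C :=
  Complex (limn (fun n => \sum_(i < n) complex.Re (f i)))
  (limn (fun n => \sum_(i < n) complex.Im (f i))).

Lemma csum_cvg (f : nat -> C) (M : R) : (forall n, \sum_(i < n) N (f i) <= M) ->
  ccvg (fun n => \sum_(i < n) f i) (csum f) /\ N (csum f) <= M.
Proof.
move=> fM.
have h (g : nat -> R) : (forall i, `|g i| <= N (f i)) -> cvgn (fun n => \sum_(i < n) g i).
  move=> gN; have -> : (fun n => \sum_(i < n) g i) = series g.
    by apply/funext => n; rewrite /series/= big_mkord.
  apply: normed_cvg; apply: nondecreasing_is_cvgn.
    by apply: nondecreasing_series => i _ _; rewrite normr_ge0.
  exists M => _ [n _ <-]; rewrite /normed_series_of /series/= big_mkord (le_trans _ (fM n))//.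
  by rewrite ler_sum.
have cv : ccvg (fun n => \sum_(i < n) f i) (csum f).
  split => /=.
    by under eq_fun do rewrite Re_sum; apply: (h (fun i => complex.Re (f i))) => i; rewrite lerDl.
  by under eq_fun do rewrite Im_sum; apply: (h (fun i => complex.Im (f i))) => i; rewrite lerDr.
split => //; apply: cabs1_ccvg_le cv _ => n.
by rewrite (le_trans (cabs1_sum _ _ _)).
Qed.

(** Dominated convergence for the partial sums. The value 0 where [G] is infinite, a null set, makes
    the bound by [G] hold at every point and not just almost everywhere. *)
Lemma cint_csum (f : nat -> R -> C) (G : R -> \bar R) :
  (forall n, cmeas (f n)) -> measurable_fun setT G -> (\int[mu]_t G t < +oo)%E ->
  (forall n t, (\sum_(i < n) (N (f i t))%:E <= G t)%E) ->
  let g := fun t => if (G t < +oo)%E then csum (f^~ t) else 0 in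
  [/\ cintegrable g, forall t, ((N (g t))%:E <= G t)%E &
      ccvg (fun n => \sum_(i < n) cint (f i)) (cint g)].
Proof.
move=> mf mG Goo fG g.
have G0 t : (0 <= G t)%E by have := fG 0%N t; rewrite big_ord0.
have mb : measurable_fun setT (fun t => (G t < +oo)%E).
  exact: measurable_fun_lte.
pose f' i t := if (G t < +oo)%E then f i t else 0.
have mf' i : cmeas (f' i) by apply: cmeas_if => //; exact: cmeas_cst.
have fM t n : (G t < +oo)%E -> \sum_(i < n) N (f i t) <= fine (G t).
  by move=> Gt; rewrite -lee_fin -sumEFin fineK ?fG// ge0_fin_numE.
have cvg t : ccvg (fun n => \sum_(i < n) f' i t) (g t) /\ ((N (g t))%:E <= G t)%E.
  rewrite /f' /g; case: ifPn => Gt; last first.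
    rewrite cabs1_0; split => //.
    by under eq_fun do rewrite big1//; exact: ccvg_cst.
  have [c1 c2] := @csum_cvg (f^~ t) _ (fun n => fM t n Gt); split => //.
  by rewrite -[leRHS]fineK ?lee_fin// ge0_fin_numE.
have Gi : mu.-integrable setT G.
  apply/integrableP; split => //.
  by under eq_integral do rewrite gee0_abs//.
have mS n : cmeas (fun t => \sum_(i < n) f' i t) by exact: cmeas_sum.
have mg : cmeas g.
  split.
    by apply: (measurable_fun_cvg (fun n => (mS n).1)) => t _; exact: (cvg t).1.1.
  by apply: (measurable_fun_cvg (fun n => (mS n).2)) => t _; exact: (cvg t).1.2.
have fi i : cintegrable (f i).
  apply: (cintegrable_le (G := G)) => // t.
  apply: le_trans (fG i.+1 t); rewrite big_ord_recr/= leeDr// sume_ge0// => j _.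
  by rewrite lee_fin cabs1_ge0.
have Gae : {ae mu, forall t, (G t < +oo)%E}.
  have := integrable_ae measurableT Gi; apply: filterS => t /(_ I).
  by rewrite ge0_fin_numE.
split => //.
- by apply: (cintegrable_le (G := G)) => // t; exact: (cvg t).2.
- by move=> t; exact: (cvg t).2.
- have SE n : \sum_(i < n) cint (f i) = cint (fun t => \sum_(i < n) f' i t).
    rewrite -(cint_sum n fi).2; apply: ReIm_eq => /=.
      congr fine; apply: ae_eq_integral => //.
      + by apply/measurable_EFinP; exact: (cint_sum n fi).1.1.1.
      + by apply/measurable_EFinP; exact: (mS n).1.
      + by have := Gae; apply: (@filterS _ _ (ae_filter_ringOfSetsType _)) => t Gt _; congr (complex.Re _)%:E; apply: eq_bigr => i _; rewrite /f' Gt.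
    congr fine; apply: ae_eq_integral => //.
    + by apply/measurable_EFinP; exact: (cint_sum n fi).1.1.2.
    + by apply/measurable_EFinP; exact: (mS n).2.
    + by have := Gae; apply: (@filterS _ _ (ae_filter_ringOfSetsType _)) => t Gt _; congr (complex.Im _)%:E; apply: eq_bigr => i _; rewrite /f' Gt.
  have SG t n : ((N (\sum_(i < n) f' i t))%:E <= G t)%E.
    apply: le_trans (fG n t); rewrite sumEFin lee_fin (le_trans (cabs1_sum _ _ _))//.
    by rewrite ler_sum// => i _; rewrite /f'; case: ifP => // _; rewrite cabs1_0 cabs1_ge0.
  have DCT (h : nat -> R -> R) (k : R -> R) : (forall n, measurable_fun setT (h n)) ->
      measurable_fun setT k -> (forall t, h n t @[n --> \oo] --> k t) ->
      (forall n t, (`|h n t|%:E <= G t)%E) ->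
      (\int[mu]_t h n t) @[n --> \oo] --> \int[mu]_t k t.
    move=> mh mk hk hG.
    have [] := @dominated_convergence _ _ _ mu setT measurableT
      (fun n t => (h n t)%:E) (fun t => (k t)%:E) G.
    - by move=> n; apply/measurable_EFinP; exact: mh.
    - exact/measurable_EFinP.
    - by apply: nearW => t _; apply/fine_cvgP; split; [by apply: nearW|exact: hk].
    - exact: Gi.
    - by apply: nearW => t n _; exact: hG.
    - move=> ki _ c; apply: fine_cvg; rewrite fineK; first exact: c.
      exact: integrable_fin_num.
  split; under eq_fun do rewrite SE; apply: DCT => [n||t|n t].
  + exact: (mS n).1.
  + exact: mg.1.
  + exact: (cvg t).1.1.
  + by apply: le_trans (SG t n); rewrite lee_fin lerDl.
  + exact: (mS n).2.
  + exact: mg.2.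
  + exact: (cvg t).1.2.
  + by apply: le_trans (SG t n); rewrite lee_fin lerDr.
Qed.
End ComplexSeries.

(** * Jensen's inequality for powers *)

Section Jensen.
Variable R : realType.
Local Notation mu := (@lebesgue_measure R).
Local Open Scope ereal_scope.

Lemma le_poweR (s : R) (x y : \bar R) : (0 <= s)%R -> 0 <= x -> x <= y -> x `^ s <= y `^ s.
Proof.
move=> s0 x0 xy; apply: gt0_ler_poweR => //; rewrite in_itv/= leey andbT//.
exact: le_trans xy.
Qed.

(** On a space of finite mass this crude bound turns a finite integral of x^s into a finite integral
    of x. *)
Lemma le_1DpoweR (s : R) (x : \bar R) : (1 <= s)%R -> 0 <= x -> x <= 1 + x `^ s.
Proof.
move=> s1 x0; have [x1|x1] := leP x 1.
  by rewrite (le_trans x1)// leeDl// poweR_ge0.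
case: x x0 x1 => [x| |//]; last by rewrite poweRyr ?gt_eqF ?(lt_le_trans _ s1)// leey.
rewrite !lte_fin => x0 x1; rewrite poweR_EFin -EFinD lee_fin.
by rewrite (le_trans (le1r_powR (ltW x1) s1))// lerDr.
Qed.

(* Young's inequality integrated; the tangent of the power function at the mean. *)
Lemma jensen_poweR (s rho0 z0 : R) (rho : R -> R) (z : R -> \bar R) :
  (1 <= s)%R -> (0 <= rho0)%R -> (0 <= z0)%R ->
  measurable_fun setT rho -> (forall t, (0 <= rho t)%R) ->
  measurable_fun setT z -> (forall t, 0 <= z t) ->
  rho0%:E + \int[mu]_t (rho t)%:E <= 1 ->
  ((rho0 * z0)%:E + \int[mu]_t ((rho t)%:E * z t)) `^ s <=
  (rho0 * z0 `^ s)%:E + \int[mu]_t ((rho t)%:E * (z t) `^ s).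
Proof.
move=> s1 rho00 z00 mrho rho_ge0 mz z_ge0 rho1.
have s0 : (0 < s)%R by exact: lt_le_trans s1.
set m := (X in X `^ s); set RHS := (X in _ <= X).
have mrho' : measurable_fun setT (EFin \o rho) by exact/measurable_EFinP.
have rho0' t : 0 <= (rho t)%:E by rewrite lee_fin.
have mzs : measurable_fun setT (fun t => z t `^ s).
  exact: (measurableT_comp (measurable_poweR _)).
have mrz : measurable_fun setT (fun t => (rho t)%:E * z t) by exact: emeasurable_funM.
have mrzs : measurable_fun setT (fun t => (rho t)%:E * z t `^ s) by exact: emeasurable_funM.
have rz0 t : 0 <= (rho t)%:E * z t by rewrite mule_ge0.
have rzs0 t : 0 <= (rho t)%:E * z t `^ s by rewrite mule_ge0// poweR_ge0.
have m0 : 0 <= m by rewrite adde_ge0 ?lee_fin ?mulr_ge0// integral_ge0.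
have RHS0 : 0 <= RHS by rewrite adde_ge0 ?lee_fin ?mulr_ge0 ?powR_ge0// integral_ge0.
have [RHSoo|] := ltP RHS +oo; last by rewrite leye_eq => /eqP ->; rewrite leey.
(* The mean has to be a real number before a power of it can serve as the slope of a tangent. *)
have moo : m < +oo.
  have : m <= 1 + RHS.
    have z1 : (rho0 * z0 <= rho0 + rho0 * z0 `^ s)%R.
      rewrite -[X in (_ <= X + _)%R]mulr1 -mulrDr ler_wpM2l//.
      by have := @le_1DpoweR s z0%:E s1; rewrite poweR_EFin -EFinD !lee_fin; exact.
    apply: (@le_trans _ _ ((rho0 + rho0 * z0 `^ s)%:E + 
       (\int[mu]_t (rho t)%:E + \int[mu]_t ((rho t)%:E * (z t) `^ s)))).
      apply: leeD; first by rewrite lee_fin.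
      rewrite -ge0_integralD//; apply: ge0_le_integralT => //.
        exact: emeasurable_funD.
      move=> t; rewrite -[X in _ <= X + _]mule1 -ge0_muleDr//; last exact: poweR_ge0.
      by rewrite lee_wpmul2l// le_1DpoweR.
    by rewrite EFinD addeACA leeD.
  by move=> /le_lt_trans; apply; rewrite lte_add_pinfty// ltry.
have [m_eq0|m_neq0] := eqVneq m 0; first by rewrite m_eq0 poweR0r// gt_eqF.
have mfin : m \is a fin_num by rewrite ge0_fin_numE.
pose r := fine m; have mE : m = r%:E by rewrite /r fineK.
have r0 : (0 < r)%R by rewrite fine_gt0// lt0e m_neq0 m0.
rewrite mE poweR_EFin.
(* For [s = 1] the conjugate exponent would be infinite; the two sides coincide. *)
have [s_eq1|s_neq1] := eqVneq s 1%R.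
  have -> : RHS = m.
    rewrite /RHS /m s_eq1 powRr1//; congr (_ + _); apply: eq_integral => t _.
    by rewrite poweRe1.
  by rewrite s_eq1 (powRr1 (ltW r0)) -mE lexx.
have {s_neq1}s1' : (1 < s)%R by rewrite lt_neqAle eq_sym s_neq1.
(* [k] is the slope of y^s / s at the mean [r]. As k^q = r^s, Young's inequality reads k y <= y^s /
   s + r^s / q, with equality at y = r. *)
pose k := (r `^ (s - 1))%R.
have k0 : (0 < k)%R by rewrite powR_gt0.
pose q := (s / (s - 1))%R.
have sB0 : (0 < s - 1)%R by rewrite subr_gt0.
have q0 : (0 < q)%R by rewrite divr_gt0.
have pq : (s^-1 + q^-1 = 1)%R by rewrite /q; field; rewrite !gt_eqF.
have kq : (k `^ q = r `^ s)%R.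
  by rewrite /k -powRrM /q; congr (_ `^ _)%R; field; rewrite gt_eqF.
have kr : (k * r = r `^ s)%R.
  by rewrite /k -[X in (_ * X)%R](powRr1 (ltW r0)) -powRD ?subrK// gt_eqF.
have young (y : \bar R) : 0 <= y -> k%:E * y <= s^-1%:E * y `^ s + (q^-1 * r `^ s)%:E.
  case: y => [y| |//] y0; last first.
    by rewrite poweRyr ?gt_eqF// (gt0_muley (x := s^-1%:E)) ?lte_fin ?invr_gt0// addye// leey.
  rewrite poweR_EFin -!EFinM -EFinD lee_fin -kq (mulrC k) (mulrC s^-1%R) (mulrC q^-1%R).
  exact: conjugate_powR y0 (ltW k0) s0 q0 pq.
have : k%:E * m <= s^-1%:E * RHS + (q^-1 * r `^ s)%:E.
  have I0 : (0 <= q^-1 * r `^ s)%R by rewrite mulr_ge0 ?invr_ge0 ?powR_ge0// ltW.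
  have si0 : (0 <= s^-1)%R by rewrite invr_ge0 ltW.
  apply: (@le_trans _ _ ((rho0 * (s^-1 * z0 `^ s + q^-1 * r `^ s))%:E +
    \int[mu]_t ((rho t)%:E * (s^-1%:E * z t `^ s + (q^-1 * r `^ s)%:E)))).
    rewrite /m ge0_muleDr ?lee_fin ?mulr_ge0 ?integral_ge0//; apply: leeD.
      rewrite -EFinM lee_fin mulrCA ler_wpM2l//.
      by have := young z0%:E; rewrite poweR_EFin -!EFinM -EFinD !lee_fin; exact.
    have -> : k%:E * \int[mu]_t ((rho t)%:E * z t) = \int[mu]_t (k%:E * ((rho t)%:E * z t)).
      by rewrite ge0_integralZl// lee_fin ltW.
    apply: ge0_le_integralT.
    - by move=> t; rewrite mule_ge0// lee_fin ltW.
    - exact: measurable_funeM.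
    - apply: emeasurable_funM => //; apply: emeasurable_funD => //.
      exact: measurable_funeM.
    - by move=> t; rewrite muleCA lee_wpmul2l// young.
  have -> : \int[mu]_t ((rho t)%:E * (s^-1%:E * z t `^ s + (q^-1 * r `^ s)%:E)) =
     s^-1%:E * \int[mu]_t ((rho t)%:E * z t `^ s) + (q^-1 * r `^ s)%:E * \int[mu]_t (rho t)%:E.
    rewrite -ge0_integralZl ?lee_fin// -ge0_integralZl ?lee_fin// -ge0_integralD//; last 4 first.
    - by move=> t _; rewrite mule_ge0 ?lee_fin.
    - exact: measurable_funeM.
    - by move=> t _; rewrite mule_ge0 ?lee_fin.
    - exact: measurable_funeM.
    apply: eq_integral => t _; rewrite ge0_muleDr ?mule_ge0 ?poweR_ge0 ?lee_fin//.
    by congr (_ + _); [rewrite muleCA|rewrite muleC].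
  rewrite mulrDr EFinD addeACA leeD//.
    rewrite [X in _ <= X]ge0_muleDr ?lee_fin ?mulr_ge0 ?powR_ge0 ?integral_ge0//.
    by rewrite leeD// -EFinM lee_fin mulrCA.
  (* The constant term of Young's inequality is multiplied by the total mass, which is at most
     one. *)
  rewrite -[leRHS]mule1 mulrC EFinM -ge0_muleDr ?lee_fin ?integral_ge0//.
  by rewrite lee_wpmul2l ?lee_fin.
rewrite mE -EFinM kr.
have RHSfin : RHS \is a fin_num by rewrite ge0_fin_numE.
rewrite -(fineK RHSfin) -EFinM -EFinD !lee_fin -lerBlDr.
have -> : (r `^ s - q^-1 * r `^ s = s^-1 * r `^ s)%R.
  by rewrite -[X in (X - _)%R]mul1r -pq; ring.
by rewrite ler_pM2l ?invr_gt0.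
Qed.
End Jensen.

(** * Primitives and the scalar resolvent *)

Section Primitive.
Variable R : realType.
Local Notation mu := (@lebesgue_measure R).
Implicit Types f w : R -> R.

Lemma ae_mono (P Q : R -> Prop) : (forall x, P x -> Q x) ->
  {ae mu, forall x, P x} -> {ae mu, forall x, Q x}.
Proof. by move=> PQ; apply: (@filterS _ _ (ae_filter_ringOfSetsType _)). Qed.

Lemma ae_mono2 (P P' Q : R -> Prop) : (forall x, P x -> P' x -> Q x) ->
  {ae mu, forall x, P x} -> {ae mu, forall x, P' x} -> {ae mu, forall x, Q x}.
Proof. by move=> PQ; apply: (@filterS2 _ _ (ae_filter_ringOfSetsType _)). Qed.

Definition primitive f (x : R) : R := \int[mu]_(t in `]-oo, x]) f t.

Lemma primitiveE f x : primitive f x = \int[mu]_t (if t <= x then f t else 0).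
Proof.
rewrite /primitive Rintegral_mkcond; apply: eq_Rintegral => t _.
by rewrite patchE mem_setE in_itv.
Qed.

Lemma measurable_primitive f : measurable_fun setT f -> measurable_fun setT (primitive f).
Proof.
move=> mf; rewrite (funext (primitiveE f)).
apply: (@measurable_Rintegral_param _ _ R (fun p => if p.2 <= p.1 then f p.2 else 0)).
apply: measurable_fun_ifT; last exact: measurable_cst.
  by apply: measurable_fun_ler; [exact: measurable_snd|exact: measurable_fst].
exact: (measurableT_comp mf measurable_snd).
Qed.

Lemma is_derive_primitive f : mu.-integrable setT (EFin \o f) ->
  {ae mu, forall x, is_derive (x : R) (1 : R) (primitive f) (f x)}.
Proof.
move=> fi; have := @FTC1Ny R f; rewrite /=.
have h y : mu.-integrable `]-oo, y] (EFin \o f) by apply: integrableS fi.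
have lf : locally_integrable [set: R] f.
  by have := integrable_locally measurableT fi; rewrite patch_setT.
move=> /(_ h lf); apply: ae_mono => x [df fx].
by apply: DeriveDef => //; rewrite -derive1E.
Qed.

Lemma primitive0 f : (forall t, t < 0 -> f t = 0) -> primitive f 0 = 0.
Proof.
move=> f0; rewrite /primitive -Rintegral_itv_bndo_bndc; last first.
  apply: eq_integrable (integrable0 _ _) => // t; rewrite inE/= in_itv/= => t0.
  by rewrite f0.
under eq_Rintegral => t.
  rewrite inE/= in_itv/= => t0; rewrite f0//.
  over.
by rewrite Rintegral_cst// mul0r.
Qed.

Lemma primitive_le f x : mu.-integrable setT (EFin \o f) -> (forall t, 0 <= f t) ->
  primitive f x <= \int[mu]_t f t.
Proof.
move=> fi f0; rewrite -lee_fin /primitive /Rintegral !fineK.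
- apply: ge0_subset_integral => //; first by have /integrableP[] := fi.
  by move=> t _; rewrite lee_fin.
- exact: integrable_fin_num.
- by apply: integrable_fin_num => //; apply: integrableS fi.
Qed.

(** Makes the exponential Lipschitz below [M], so that the exponential of a bounded primitive is
    absolutely continuous. *)
Lemma ler_expR_diff (u v M : R) : u <= M -> v <= M -> `|expR u - expR v| <= expR M * `|u - v|.
Proof.
wlog uv : u v / u <= v.
  move=> H uM vM; have [uv|/ltW uv] := leP u v; first exact: H.
  by rewrite distrC [`|u - v|]distrC; exact: H.
move=> uM vM; rewrite distrC [`|u - v|]distrC.
rewrite ger0_norm ?subr_ge0 ?ler_expR// ger0_norm ?subr_ge0//.
have -> : expR v - expR u = expR v * (1 - expR (u - v)).
  by rewrite mulrBr mulr1 -expRD [v + _]addrC subrK.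
rewrite ler_pM ?expR_ge0 ?ler_expR// ?subr_ge0.
  by rewrite -(expR0 R) ler_expR subr_le0.
by have := expR_ge1Dx (u - v); lra.
Qed.

(* [expR (primitive w)] is the resolvent of the Volterra kernel [w]. *)
Lemma integral_expR_primitive w x : mu.-integrable setT (EFin \o w) ->
  (forall t, 0 <= w t) -> (forall t, ~~ (0 <= t <= 1) -> w t = 0) -> 0 <= x <= 1 ->
  (\int[mu]_t (if (t <= x)%R then w t * expR (primitive w t) else 0)%:E =
   (expR (primitive w x) - 1)%:E)%E.
Proof.
move=> wi w0 wsupp x01.
have mw : measurable_fun setT w by apply/measurable_EFinP; exact: measurable_int wi.
pose M := \int[mu]_t w t.
have sM t : primitive w t <= M by exact: primitive_le.
pose f t := w t * expR (primitive w t).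
have mf : measurable_fun setT f.
  apply: measurable_funM => //; apply: (measurableT_comp (f := expR)) => //.
  exact: measurable_primitive.
have f0 t : 0 <= f t by rewrite mulr_ge0// expR_ge0.
have fi : mu.-integrable setT (EFin \o f).
  have h := integrableZl measurableT (expR M) wi.
  apply: le_integrable h => //; first exact/measurable_EFinP.
  move=> t _ /=; rewrite !ger0_norm ?mulr_ge0 ?expR_ge0// lee_fin mulrC.
  by rewrite ler_wpM2l// ler_expR.
(* The derivative of [G] vanishes almost everywhere by the chain rule, so [G] keeps its value 1 at
   the origin. *)
pose G t := expR (primitive w t) - primitive f t.
have acG : acont01 G.
  apply: acont01B; last exact: acont01_integral.
  apply: (acont01_dom (L := expR M) (acont01_integral wi)) => a b _ _ _.
  exact: ler_expR_diff.
have G' : {ae mu, forall t : R, 0 < t < 1 -> is_derive t (1 : R) G 0}.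
  have h1 := is_derive_primitive wi; have h2 := is_derive_primitive fi.
  apply: ae_mono2 h1 h2 => t h1 h2 _.
  rewrite -[X in is_derive _ _ _ X](_ : expR (primitive w t) * w t - f t = 0); last first.
    by rewrite /f mulrC subrr.
  by apply: is_deriveB; apply: is_derive1_comp.
have := acont01_zero_derive acG G' x01; rewrite /G.
rewrite primitive0; last by move=> t t0; rewrite wsupp// leNgt t0.
rewrite primitive0; last by move=> t t0; rewrite /f wsupp ?mul0r// leNgt t0.
rewrite expR0 subr0 => GE.
have -> : expR (primitive w x) - 1 = primitive f x by rewrite -GE; ring.
rewrite primitiveE /Rintegral fineK//.
apply: integrable_fin_num => //; apply: le_integrable fi => //.
  apply/measurable_EFinP; apply: measurable_fun_ifT => //.
  by apply: measurable_fun_ler => //; exact: measurable_cst.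
by move=> t _ /=; rewrite lee_fin; case: ifP => // _; rewrite normr0.
Qed.
End Primitive.

(** * Majorant of the Picard densities *)

Section Majorant.
Variable R : realType.
Local Notation mu := (@lebesgue_measure R).
Variable w : R -> R.
Hypothesis mw : measurable_fun setT w.
Hypothesis w0 : forall t, 0 <= w t.
Hypothesis wsupp : forall t, ~~ (0 <= t <= 1) -> w t = 0.
Local Open Scope ereal_scope.

(* The Picard density [kern] below, with the scalar weight [w] in place of the moduli of
   the potential. *)
Fixpoint kmaj (n : nat) (p : R * R) : \bar R :=
  match n with
  | 0%N => if (p.2 <= p.1)%R then (w p.2)%:E else 0
  | n.+1 => \int[mu]_t (if (t <= p.1)%R then (w t)%:E * kmaj n (t, t - p.2)%R else 0)
  end.

Definition kmaj_sum N p := \sum_(n < N) kmaj n p.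

Lemma kmaj_ge0 n p : 0 <= kmaj n p.
Proof.
elim: n p => [|n IH] p /=; first by case: ifP => // _; rewrite lee_fin.
by apply: integral_ge0 => t _; case: ifP => // _; rewrite mule_ge0// lee_fin.
Qed.

Lemma kmaj_sum_ge0 N p : 0 <= kmaj_sum N p.
Proof. by apply: sume_ge0 => n _; exact: kmaj_ge0. Qed.

(** The reflection taking tau to t - tau preserves [0, t], and t <= x in the integral, so the
    support [0, x] is inherited from one iterate to the next. *)
Lemma kmaj_supp n (x tau : R) : ~~ (0 <= tau <= x)%R -> kmaj n (x, tau) = 0.
Proof.
elim: n x tau => [|n IH] x tau h /=.
  case: ifP => // tx; rewrite wsupp//; apply: contra h => /andP[-> _].
  by rewrite tx.
apply: integral0_eq => t _; case: ifPn => // tx.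
have [w_eq0|] := eqVneq (w t) 0%R; first by rewrite w_eq0 mul0e.
move=> wn0; rewrite IH ?mule0//; apply: contra h => /andP[h1 h2].
by rewrite gerBl in h2; rewrite h2 (le_trans _ tx)// -subr_ge0.
Qed.

Let Sh (q : (R * R) * R) : R * R := (q.2, q.2 - q.1.2)%R.

Lemma measurable_Sh : measurable_fun setT Sh.
Proof.
apply: measurable_fun_pair; first exact: measurable_snd.
apply: measurable_funB; first exact: measurable_snd.
exact: (measurableT_comp measurable_snd measurable_fst).
Qed.

Lemma measurable_ler_param : measurable_fun setT (fun q : (R * R) * R => (q.2 <= q.1.1)%R).
Proof.
apply: measurable_fun_ler; first exact: measurable_snd.
exact: (measurableT_comp measurable_fst measurable_fst).
Qed.

Lemma measurable_volterra (F : R * R -> \bar R) : measurable_fun setT F ->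
  measurable_fun setT (fun q : (R * R) * R =>
    if (q.2 <= q.1.1)%R then (w q.2)%:E * F (q.2, q.2 - q.1.2)%R else 0).
Proof.
move=> mF; apply: measurable_fun_ifT; [exact: measurable_ler_param| |exact: measurable_cst].
apply: emeasurable_funM; last exact: (measurableT_comp mF measurable_Sh).
by apply/measurable_EFinP; exact: (measurableT_comp mw measurable_snd).
Qed.

Lemma measurable_kmaj n : measurable_fun setT (kmaj n).
Proof.
elim: n => [|n IH] /=.
  apply: measurable_fun_ifT; last exact: measurable_cst.
    by apply: measurable_fun_ler; [exact: measurable_snd|exact: measurable_fst].
  by apply/measurable_EFinP; exact: (measurableT_comp mw measurable_snd).
apply: (measurable_integral_param (measurable_volterra IH)) => q.
by case: ifP => // _; rewrite mule_ge0 ?lee_fin ?kmaj_ge0.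
Qed.

Lemma measurable_kmaj_sum N : measurable_fun setT (kmaj_sum N).
Proof. by apply: emeasurable_sum => n; exact: measurable_kmaj. Qed.

Lemma measurable_section (F : R * R -> \bar R) (x : R) : measurable_fun setT F ->
  measurable_fun setT (fun tau => F (x, tau)).
Proof. by move=> mF; exact: (measurableT_comp mF (measurable_pair1 x)). Qed.

Lemma measurable_volterra_section (F : R * R -> \bar R) (x tau : R) : measurable_fun setT F ->
  measurable_fun setT (fun t : R =>
    if (t <= x)%R then (w t)%:E * F (t, t - tau)%R else 0).
Proof.
by move=> mF; exact: (measurableT_comp (measurable_volterra mF) (measurable_pair1 (x, tau))).
Qed.

(** Partial sums obey the recursion of the iterates with an inhomogeneous term. This one-step
    Volterra inequality is what the induction for the norm runs on. *)
Lemma kmaj_sumS N (x tau : R) : kmaj_sum N.+1 (x, tau) = kmaj 0 (x, tau) +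
  \int[mu]_t (if (t <= x)%R then (w t)%:E * kmaj_sum N (t, t - tau)%R else 0).
Proof.
rewrite /kmaj_sum big_ord_recl; congr (_ + _) => /=.
rewrite -ge0_integral_sum//; last 2 first.
- by move=> n; exact: measurable_volterra_section (measurable_kmaj n).
- by move=> n t _; case: ifP => // _; rewrite mule_ge0 ?lee_fin ?kmaj_ge0.
apply: eq_integral => t _; case: ifP => _; last by rewrite big1.
by rewrite ge0_sume_distrr// => i _; exact: kmaj_ge0.
Qed.

Hypothesis wi : mu.-integrable setT (EFin \o w).
Variables (c s : R).
Hypothesis c0 : (0 < c)%R.
Hypothesis s1 : (1 <= s)%R.
Hypothesis wc : \int[mu]_t ((w t / c) `^ s)%:E <= 1.

(** The solution of B(x) = c + int_0^x w B, where [c] bounds the L^s norm of [w]; it is the expected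
    bound for the L^s norm in tau of every partial sum at [x]. *)
Definition kbound x : R := (c * expR (primitive w x))%R.

Lemma kbound_gt0 x : (0 < kbound x)%R. Proof. by rewrite mulr_gt0 ?expR_gt0. Qed.

Lemma kbound_ge0 x : (0 <= kbound x)%R. Proof. exact: ltW (kbound_gt0 x). Qed.

Lemma kmaj_sum_div_ge0 N x tau : 0 <= kmaj_sum N (x, tau) * (kbound x)^-1%:E.
Proof. by apply: mule_ge0; rewrite ?kmaj_sum_ge0// lee_fin invr_ge0 kbound_ge0. Qed.

(** After division by [kbound x] the left-hand side is the total mass of the weights used in
    Jensen's inequality at [x]. *)
Lemma kbound_super (x : R) : (0 <= x <= 1)%R ->
  (c%:E + \int[mu]_t (if (t <= x)%R then w t * kbound t else 0)%:E <= (kbound x)%:E).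
Proof.
move=> x01.
have -> : \int[mu]_t (if (t <= x)%R then w t * kbound t else 0)%:E =
   c%:E * \int[mu]_t (if (t <= x)%R then w t * expR (primitive w t) else 0)%:E.
  rewrite -ge0_integralZl//.
  - by apply: eq_integral => t _; case: ifP => _; rewrite ?mule0// -EFinM mulrCA.
  - apply/measurable_EFinP; apply: measurable_fun_ifT => //.
      by apply: measurable_fun_ler => //; exact: measurable_cst.
    apply: measurable_funM => //; apply: (measurableT_comp (f := expR)) => //.
    exact: measurable_primitive.
  - by move=> t _; case: ifP => // _; rewrite lee_fin mulr_ge0// expR_ge0.
  - by rewrite lee_fin ltW.
rewrite integral_expR_primitive// -EFinM -EFinD lee_fin /kbound.
by rewrite mulrBr mulr1 addrC subrK.
Qed.

(** The partial sum at [x], divided by [kbound x], is an average of w / c and of the reflected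
    normalized partial sums at all t <= x. Jensen's inequality moves the power inside the average,
    Tonelli's theorem integrates in tau first, and there the induction hypothesis applies because
    reflections preserve the integral. *)
Lemma kmaj_sum_bound N (x : R) : (0 <= x <= 1)%R ->
  \int[mu]_tau ((kmaj_sum N (x, tau) * (kbound x)^-1%:E) `^ s) <= 1.
Proof.
have s0 : (0 < s)%R by exact: lt_le_trans s1.
elim: N x => [|N IH] x x01.
  rewrite /kmaj_sum; under eq_integral do rewrite big_ord0 mul0e poweR0r ?gt_eqF//.
  by rewrite integral0.
have [A AE] : exists A, A = kbound x by exists (kbound x).
have A0 : (0 < A)%R by rewrite AE kbound_gt0.
rewrite -AE.
have Ai0 : 0 <= A^-1%:E by rewrite lee_fin invr_ge0 ltW.
(* The weight that the average gives to time [t]; the remaining weight c / A goes to the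
   inhomogeneous term. *)
pose rho (t : R) := (if (t <= x)%R then w t * kbound t / A else 0)%R.
have rho0 t : (0 <= rho t)%R.
  by rewrite /rho; case: ifP => // _; rewrite divr_ge0 ?mulr_ge0 ?kbound_ge0// ltW.
have mkb : measurable_fun setT kbound.
  apply: measurable_funM => //; apply: (measurableT_comp (f := expR)) => //.
  exact: measurable_primitive.
have mle : measurable_fun setT (fun t : R => (t <= x)%R).
  by apply: measurable_fun_ler => //; exact: measurable_cst.
have mrho : measurable_fun setT rho.
  apply: measurable_fun_ifT => //; apply: measurable_funM => //.
  exact: measurable_funM.
pose z (tau t : R) := kmaj_sum N (t, t - tau)%R * (kbound t)^-1%:E.
have mz'' : measurable_fun setT (fun q : R * R => kmaj_sum N q * (kbound q.1)^-1%:E).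
  apply: emeasurable_funM; first exact: measurable_kmaj_sum.
  apply/measurable_EFinP.
  have -> : (fun q : R * R => (kbound q.1)^-1)%R = (fun q => c^-1 * expR (- primitive w q.1))%R.
    by apply/funext => q; rewrite /kbound invfM expRN.
  apply: measurable_funM => //; apply: (measurableT_comp (f := expR)) => //.
  apply: measurableT_comp => //.
  exact: (measurableT_comp (measurable_primitive mw) measurable_fst).
have mz' : measurable_fun setT (fun q : R * R => (kmaj_sum N q * (kbound q.1)^-1%:E) `^ s).
  exact: (measurableT_comp (measurable_poweR s)).
have z0 (tau t : R) : 0 <= z tau t.
  exact: (@kmaj_sum_div_ge0 N t (t - tau)).
have mz tau : measurable_fun setT (z tau).
  apply: (measurableT_comp mz'' (g := fun t : R => (t, t - tau)%R)).
  apply: measurable_fun_pair; first exact: measurable_id.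
  by apply: measurable_funB => //; exact: measurable_cst.
have rho1 : (c / A)%:E + \int[mu]_t (rho t)%:E <= 1.
  have := lee_wpmul2r Ai0 (kbound_super x01); rewrite -AE.
  have h0 t : 0 <= (if (t <= x)%R then w t * kbound t else 0)%:E.
    by case: ifP => // _; rewrite lee_fin mulr_ge0 ?kbound_ge0.
  rewrite ge0_muleDl; [|by rewrite lee_fin ltW|exact: integral_ge0].
  rewrite -!EFinM mulfV ?gt_eqF//.
  rewrite -ge0_integralZr//; last first.
    apply/measurable_EFinP; apply: measurable_fun_ifT => //; exact: measurable_funM.
  apply: le_trans; rewrite leeD2l// le_eqVlt; apply/orP; left; apply/eqP.
  by apply: eq_integral => t _; rewrite /rho -EFinM; case: ifP => //; rewrite mul0r.
pose y0 (tau : R) := (if (tau <= x)%R then w tau / c else 0)%R.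
have y00 tau : (0 <= y0 tau)%R by rewrite /y0; case: ifP => // _; rewrite divr_ge0// ltW.
have my0 : measurable_fun setT y0.
  apply: measurable_fun_ifT => //; exact: measurable_funM.
have SE tau : kmaj_sum N.+1 (x, tau) * A^-1%:E =
    (c / A * y0 tau)%:E + \int[mu]_t ((rho t)%:E * z tau t).
  rewrite kmaj_sumS ge0_muleDl ?kmaj_ge0//; last first.
    by apply: integral_ge0 => t _; case: ifP => // _; rewrite mule_ge0 ?lee_fin ?kmaj_sum_ge0.
  congr (_ + _).
    rewrite /= /y0; case: ifP => _; last by rewrite mul0e mulr0.
    by rewrite -EFinM; congr EFin; field; rewrite !gt_eqF.
  rewrite -ge0_integralZr//; last 2 first.
  - exact: measurable_volterra_section (measurable_kmaj_sum N).
  - by move=> t _; case: ifP => // _; rewrite mule_ge0 ?lee_fin ?kmaj_sum_ge0.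
  apply: eq_integral => t _; rewrite /rho /z; case: ifP => _; last by rewrite !mul0e.
  move: (kmaj_sum N (t, t - tau)%R) (kbound t) (kbound_gt0 t) => X k k0.
  rewrite [RHS]muleCA -EFinM muleAC -EFinM muleC; congr (X * _%:E).
  by field; rewrite !gt_eqF.
have cA0 : (0 <= c / A)%R by rewrite divr_ge0// ltW.
have mzs : measurable_fun setT (fun q : R * R => (rho q.2)%:E * (z q.1 q.2) `^ s).
  apply: emeasurable_funM.
    by apply/measurable_EFinP; exact: (measurableT_comp mrho measurable_snd).
  apply: (measurableT_comp mz' (g := fun q : R * R => (q.2, q.2 - q.1)%R)).
  apply: measurable_fun_pair; first exact: measurable_snd.
  by apply: measurable_funB; [exact: measurable_snd|exact: measurable_fst].
have zs0 q : 0 <= (rho q.2)%:E * (z q.1 q.2) `^ s.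
  by rewrite mule_ge0 ?lee_fin// poweR_ge0.
have mint : measurable_fun setT (fun tau => \int[mu]_t ((rho t)%:E * (z tau t) `^ s)).
  exact: (measurable_integral_param mzs).
have my0s : measurable_fun setT (fun tau => (c / A * y0 tau `^ s)%:E).
  apply/measurable_EFinP; apply: measurable_funM => //.
  exact: (measurableT_comp (measurable_powR s)).
apply: (@le_trans _ _ (\int[mu]_tau ((c / A * y0 tau `^ s)%:E +
     \int[mu]_t ((rho t)%:E * (z tau t) `^ s)))).
  apply: ge0_le_integralT.
  - by move=> tau; exact: poweR_ge0.
  - apply: (measurableT_comp (measurable_poweR s)); apply: emeasurable_funM => //.
    exact: measurable_section (measurable_kmaj_sum _).
  - exact: emeasurable_funD.
  - move=> tau; rewrite SE.
    exact: (jensen_poweR s1 cA0 (y00 tau) mrho rho0 (mz tau) (z0 tau) rho1).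
rewrite ge0_integralD//; last 2 first.
- by move=> tau _; rewrite lee_fin mulr_ge0 ?powR_ge0.
- by move=> tau _; apply: integral_ge0 => t _; exact: (zs0 (tau, t)).
apply: le_trans rho1; apply: leeD.
  apply: (@le_trans _ _ ((c / A)%:E * \int[mu]_tau ((w tau / c) `^ s)%:E)).
    have mws : measurable_fun setT (fun tau => ((w tau / c) `^ s)%:E).
      apply/measurable_EFinP; apply: (measurableT_comp (measurable_powR s)).
      exact: measurable_funM.
    have ws0 tau : 0 <= ((w tau / c) `^ s)%:E by rewrite lee_fin powR_ge0.
    rewrite -(@ge0_integralZl _ _ _ mu _ measurableT _ mws (c / A)%:E)//.
    apply: ge0_le_integralT => //.
    + by move=> tau; rewrite lee_fin mulr_ge0 ?powR_ge0.
    + exact: measurable_funeM.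
    + move=> tau; rewrite -EFinM lee_fin ler_wpM2l// ge0_ler_powR ?nnegrE//.
      * exact: ltW.
      * by rewrite divr_ge0// ltW.
      * by rewrite /y0; case: ifP => // _; rewrite divr_ge0// ltW.
  by rewrite -[leRHS]mule1 lee_wpmul2l// lee_fin.
(* With [t] fixed, the inner integral over tau is that of a reflected section at [t], bounded by one
   through the induction hypothesis. *)
rewrite (integral_Tonelli mzs zs0) /=.
apply: ge0_le_integralT.
- by move=> t; apply: integral_ge0 => tau _; exact: (zs0 (tau, t)).
- apply: (@measurable_integral_param _ _ R (fun q : R * R => (rho q.1)%:E * (z q.2 q.1) `^ s)).
    apply: (measurableT_comp mzs (g := fun q : R * R => (q.2, q.1))).
    by apply: measurable_fun_pair; [exact: measurable_snd|exact: measurable_fst].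
  by move=> q; exact: (zs0 (q.2, q.1)).
- exact/measurable_EFinP.
move=> t.
have mzt : measurable_fun setT (fun tau => z tau t `^ s).
  apply: (measurableT_comp mz' (g := fun tau : R => (t, t - tau)%R)).
  by apply: measurable_fun_pair => //; apply: measurable_funB.
rewrite (@ge0_integralZl _ _ _ mu _ measurableT _ mzt (rho t)%:E); last 2 first.
- by move=> tau _; exact: poweR_ge0.
- by rewrite lee_fin.
(* The induction hypothesis covers [t] in [0, 1] only; elsewhere the weight vanishes along with
   [w t]. *)
have [t01|t01] := boolP (0 <= t <= 1)%R; last first.
  by rewrite /rho wsupp// !mul0r; case: ifP => _; rewrite mul0e.
rewrite -[leRHS]mule1 lee_wpmul2l ?lee_fin//.
rewrite (integral_reflect t (f := fun tau => (kmaj_sum N (t, tau) * (kbound t)^-1%:E) `^ s)).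
- exact: IH.
- exact: measurable_section mz'.
- by move=> tau; exact: poweR_ge0.
Qed.
End Majorant.

(** * The full majorant at x = 1 *)

Section MajorantLimit.
Variable R : realType.
Local Notation mu := (@lebesgue_measure R).
Variable w : R -> R.
Hypothesis mw : measurable_fun setT w.
Hypothesis w0 : forall t, 0 <= w t.
Hypothesis wsupp : forall t, ~~ (0 <= t <= 1) -> w t = 0.
Hypothesis wi : mu.-integrable setT (EFin \o w).
Local Open Scope ereal_scope.

Definition kmaj_lim (tau : R) : \bar R := limn (fun N => kmaj_sum w N (1%R, tau)).

Lemma kmaj_sum_nd p : nondecreasing_seq (fun N => kmaj_sum w N p).
Proof.
apply/nondecreasing_seqP => N; rewrite /kmaj_sum big_ord_recr/= leeDl//.
exact: kmaj_ge0.
Qed.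

Lemma kmaj_limE tau :
  kmaj_lim tau = ereal_sup (range (fun N => kmaj_sum w N (1%R, tau))).
Proof. by apply/cvg_lim => //; apply: ereal_nondecreasing_cvgn; exact: kmaj_sum_nd. Qed.

Lemma kmaj_sum_le_lim N tau : kmaj_sum w N (1%R, tau) <= kmaj_lim tau.
Proof. by rewrite kmaj_limE; apply: ereal_sup_ubound; exists N. Qed.

Lemma kmaj_lim_ge0 tau : 0 <= kmaj_lim tau.
Proof. by apply: le_trans (kmaj_sum_le_lim 0 tau); rewrite /kmaj_sum big_ord0. Qed.

Lemma measurable_kmaj_lim : measurable_fun setT kmaj_lim.
Proof.
apply: (emeasurable_fun_cvg (fun N tau => kmaj_sum w N (1%R, tau))).
  by move=> N; apply: measurable_section; exact: measurable_kmaj_sum.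
move=> tau _; rewrite kmaj_limE; apply: ereal_nondecreasing_cvgn; exact: kmaj_sum_nd.
Qed.

(** Monotone convergence of the s-th powers transfers the bound, which does not depend on the number
    of terms. *)
Lemma kmaj_lim_bound (c s : R) : (0 < c)%R -> (1 <= s)%R ->
  \int[mu]_t ((w t / c) `^ s)%:E <= 1 ->
  \int[mu]_tau ((kmaj_lim tau * (kbound w c 1)^-1%:E) `^ s) <= 1.
Proof.
move=> c0 s1 wc; have s0 : (0 < s)%R by exact: lt_le_trans s1.
have b0 : (0 < kbound w c 1)%R by exact: kbound_gt0.
pose g N tau := (kmaj_sum w N (1%R, tau) * (kbound w c 1)^-1%:E) `^ s.
have b0' : 0 <= (kbound w c 1)^-1%:E by rewrite lee_fin invr_ge0 ltW.
have mg N : measurable_fun setT (g N).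
  apply: (measurableT_comp (measurable_poweR s)); apply: emeasurable_funM => //.
  by apply: measurable_section; exact: measurable_kmaj_sum.
have g0 N tau : 0 <= g N tau by exact: poweR_ge0.
have gnd tau : nondecreasing_seq (g ^~ tau).
  move=> n m nm; apply: le_poweR; first exact: ltW.
    by rewrite mule_ge0// kmaj_sum_ge0.
  by apply: lee_wpmul2r => //; exact: kmaj_sum_nd.
have := @cvg_monotone_convergence _ _ _ mu setT measurableT g mg
  (fun n t _ => g0 n t) (fun t _ => gnd t).
move=> cv; have lim1 : \int[mu]_t limn (g ^~ t) <= 1.
  rewrite -(cvg_lim _ cv)//; apply: lime_le; first by apply/cvg_ex; eexists; exact: cv.
  apply: nearW => n; apply: kmaj_sum_bound => //.
  by rewrite lexx ler01.
apply: le_trans lim1; apply: ge0_le_integralT.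
- by move=> t; exact: poweR_ge0.
- apply: (measurableT_comp (measurable_poweR s)); apply: emeasurable_funM => //.
  exact: measurable_kmaj_lim.
- apply: (emeasurable_fun_cvg g) => // t _.
  by apply: ereal_nondecreasing_is_cvgn; exact: gnd.
move=> t; set T := limn _.
have gT N : g N t <= T.
  rewrite /T (cvg_lim _ (ereal_nondecreasing_cvgn (gnd t)))//.
  by apply: ereal_sup_ubound; exists N.
have T0 : 0 <= T by exact: le_trans (gT 0%N).
(* Comparing each partial sum with the s-th root of [T] avoids an appeal to continuity of the power
   at infinity. *)
have TE : (T `^ s^-1) `^ s = T.
  by rewrite -poweRrM mulVf ?gt_eqF// poweRe1.
rewrite -TE; apply: le_poweR; first exact: ltW.
  by rewrite mule_ge0// kmaj_lim_ge0.
rewrite muleC lee_pdivrMl// kmaj_limE; apply: ub_ereal_sup => _ [N _ <-].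
rewrite -lee_pdivrMl// muleC.
have h : 0 <= kmaj_sum w N (1%R, t) * (kbound w c 1)^-1%:E.
  by rewrite mule_ge0// kmaj_sum_ge0.
rewrite -[leLHS](_ : (g N t) `^ s^-1 = _); last first.
  by rewrite /g -poweRrM mulfV ?gt_eqF// poweRe1.
by apply: le_poweR => //; rewrite invr_ge0 ltW.
Qed.
End MajorantLimit.

(** * Picard kernels and their dependence on the potential *)

Section Kernels.
Variable R : realType.
Local Notation C := R[i].
Local Notation mu := (@lebesgue_measure R).
Local Notation N := (@cabs1 R).
Variable w : R -> R.
Hypothesis mw : measurable_fun setT w.
Hypothesis w0 : forall t, 0 <= w t.
Hypothesis wsupp : forall t, ~~ (0 <= t <= 1) -> w t = 0.

Section Kernel.
Variables (q : bool -> R -> C) (cc : bool -> C).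

(* [kern n i (x, tau)] is the density, at frequency variable [tau], of the [n]-th Picard
   iterate at [x] of the [i]-th component of the solution with initial value [cc]. *)
Fixpoint kern (n : nat) (i : bool) (p : R * R) : C :=
  match n with
  | 0%N => if p.2 <= p.1 then cc (~~ i) * q i p.2 else 0
  | n.+1 => cint (fun t => if t <= p.1 then q i t * kern n (~~ i) (t, t - p.2) else 0)
  end.

Hypothesis mq : forall i, cmeas (q i).
Hypothesis qw : forall i t, N (q i t) <= w t.
Hypothesis cc1 : forall i, N (cc i) <= 1.

Lemma cmeas_kern_integrand n i : cmeas (kern n (~~ i)) ->
  cmeas (fun r : (R * R) * R =>
    if r.2 <= r.1.1 then q i r.2 * kern n (~~ i) (r.2, r.2 - r.1.2) else 0).
Proof.
move=> mk; apply: cmeas_if; [exact: measurable_ler_param| |exact: cmeas_cst].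
apply: cmeasM; first exact: (cmeas_comp measurable_snd (mq i)).
exact: (cmeas_comp (@measurable_Sh R) mk).
Qed.

Lemma cmeas_kern n i : cmeas (kern n i).
Proof.
elim: n i => [|n IH] i /=.
  apply: cmeas_if; last exact: cmeas_cst.
    by apply: measurable_fun_ler; [exact: measurable_snd|exact: measurable_fst].
  by apply: cmeasM; [exact: cmeas_cst|exact: (cmeas_comp measurable_snd (mq i))].
exact: (cmeas_cint_param (cmeas_kern_integrand (IH _))).
Qed.

Lemma cmeas_kern_section n i x tau :
  cmeas (fun t : R => if t <= x then q i t * kern n (~~ i) (t, t - tau) else 0).
Proof.
exact: (cmeas_comp (measurable_pair1 (x, tau)) (cmeas_kern_integrand (cmeas_kern n (~~ i)))).
Qed.

Lemma cabs1_kern_integrand n i x tau t : ((N (kern n (~~ i) (t, t - tau)))%:E <= kmaj w n (t, t - tau)%R)%E ->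
  ((N (if t <= x then q i t * kern n (~~ i) (t, t - tau) else 0))%:E <=
  if (t <= x)%R then (w t)%:E * kmaj w n (t, t - tau)%R else 0)%E.
Proof.
move=> h; case: ifP => _; last by rewrite cabs1_0.
apply: (@le_trans _ _ ((N (q i t))%:E * (N (kern n (~~ i) (t, t - tau)))%:E)%E).
  by rewrite -EFinM lee_fin cabs1M.
by apply: lee_pmul => //; rewrite lee_fin ?cabs1_ge0.
Qed.

Lemma kern_le n i p : ((N (kern n i p))%:E <= kmaj w n p)%E.
Proof.
elim: n i p => [|n IH] i p /=.
  case: ifP => _; last by rewrite cabs1_0.
  rewrite lee_fin (le_trans (cabs1M _ _))// -[leRHS]mul1r.
  by rewrite ler_pM ?cabs1_ge0.
case: p => x tau; apply: le_trans (cabs1_cint_le (cmeas_kern_section n i x tau)) _.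
apply: ge0_le_integralT.
- by move=> t; rewrite lee_fin cabs1_ge0.
- exact: measurable_cabs1E (cmeas_kern_section n i x tau).
- exact: measurable_volterra_section (measurable_kmaj _ _ _).
- by move=> t; exact: cabs1_kern_integrand.
Qed.

Lemma kern_sum_le M i p : ((\sum_(n < M) (N (kern n i p))%:E) <= kmaj_sum w M p)%E.
Proof. by apply: lee_sum => n _; exact: kern_le. Qed.

(** The default 0 is taken on a set that depends on the weight alone, so that the kernels of two
    potentials with a common weight are series at the same points. *)
Definition kern_lim (i : bool) (tau : R) : C :=
  if (kmaj_lim w tau < +oo)%E then csum (fun n => kern n i (1, tau)) else 0.

Lemma kern_sum_fine i tau : (kmaj_lim w tau < +oo)%E ->
  forall M, \sum_(n < M) N (kern n i (1, tau)) <= fine (kmaj_lim w tau).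
Proof.
move=> h M; rewrite -lee_fin -sumEFin fineK; last by rewrite ge0_fin_numE// kmaj_lim_ge0.
exact: le_trans (kern_sum_le _ _ _) (kmaj_sum_le_lim w0 _ _).
Qed.

Lemma kern_lim_le i tau : ((N (kern_lim i tau))%:E <= kmaj_lim w tau)%E.
Proof.
rewrite /kern_lim; case: ifPn => h; last by rewrite cabs1_0 kmaj_lim_ge0.
have [_ h2] := @csum_cvg _ (fun n => kern n i (1, tau)) _ (kern_sum_fine i h).
by rewrite -[leRHS]fineK ?lee_fin// ge0_fin_numE// kmaj_lim_ge0.
Qed.
End Kernel.

Section Lipschitz.
Variables (q q' : bool -> R -> C) (cc : bool -> C) (d : R).
Hypotheses (mq : forall i, cmeas (q i)) (mq' : forall i, cmeas (q' i)).
Hypotheses (qw : forall i t, N (q i t) <= w t / 2) (q'w : forall i t, N (q' i t) <= w t / 2).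
Hypothesis qq' : forall i t, N (q i t - q' i t) <= d * (w t / 2).
Hypothesis cc1 : forall i, N (cc i) <= 1.
Hypothesis d0 : 0 < d.

Let w2 i t : N (q i t) <= w t.
Proof. by rewrite (le_trans (qw i t))// ler_pdivrMr// mulr_natr mulr2n lerDl. Qed.
Let w2' i t : N (q' i t) <= w t.
Proof. by rewrite (le_trans (q'w i t))// ler_pdivrMr// mulr_natr mulr2n lerDl. Qed.

(** In q k - q' k' = (q - q') k + q' (k - k') each of the two terms is at most d (w / 2) times the
    majorant. The halves in the hypotheses thus add up to exactly one step of the recursion with
    weight [w], and no factor growing with [n] appears. *)
Lemma kern_lipschitz n i p :
  ((N (kern q cc n i p - kern q' cc n i p))%:E <= d%:E * kmaj w n p)%E.
Proof.
elim: n i p => [|n IH] i [x tau] /=.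
  case: ifP => _; last by rewrite subrr cabs1_0 mule0.
  rewrite -mulrBr -EFinM lee_fin (le_trans (cabs1M _ _))// -[leRHS]mul1r.
  rewrite ler_pM ?cabs1_ge0// (le_trans (qq' _ _))// ler_pM2l//.
  by rewrite ler_pdivrMr// mulr_natr mulr2n lerDl.
set I := (X in (_ <= _ * X)%E).
(* Either the bound is infinite and trivial, or both integrals converge and may be subtracted. *)
have [Ioo|] := ltP I +oo%E; last first.
  by rewrite leye_eq => /eqP ->; rewrite gt0_muley ?lte_fin// leey.
have mk := cmeas_kern_section cc mq n i x tau.
have mk' := cmeas_kern_section cc mq' n i x tau.
have mI := measurable_volterra_section mw x tau (measurable_kmaj mw w0 n).
rewrite -cintB; last 2 first.
- apply: cintegrable_le mk mI _ Ioo => t; apply: (cabs1_kern_integrand w2).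
  exact: kern_le.
- apply: cintegrable_le mk' mI _ Ioo => t; apply: (cabs1_kern_integrand w2').
  exact: kern_le.
apply: le_trans (cabs1_cint_le (cmeasB mk mk')) _.
rewrite /I -ge0_integralZl//; last 2 first.
- by move=> t _; case: ifP => // _; rewrite mule_ge0 ?lee_fin// kmaj_ge0.
- by rewrite lee_fin ltW.
apply: ge0_le_integralT.
- by move=> t; rewrite lee_fin cabs1_ge0.
- exact: measurable_cabs1E (cmeasB mk mk').
- exact: measurable_funeM.
move=> t; case: ifP => _; last by rewrite subrr cabs1_0 mule0.
have := IH (~~ i) (t, t - tau).
have := kern_le mq w2 cc1 n (~~ i) (t, t - tau).
move: (kmaj w n _) (kmaj_ge0 w0 n (t, t - tau)) (kern q _ _ _ _) (kern q' _ _ _ _).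
move=> X X0 k k' kX kk'X.
have -> : q i t * k - q' i t * k' = (q i t - q' i t) * k + q' i t * (k - k') by ring.
apply: (@le_trans _ _ ((d * (w t / 2))%:E * X + (w t / 2)%:E * (d%:E * X))%E).
  apply: (@le_trans _ _ ((N (q i t - q' i t))%:E * (N k)%:E + (N (q' i t))%:E * (N (k - k'))%:E)%E).
    rewrite -!EFinM -EFinD lee_fin (le_trans (cabs1D _ _))// lerD// cabs1M//.
  by apply: leeD; apply: lee_pmul => //; rewrite lee_fin ?cabs1_ge0.
rewrite le_eqVlt; apply/orP; left; apply/eqP.
rewrite !muleA -!EFinM -ge0_muleDl ?lee_fin ?mulr_ge0 ?divr_ge0 ?(ltW d0)//.
by congr (_ * _)%E; rewrite -EFinD; congr EFin; field.
Qed.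

Lemma kern_lim_lipschitz i tau :
  ((N (kern_lim q cc i tau - kern_lim q' cc i tau))%:E <= d%:E * kmaj_lim w tau)%E.
Proof.
rewrite /kern_lim; case: ifPn => h; last first.
  by rewrite subrr cabs1_0 mule_ge0 ?lee_fin ?(ltW d0)// kmaj_lim_ge0.
have [c1 _] := @csum_cvg _ (fun n => kern q cc n i (1, tau)) _ (kern_sum_fine mq w2 cc1 i h).
have [c2 _] := @csum_cvg _ (fun n => kern q' cc n i (1, tau)) _ (kern_sum_fine mq' w2' cc1 i h).
have fin : kmaj_lim w tau \is a fin_num by rewrite ge0_fin_numE// kmaj_lim_ge0.
rewrite -(fineK fin) -EFinM lee_fin.
have c3 := ccvgD c1 (ccvgMl (-1) c2).
rewrite -[X in _ - X]mul1r -mulNr; apply: cabs1_ccvg_le c3 _ => M.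
rewrite mulN1r -sumrB (le_trans (cabs1_sum _ _ _))//.
rewrite -lee_fin EFinM fineK// -sumEFin.
apply: (@le_trans _ _ (d%:E * kmaj_sum w M (1%R, tau))%E); last first.
  by rewrite lee_wpmul2l ?lee_fin ?(ltW d0)// kmaj_sum_le_lim.
rewrite /kmaj_sum ge0_sume_distrr; last by move=> n _; exact: kmaj_ge0.
by apply: lee_sum => n _; exact: kern_lipschitz.
Qed.
End Lipschitz.
End Kernels.

(** * Solution of the Volterra system *)

Section Picard.
Variable R : realType.
Local Notation C := R[i].
Local Notation mu := (@lebesgue_measure R).
Local Notation N := (@cabs1 R).
Variable w : R -> R.
Hypothesis mw : measurable_fun setT w.
Hypothesis w0 : forall t, 0 <= w t.
Hypothesis wsupp : forall t, ~~ (0 <= t <= 1) -> w t = 0.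
Hypothesis wi : mu.-integrable setT (EFin \o w).

Lemma cabs1_eq0 (z : C) : N z <= 0 -> z = 0.
Proof.
move=> z0; apply: ReIm_eq => /=; apply/eqP; rewrite -normr_le0 (le_trans _ z0)//.
  by rewrite lerDl.
by rewrite lerDr.
Qed.

(** The case of exponent 1, uniform in [x] and in the number of terms; it gives the convergence of
    the Picard series on [0, 1]. *)
Lemma kmaj_sum_int : exists2 B : R, 0 <= B & forall M x, 0 <= x <= 1 ->
  (\int[mu]_tau kmaj_sum w M (x, tau) <= B%:E)%E.
Proof.
(* Adding 1 keeps [c] positive when [w] is zero. *)
pose c := \int[mu]_t w t + 1.
have I0 : 0 <= \int[mu]_t w t by exact: Rintegral_ge0.
have c0 : 0 < c by rewrite ltr_wpDl.
have wc : (\int[mu]_t ((w t / c) `^ 1)%:E <= 1)%E.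
  under eq_integral do rewrite powRr1 ?divr_ge0 ?(ltW c0)// mulrC EFinM.
  rewrite integralZl// -(@fineK _ (\int[mu]_t (w t)%:E)%E); last exact: integrable_fin_num.
  by rewrite -EFinM lee_fin ler_pdivrMl// mulr1 lerDl.
exists (c * expR (\int[mu]_t w t)); first by rewrite mulr_ge0 ?expR_ge0 ?ltW.
move=> M x x01; have := kmaj_sum_bound mw w0 wsupp wi c0 (lexx _) wc M x01.
have mS : measurable_fun setT (fun tau => kmaj_sum w M (x, tau)).
  exact: measurable_section (measurable_kmaj_sum mw w0 M).
have k0 := kbound_gt0 w c0 x.
under eq_integral do rewrite poweRe1 ?(kmaj_sum_div_ge0 w0 c0)//.
rewrite ge0_integralZr//; last 2 first.
- by move=> tau _; exact: kmaj_sum_ge0.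
- by rewrite lee_fin invr_ge0 ltW.
rewrite muleC lee_pdivrMl// mule1 => /le_trans; apply.
by rewrite lee_fin ler_pM2l// ler_expR; exact: primitive_le.
Qed.

Variables (q : bool -> R -> C) (cc : bool -> C).
Hypothesis mq : forall i, cmeas (q i).
Hypothesis qw : forall i t, N (q i t) <= w t.
Hypothesis cc1 : forall i, N (cc i) <= 1.
Local Notation kern := (kern q cc).
Variables (E : bool -> R -> C) (M : R).
Hypothesis mE : forall i, cmeas (E i).
Hypothesis EB : forall i t tau, E i (t - tau) = E i t * E (~~ i) tau.
Hypothesis M0 : 0 <= M.
Hypothesis EM : forall i t, 0 <= t <= 1 -> N (E i t) <= M.

Lemma q_supp i t : ~~ (0 <= t <= 1) -> q i t = 0.
Proof. by move=> t01; apply: cabs1_eq0; rewrite (le_trans (qw i t))// wsupp. Qed.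

Lemma cabs1_kernE n i (x tau : R) : 0 <= x <= 1 ->
  ((N (kern n i (x, tau) * E i tau))%:E <= M%:E * kmaj w n (x, tau))%E.
Proof.
move=> /andP[x0 x1]; have kk := kern_le mw w0 mq qw cc1 n i (x, tau).
have [tau01|tau01] := boolP (0 <= tau <= x); last first.
  move: kk; rewrite kmaj_supp// mule0 lee_fin => /cabs1_eq0 ->.
  by rewrite mul0r cabs1_0.
apply: (@le_trans _ _ ((N (E i tau))%:E * (N (kern n i (x, tau)))%:E)%E).
  by rewrite -EFinM lee_fin mulrC cabs1M.
apply: lee_pmul => //; rewrite ?lee_fin ?cabs1_ge0//.
by case/andP: tau01 => t0 tx; apply: EM; rewrite t0 (le_trans tx).
Qed.

Lemma cint_ae (f g : R -> C) : cmeas f -> cmeas g ->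
  {ae mu, forall t, f t = g t} -> cint f = cint g.
Proof.
move=> mf mg fg; apply: ReIm_eq => /=; congr fine; apply: ae_eq_integral => //.
- by apply/measurable_EFinP; exact: mf.1.
- by apply/measurable_EFinP; exact: mg.1.
- by apply: ae_mono fg => t -> _.
- by apply/measurable_EFinP; exact: mf.2.
- by apply/measurable_EFinP; exact: mg.2.
- by apply: ae_mono fg => t -> _.
Qed.

(** [E i] stands for e^{i lambda (b_j - b_i) t} with j the other index. Of lambda the argument uses
    only measurability, the functional equation [EB] and a bound on [0, 1]. *)
Definition pic n i x := cint (fun tau => kern n i (x, tau) * E i tau).

Lemma cmeas_kernE n i : cmeas (fun p : R * R => kern n i p * E i p.2).
Proof. by apply: cmeasM; [exact: cmeas_kern|exact: (cmeas_comp measurable_snd (mE i))]. Qed.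

Lemma cmeas_pic n i : cmeas (pic n i).
Proof. exact: (cmeas_cint_param (cmeas_kernE n i)). Qed.

Lemma cmeas_kernE_section n i x : cmeas (fun tau => kern n i (x, tau) * E i tau).
Proof. exact: (cmeas_comp (measurable_pair1 x) (cmeas_kernE n i)). Qed.

Lemma pic_sum_le : exists2 B : R, 0 <= B & forall K i x, 0 <= x <= 1 ->
  \sum_(n < K) N (pic n i x) <= B.
Proof.
have [B B0 hB] := kmaj_sum_int; exists (M * B); first exact: mulr_ge0.
move=> K i x x01; rewrite -lee_fin -sumEFin.
apply: (@le_trans _ _ (\sum_(n < K) (M%:E * \int[mu]_tau kmaj w n (x, tau))%E)).
  apply: lee_sum => n _; apply: le_trans (cabs1_cint_le (cmeas_kernE_section n i x)) _.
  have mk := measurable_section x (measurable_kmaj mw w0 n).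
  rewrite -ge0_integralZl//; last by move=> t _; exact: kmaj_ge0.
  apply: ge0_le_integralT.
  - by move=> t; rewrite lee_fin cabs1_ge0.
  - exact: measurable_cabs1E (cmeas_kernE_section n i x).
  - exact: measurable_funeM.
  - by move=> t; exact: cabs1_kernE.
rewrite -ge0_sume_distrr; last by move=> n _; apply: integral_ge0 => t _; exact: kmaj_ge0.
rewrite EFinM lee_wpmul2l// (le_trans _ (hB K x x01))// -ge0_integral_sum//.
- by move=> n; exact: measurable_section (measurable_kmaj mw w0 n).
- by move=> n t _; exact: kmaj_ge0.
Qed.

Lemma kmaj_int_lty n x : 0 <= x <= 1 -> (\int[mu]_tau kmaj w n (x, tau) < +oo)%E.
Proof.
move=> x01; have [B B0 hB] := kmaj_sum_int.
apply: le_lt_trans (ltry B); apply: le_trans (hB n.+1 x x01).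
apply: ge0_le_integralT.
- by move=> t; exact: kmaj_ge0.
- exact: measurable_section (measurable_kmaj mw w0 n).
- exact: measurable_section (measurable_kmaj_sum mw w0 n.+1).
- move=> t; rewrite /kmaj_sum big_ord_recr/= leeDr//.
  by apply: sume_ge0 => j _; exact: kmaj_ge0.
Qed.

Lemma cintegrable_kernE n i x : 0 <= x <= 1 ->
  cintegrable (fun tau => kern n i (x, tau) * E i tau).
Proof.
move=> x01.
have mk := measurable_section x (measurable_kmaj mw w0 n).
apply: (@cintegrable_le _ _ (fun tau => M%:E * kmaj w n (x, tau))%E).
- exact: cmeas_kernE_section.
- exact: measurable_funeM.
- by move=> tau; exact: cabs1_kernE.
- rewrite ge0_integralZl//; last by move=> t _; exact: kmaj_ge0.
  by rewrite lte_mul_pinfty// kmaj_int_lty.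
Qed.

(* The substitution [tau -> t - tau] turns [E i tau] into [E i t * E (~~ i) tau]. *)
Lemma picS n i x : 0 <= x <= 1 ->
  pic n.+1 i x = cint (fun t => if t <= x then q i t * E i t * pic n (~~ i) t else 0).
Proof.
move=> x01; have /andP[x0 x1] := x01.
pose F (p : R * R) :=
  if p.2 <= x then q i p.2 * kern n (~~ i) (p.2, p.2 - p.1) * E i p.1 else 0.
have mF : cmeas F.
  apply: cmeas_if; [|apply: cmeasM; first apply: cmeasM|exact: cmeas_cst].
  - by apply: measurable_fun_ler; [exact: measurable_snd|exact: measurable_cst].
  - exact: (cmeas_comp measurable_snd (mq i)).
  - apply: (cmeas_comp (g := fun p : R * R => (p.2, p.2 - p.1))); last exact: cmeas_kern.
    apply: measurable_fun_pair; first exact: measurable_snd.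
    by apply: measurable_funB; [exact: measurable_snd|exact: measurable_fst].
  - exact: (cmeas_comp measurable_fst (mE i)).
have FN tau t : ((N (F (tau, t)))%:E <=
    M%:E * (if (t <= x)%R then (w t)%:E * kmaj w n (t, t - tau)%R else 0))%E.
  rewrite /F /=; case: ifP => tx; last by rewrite cabs1_0 mule0.
  have [t01|t01] := boolP (0 <= t <= 1); last first.
    by rewrite q_supp// !mul0r cabs1_0 !mule_ge0 ?lee_fin ?kmaj_ge0.
  have kk := kern_le mw w0 mq qw cc1 n (~~ i) (t, t - tau).
  have [tau01|tau01] := boolP (0 <= t - tau <= t); last first.
    move: kk; rewrite kmaj_supp// lee_fin => /cabs1_eq0 ->.
    by rewrite mulr0 mul0r cabs1_0 !mule0.
  apply: (@le_trans _ _ ((N (E i tau))%:E * ((N (q i t))%:E * (N (kern n (~~ i) (t, t - tau)))%:E))%E).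
    rewrite -!EFinM lee_fin mulrC (le_trans (cabs1M _ _))//.
    by rewrite ler_wpM2l ?cabs1_ge0// cabs1M.
  apply: lee_pmul; rewrite ?mule_ge0 ?lee_fin ?cabs1_ge0//.
    by apply: EM; lra.
  by apply: lee_pmul; rewrite ?lee_fin ?cabs1_ge0//.
have Ffin : (\int[mu]_tau \int[mu]_t (N (F (tau, t)))%:E < +oo)%E.
  apply: (@le_lt_trans _ _ (M%:E * \int[mu]_tau kmaj w n.+1 (x, tau))%E); last first.
    by rewrite lte_mul_pinfty// kmaj_int_lty.
  have mk := measurable_section x (measurable_kmaj mw w0 n.+1).
  rewrite -ge0_integralZl//; last by move=> t _; exact: kmaj_ge0.
  apply: ge0_le_integralT.
  - by move=> t; apply: integral_ge0 => s _; rewrite lee_fin cabs1_ge0.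
  - apply: (measurable_integral_param (measurable_cabs1E mF)) => p.
    by rewrite lee_fin cabs1_ge0.
  - exact: measurable_funeM.
  - move=> tau; have mk' := measurable_volterra_section mw x tau (measurable_kmaj mw w0 n).
    rewrite /= -ge0_integralZl//; last first.
      by move=> t _; case: ifP => // _; rewrite mule_ge0 ?lee_fin ?kmaj_ge0.
    apply: ge0_le_integralT.
    + by move=> t; rewrite lee_fin cabs1_ge0.
    + exact: (measurableT_comp (measurable_cabs1E mF) (measurable_pair1 tau)).
    + exact: measurable_funeM.
    + by move=> t; exact: FN.
transitivity (cint (fun tau => cint (fun t => F (tau, t)))).
  rewrite /pic; apply: cint_ae.
  - exact: cmeas_kernE_section.
  - exact: (cmeas_cint_param mF).
  (* The factor [E i tau] may be moved under the inner integral only where that integral converges,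
     which the finiteness of the next majorant ensures for almost every [tau]. *)
  have kae : {ae mu, forall tau, (kmaj w n.+1 (x, tau) < +oo)%E}.
    have ki : mu.-integrable setT (fun tau => kmaj w n.+1 (x, tau)).
      apply/integrableP; split; first exact: measurable_section (measurable_kmaj mw w0 n.+1).
      by under eq_integral do rewrite gee0_abs ?kmaj_ge0//; exact: kmaj_int_lty.
    have := integrable_ae measurableT ki; apply: ae_mono => tau /(_ I).
    by rewrite ge0_fin_numE// kmaj_ge0.
  apply: ae_mono kae => tau kfin /=.
  have mk := cmeas_kern_section cc mq n i x tau.
  rewrite mulrC -cintZ.
    apply: eq_cint => t; rewrite /F /=; case: ifP => _; last by rewrite mulr0.
    by rewrite mulrC.
  apply: (cintegrable_le mk (measurable_volterra_section mw x tau (measurable_kmaj mw w0 n))).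
    by move=> t; apply: cabs1_kern_integrand => //; exact: kern_le.
  exact: kfin.
rewrite cint_Fubini//; apply: eq_cint => t; rewrite /F /=.
case: ifP => tx; last exact: cint0.
have [t01|t01] := boolP (0 <= t <= 1); last first.
  rewrite q_supp// !mul0r -[RHS]cint0; apply: eq_cint => tau.
  by rewrite !mul0r.
have hi := cintegrable_kernE n (~~ i) t01.
rewrite /pic -(cint_reflect t hi) -cintZ; last first.
  have := @cintegrable_affine R (-1) t _ _ hi; rewrite oppr_eq0 oner_eq0 => /(_ isT).
  by under eq_fun do rewrite mulN1r addrC.
apply: eq_cint => tau; rewrite -[in LHS](subKr t tau) EB subKr; ring.
Qed.

Definition sol i x := cc i + csum (fun n => pic n i x).

Lemma pic_cvg i x : 0 <= x <= 1 ->
  ccvg (fun K => \sum_(n < K) pic n i x) (csum (fun n => pic n i x)).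
Proof.
move=> x01; have [B _ hB] := pic_sum_le.
by have [] := @csum_cvg _ (fun n => pic n i x) B (fun K => hB K i x x01).
Qed.

Lemma pic0 i x : pic 0 i x = cint (fun t => if t <= x then q i t * E i t * cc (~~ i) else 0).
Proof.
by apply: eq_cint => t /=; case: ifP => _; rewrite ?mul0r//; ring.
Qed.

(** The Picard series can be integrated term by term: on [0, 1] its partial sums are uniformly
    bounded, so a multiple of [w] dominates the integrands. *)
Lemma sol_integral_restrict i x : 0 <= x <= 1 ->
  cintegrable (fun t => if t <= x then q i t * E i t * sol (~~ i) t else 0) /\
  sol i x = cc i + cint (fun t => if t <= x then q i t * E i t * sol (~~ i) t else 0).
Proof.
move=> x01; have [B B0 hB] := pic_sum_le.
(* Here the initial value is term 0 and the iterates are shifted by one, so that the n-th term under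
   the integral yields exactly the n-th iterate of the other component. *)
pose fc (n : nat) (t : R) : C := if n is n'.+1 then pic n' (~~ i) t else cc (~~ i).
pose f n (t : R) : C := if t <= x then q i t * E i t * fc n t else 0.
have fpic n : pic n i x = cint (f n).
  by case: n => [|n]; [exact: pic0|exact: picS].
have mle : measurable_fun setT (fun t : R => t <= x).
  by apply: measurable_fun_ler => //; exact: measurable_cst.
have mf n : cmeas (f n).
  apply: cmeas_if; [exact: mle| |exact: cmeas_cst].
  apply: cmeasM; first exact: cmeasM.
  by case: n => [|n]; [apply: cmeas_cst|apply: cmeas_pic].
have f_supp n t : ~~ (0 <= t <= 1) -> f n t = 0.
  by move=> t01; rewrite /f q_supp// !mul0r; case: ifP.
pose G t : \bar R := ((M * (1 + B)) * w t)%:E.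
have G0 : 0 <= M * (1 + B) by rewrite mulr_ge0// addr_ge0.
have mG : measurable_fun setT G.
  by apply/measurable_EFinP; exact: measurable_funM.
have Goo : (\int[mu]_t G t < +oo)%E.
  rewrite /G; under eq_integral do rewrite EFinM.
  rewrite integralZl// lte_mul_pinfty// ltey_eq.
  by rewrite (integrable_fin_num _ wi).
have SU t : 0 <= t <= 1 -> forall K,
    \sum_(n < K) N (fc n t) <= 1 + B.
  move=> t01 [|K]; first by rewrite big_ord0 addr_ge0.
  by rewrite big_ord_recl; apply: lerD; [exact: cc1|exact: (hB K (~~ i) t t01)].
have fG K t : (\sum_(n < K) (N (f n t))%:E <= G t)%E.
  rewrite sumEFin lee_fin.
  have [t01|t01] := boolP (0 <= t <= 1); last first.
    by rewrite big1 ?(mulr_ge0 G0)// => n _; rewrite f_supp// cabs1_0.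
  apply: (@le_trans _ _ (\sum_(n < K) (w t * M) *
      N (fc n t))).
    apply: ler_sum => n _; rewrite /f; case: ifP => _; last first.
      by rewrite cabs1_0 !mulr_ge0// cabs1_ge0.
    rewrite (le_trans (cabs1M _ _))// ler_wpM2r ?cabs1_ge0//.
    by rewrite (le_trans (cabs1M _ _))// ler_pM ?cabs1_ge0// EM.
  rewrite -mulr_sumr [leRHS]mulrC mulrA ler_wpM2l ?mulr_ge0//.
  exact: SU.
have [gi _ gc] := cint_csum mf mG Goo fG.
have gE : (fun t => if (G t < +oo)%E then csum (f^~ t) else 0) =
   (fun t => if t <= x then q i t * E i t * sol (~~ i) t else 0).
  apply/funext => t; rewrite ltry.
  have cf : ccvg (fun K => \sum_(n < K) f n t) (csum (f^~ t)).
    have [] := @csum_cvg _ (f^~ t) (fine (G t)) _ => // K.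
    by rewrite -lee_fin -sumEFin; exact: fG.
  apply: ccvg_unique cf _.
  have [t01|t01] := boolP (0 <= t <= 1); last first.
    rewrite q_supp// !mul0r if_same.
    have -> : (fun K => \sum_(n < K) f n t) = fun=> 0.
      by apply/funext => K; rewrite big1// => n _; rewrite f_supp.
    exact: ccvg_cst.
  rewrite /f; case: ifP => _; last first.
    have -> : (fun K => \sum_(n < K) (0 : C)) = fun=> 0.
      by apply/funext => K; rewrite big1.
    exact: ccvg_cst.
  under eq_fun do rewrite -mulr_sumr; apply: ccvgMl.
  have c1 := pic_cvg (~~ i) t01.
  have [c2 _] := @csum_cvg _ (fc^~ t) _ (SU t t01).
  suff -> : sol (~~ i) t = csum (fc^~ t) by [].
  apply: (ccvg_unique _ (ccvg_shift c2)); rewrite /sol.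
  under eq_fun do rewrite big_ord_recl /=.
  by apply: ccvgD; [exact: ccvg_cst|exact: c1].
rewrite -gE; split => //; rewrite /sol; congr (_ + _).
apply: (ccvg_unique (pic_cvg i x01)).
by under eq_fun do under eq_bigr do rewrite fpic; exact: gc.
Qed.

Lemma cintegrable_sol i : cintegrable (fun t => q i t * E i t * sol (~~ i) t).
Proof.
have x01 : (0 : R) <= 1 <= (1 : R) by rewrite ler01 lexx.
have [h _] := sol_integral_restrict i x01.
suff <- : (fun t : R => if t <= 1 then q i t * E i t * sol (~~ i) t else 0) =
  (fun t => q i t * E i t * sol (~~ i) t) by [].
apply/funext => t; case: ifPn => // t1.
by rewrite q_supp ?mul0r//; apply: contra t1 => /andP[].
Qed.

Hypothesis kmaj_lim_fin : (\int[mu]_tau kmaj_lim w tau < +oo)%E.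

(** At x = 1 the sum moves under the integral over the frequency variable; the limit kernel that
    appears is free of [E], hence of lambda. *)
Lemma sol1_kern_lim i :
  cintegrable (fun tau => kern_lim w q cc i tau * E i tau) /\
  sol i 1 = cc i + cint (fun tau => kern_lim w q cc i tau * E i tau).
Proof.
have x01 : (0 : R) <= 1 <= (1 : R) by rewrite ler01 lexx.
(* With M + 1 in place of [M] the factor is positive, so [G] is finite exactly where [kmaj_lim] is,
   and the default values of the two sums match. *)
pose G tau := ((M + 1)%:E * kmaj_lim w tau)%E.
have M1 : 0 < M + 1 by rewrite ltr_wpDl.
have mG : measurable_fun setT G by apply: measurable_funeM; exact: measurable_kmaj_lim.
have Goo : (\int[mu]_t G t < +oo)%E.
  rewrite ge0_integralZl//; last 3 first.
  - exact: measurable_kmaj_lim.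
  - by move=> t _; exact: kmaj_lim_ge0.
  - by rewrite lee_fin ltW.
  by rewrite lte_mul_pinfty// lee_fin ltW.
have fG K t : (\sum_(n < K) (N (kern n i (1%R, t) * E i t))%:E <= G t)%E.
  apply: (@le_trans _ _ (\sum_(n < K) M%:E * kmaj w n (1%R, t))%E).
    by apply: lee_sum => n _; exact: cabs1_kernE.
  rewrite -ge0_sume_distrr; last by move=> n _; exact: kmaj_ge0.
  apply: lee_pmul.
  - by rewrite lee_fin.
  - by apply: sume_ge0 => n _; exact: kmaj_ge0.
  - by rewrite lee_fin lerDl.
  - exact: kmaj_sum_le_lim.
have [gi _ gc] := @cint_csum _ (fun n t => kern n i (1, t) * E i t) G
  (fun n => cmeas_kernE_section n i 1) mG Goo fG.
have GE t : (G t < +oo)%E = (kmaj_lim w t < +oo)%E.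
  have := kmaj_lim_ge0 w0 t; rewrite /G; case: (kmaj_lim w t) => [r| |//] _.
    by rewrite -EFinM !ltry.
  by rewrite gt0_muley// lte_fin.
have gE : (fun t => if (G t < +oo)%E then csum (fun n => kern n i (1, t) * E i t) else 0) =
    (fun tau => kern_lim w q cc i tau * E i tau).
  apply/funext => t; rewrite GE /kern_lim; case: ifP => tfin; last by rewrite mul0r.
  have [c1 _] := @csum_cvg _ (fun n => kern n i (1, t)) _ (kern_sum_fine mw w0 mq qw cc1 i tfin).
  have [c2 _] : ccvg (fun K => \sum_(n < K) (kern n i (1, t) * E i t))
      (csum (fun n => kern n i (1, t) * E i t)) /\ N (csum (fun n => kern n i (1, t) * E i t)) <= fine (G t).
    apply: csum_cvg => K; rewrite -lee_fin -sumEFin fineK; first exact: fG.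
    rewrite ge0_fin_numE ?GE// /G mule_ge0 ?lee_fin ?(ltW M1)//; exact: kmaj_lim_ge0.
  apply: (ccvg_unique c2); rewrite mulrC.
  under eq_fun do rewrite -mulr_suml mulrC.
  exact: ccvgMl.
rewrite -gE; split => //; rewrite /sol; congr (_ + _).
exact: (ccvg_unique (pic_cvg i x01)).
Qed.
End Picard.

Local Open Scope complex_scope.

(** * Complex exponentials, derivatives and absolute continuity *)

Section ComplexCalculus.
Variable R : realType.
Local Notation C := R[i].
Local Notation Re := (@complex.Re R).
Local Notation Im := (@complex.Im R).
Local Notation mu := (@lebesgue_measure R).
Local Notation N := (@cabs1 R).
Implicit Types (z u v : C) (f g : R -> C).

Lemma cexp0 : cexp (0 : C) = 1.
Proof. by rewrite /cexp /= expR0 cos0 sin0 mulr1 mulr0. Qed.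

Lemma cexpD z u : cexp (z + u) = cexp z * cexp u.
Proof.
by apply: ReIm_eq; rewrite !ReImE /= ?ReD ?ImD expRD ?cosD ?sinD; ring.
Qed.

Lemma cexpN_mul z : cexp (- z) * cexp z = 1.
Proof. by rewrite -cexpD addNr cexp0. Qed.

Lemma cabs1_cexp_le z : N (cexp z) <= 2 * expR (Re z).
Proof.
rewrite /N /cexp /= !normrM (ger0_norm (expR_ge0 _)) -mulrDr mulrC.
rewrite ler_wpM2r ?expR_ge0// [leRHS](_ : 2 = 1 + 1)//.
by rewrite lerD// ler_norml ?cos_geN1 ?cos_le1 ?sin_geN1 ?sin_le1.
Qed.

Lemma cmeas_cexp d (T : measurableType d) (h : T -> C) : cmeas h -> cmeas (fun t => cexp (h t)).
Proof.
move=> [h1 h2]; split => /=; apply: measurable_funM.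
- by apply: (measurableT_comp (f := expR)).
- apply: (measurableT_comp (f := cos)) => //.
  exact: (continuous_measurable_fun (@continuous_cos R)).
- by apply: (measurableT_comp (f := expR)).
- apply: (measurableT_comp (f := sin)) => //.
  exact: (continuous_measurable_fun (@continuous_sin R)).
Qed.

Lemma cmeas_lin z : cmeas (fun t : R => z * t%:C).
Proof.
by apply: cmeasM; [exact: cmeas_cst|split => //=; exact: measurable_cst].
Qed.

Lemma has_cderiv_eq f x u v : has_cderiv f x u -> u = v -> has_cderiv f x v.
Proof. by move=> h <-. Qed.

Lemma has_cderiv_cst z x : has_cderiv (fun=> z) x 0.
Proof. by split => /=; exact: is_derive_cst. Qed.

Lemma has_cderivD f g x u v : has_cderiv f x u -> has_cderiv g x v ->
  has_cderiv (fun t => f t + g t) x (u + v).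
Proof.
move=> [h1 h2] [k1 k2]; split; rewrite ?ReD ?ImD.
  have -> : (fun t => Re (f t + g t)) = (fun t => Re (f t)) + (fun t => Re (g t)).
    by apply/funext => t; rewrite ReD.
  exact: is_deriveD.
have -> : (fun t => Im (f t + g t)) = (fun t => Im (f t)) + (fun t => Im (g t)).
  by apply/funext => t; rewrite ImD.
exact: is_deriveD.
Qed.

Lemma has_cderivM f g x u v : has_cderiv f x u -> has_cderiv g x v ->
  has_cderiv (fun t => f t * g t) x (u * g x + f x * v).
Proof.
move=> [h1 h2] [k1 k2]; split.
  have -> : (fun t => Re (f t * g t)) = (fun t => Re (f t)) * (fun t => Re (g t)) -
       (fun t => Im (f t)) * (fun t => Im (g t)).
    by apply/funext => t; rewrite ReM.
  apply: is_derive_eq; rewrite !ReImE /GRing.scale/=; ring.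
have -> : (fun t => Im (f t * g t)) = (fun t => Re (f t)) * (fun t => Im (g t)) +
     (fun t => Im (f t)) * (fun t => Re (g t)).
  by apply/funext => t; rewrite ImM.
apply: is_derive_eq; rewrite !ReImE /GRing.scale/=; ring.
Qed.

Lemma has_cderivB f g x u v : has_cderiv f x u -> has_cderiv g x v ->
  has_cderiv (fun t => f t - g t) x (u - v).
Proof.
move=> hf hg; have := has_cderivD hf (has_cderivM (has_cderiv_cst (-1) x) hg).
rewrite mul0r add0r mulN1r; congr (has_cderiv _ _ _); apply/funext => t.
by rewrite mulN1r.
Qed.

Lemma has_cderiv_cexp z x :
  has_cderiv (fun t => cexp (z * t%:C)) x (z * cexp (z * x%:C)).
Proof.
have dl (a : R) : is_derive x (1 : R) (fun t => a * t) a.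
  have := is_deriveZ a (is_derive_id x (1 : R)).
  by rewrite /GRing.scale/= mulr1; congr is_derive.
have E1 (t : R) : Re (z * t%:C) = Re z * t by rewrite ReM /= mulr0 subr0.
have E2 (t : R) : Im (z * t%:C) = Im z * t by rewrite ImM /= mulr0 add0r.
have de : is_derive x (1 : R) (expR \o (fun t => Re z * t)) (expR (Re z * x) * Re z).
  exact: is_derive1_comp.
have dc : is_derive x (1 : R) (cos \o (fun t => Im z * t)) (- sin (Im z * x) * Im z).
  exact: is_derive1_comp.
have ds : is_derive x (1 : R) (sin \o (fun t => Im z * t)) (cos (Im z * x) * Im z).
  exact: is_derive1_comp.
split; rewrite /cexp.
  have -> : (fun t : R => Re ((expR (Re (z * t%:C)) * cos (Im (z * t%:C))) +i*
      (expR (Re (z * t%:C)) * sin (Im (z * t%:C))))) =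
     (expR \o (fun t => Re z * t)) * (cos \o (fun t => Im z * t)).
    by apply/funext => t; rewrite E1 E2.
  by apply: is_derive_eq; rewrite E1 E2 !ReImE /GRing.scale/=; ring.
have -> : (fun t : R => Im ((expR (Re (z * t%:C)) * cos (Im (z * t%:C))) +i*
      (expR (Re (z * t%:C)) * sin (Im (z * t%:C))))) =
     (expR \o (fun t => Re z * t)) * (sin \o (fun t => Im z * t)).
    by apply/funext => t; rewrite E1 E2.
by apply: is_derive_eq; rewrite E1 E2 !ReImE /GRing.scale/=; ring.
Qed.

Lemma acont01_bounded_derive (f df : R -> R) (L : R) :
  (forall x : R, is_derive x (1 : R) f (df x)) ->
  (forall x : R, 0 <= x <= 1 -> `|df x| <= L) -> acont01 f.
Proof.
move=> fd dL; apply: (acont01_lip (L := L)) => a b a0 ab b1.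
have [|c cab ->] := MVT_segment ab (fun x _ => fd x).
  by apply: derivable_within_continuous => x _; have [] := fd x.
rewrite normrM (ger0_norm (_ : 0 <= b - a)) ?subr_ge0// ler_wpM2r ?subr_ge0// dL//.
move: cab; rewrite in_itv/= => /andP[ac cb].
by rewrite (le_trans a0 ac) (le_trans cb b1).
Qed.

Definition cacont f := acont01 (fun t => Re (f t)) /\ acont01 (fun t => Im (f t)).

Lemma abs_continuous01P f : abs_continuous01 f <-> cacont f.
Proof.
split=> [acf|[h1 h2]].
  split=> e e0; have [d d0 hd] := acf e e0; exists d => // n a b ab tI sd;
    apply: le_lt_trans (hd n a b ab tI sd); apply: ler_sum => i _.
    by rewrite (le_trans _ (Re_le_normc _))// !ReImE.
  by rewrite (le_trans _ (Im_le_normc _))// !ReImE.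
move=> e e0; have e2 : 0 < e / 2 by rewrite divr_gt0.
have [d d0 hd] := h1 _ e2; have [d' d'0 hd'] := h2 _ e2.
exists (Num.min d d'); first by rewrite lt_min d0.
move=> n a b ab tI; rewrite lt_min => /andP[sd sd'].
have k1 := hd n a b ab tI sd; have k2 := hd' n a b ab tI sd'.
apply: (@le_lt_trans _ _ (\sum_(i < n) `|Re (f (b i)) - Re (f (a i))| +
  \sum_(i < n) `|Im (f (b i)) - Im (f (a i))|)); last by lra.
rewrite -big_split; apply: ler_sum => i _ /=.
by rewrite (le_trans (normc_le_cabs1 _))// /N !ReImE.
Qed.

Lemma cacontD f g : cacont f -> cacont g -> cacont (fun t => f t + g t).
Proof.
move=> [? ?] [? ?]; split.
  by rewrite (funext (fun t => ReD (f t) (g t))); apply: acont01D.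
by rewrite (funext (fun t => ImD (f t) (g t))); apply: acont01D.
Qed.

Lemma cacontM f g : cacont f -> cacont g -> cacont (fun t => f t * g t).
Proof.
move=> [? ?] [? ?]; split.
  rewrite (funext (fun t => ReM (f t) (g t))).
  by apply: (acont01B (acont01M _ _) (acont01M _ _)).
rewrite (funext (fun t => ImM (f t) (g t))).
by apply: (acont01D (acont01M _ _) (acont01M _ _)).
Qed.

Lemma cacont_cst z : cacont (fun=> z).
Proof.
by split; apply: (acont01_lip (L := 0)) => a b _ _ _; rewrite subrr normr0 mul0r.
Qed.

Lemma cacontB f g : cacont f -> cacont g -> cacont (fun t => f t - g t).
Proof.
move=> acf acg; have := cacontD acf (cacontM (cacont_cst (-1)) acg).
by congr cacont; apply/funext => t; rewrite mulN1r.
Qed.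

Lemma cexp_lin_bound z : exists2 M : R, 0 <= M &
  forall x : R, 0 <= x <= 1 -> N (cexp (z * x%:C)) <= M.
Proof.
exists (2 * expR `|Re z|); first by rewrite mulr_ge0// expR_ge0.
move=> x /andP[x0 x1]; rewrite (le_trans (cabs1_cexp_le _))// ler_pM2l// ler_expR.
rewrite ReM /= mulr0 subr0 (le_trans (ler_norm _))// normrM (ger0_norm x0).
by rewrite ler_piMr.
Qed.

Lemma cacont_cexp z : cacont (fun t => cexp (z * t%:C)).
Proof.
have [M M0 hM] := cexp_lin_bound z.
have key x : 0 <= x <= 1 -> N (z * cexp (z * x%:C)) <= N z * M.
  move=> x01; rewrite (le_trans (cabs1M _ _))// ler_wpM2l ?cabs1_ge0//; exact: hM.
split; apply: (acont01_bounded_derive (L := N z * M)).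
- by move=> x; exact: (has_cderiv_cexp z x).1.
- by move=> x x01; rewrite (le_trans _ (key x x01))// lerDl.
- by move=> x; exact: (has_cderiv_cexp z x).2.
- by move=> x x01; rewrite (le_trans _ (key x x01))// lerDr.
Qed.

Lemma cacont_zero_deriv f : cacont f ->
  {ae mu, forall x : R, 0 < x < 1 -> has_cderiv f x 0} -> f 1 = f 0.
Proof.
move=> [h1 h2] fd; have x01 : (0 : R) <= 1 <= (1 : R) by rewrite ler01 lexx.
apply: ReIm_eq.
  by apply: (acont01_zero_derive h1) x01; apply: ae_mono fd => x h /h[].
by apply: (acont01_zero_derive h2) x01; apply: ae_mono fd => x h /h[].
Qed.

Definition cprim f (x : R) := cint (fun t => if t <= x then f t else 0).

Lemma cprim_ReIm f x : Re (cprim f x) = primitive (fun t => Re (f t)) x /\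
  Im (cprim f x) = primitive (fun t => Im (f t)) x.
Proof.
rewrite !primitiveE /cprim /=; split; apply: eq_Rintegral => t _.
  by rewrite (fun_if Re).
by rewrite (fun_if Im).
Qed.

Lemma cacont_cprim f : cintegrable f -> cacont (cprim f).
Proof.
move=> fi; split.
  rewrite (funext (fun x => (cprim_ReIm f x).1)); apply: acont01_integral.
  exact: cintegrable_Re.
rewrite (funext (fun x => (cprim_ReIm f x).2)); apply: acont01_integral.
exact: cintegrable_Im.
Qed.

Lemma has_cderiv_cprim f : cintegrable f ->
  {ae mu, forall x : R, has_cderiv (cprim f) x (f x)}.
Proof.
move=> fi; have h1 := is_derive_primitive (cintegrable_Re fi).
have h2 := is_derive_primitive (cintegrable_Im fi).
apply: ae_mono2 h1 h2 => x h1 h2; split.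
  by rewrite (funext (fun x => (cprim_ReIm f x).1)).
by rewrite (funext (fun x => (cprim_ReIm f x).2)).
Qed.
End ComplexCalculus.

(** * The fundamental matrix *)

Section FirstOrderSystem.
Variable R : realType.
Local Notation C := R[i].
Local Notation mu := (@lebesgue_measure R).
Local Notation N := (@cabs1 R).
Variables (b1 b2 : R) (lambda : C).

Definition bb (i : bool) : R := if i then b1 else b2.

(* The system [-i B^-1 y' + Q y = lambda y] solved for [y'], with
   [q i = -i b_i Q_(i, ~~ i)]; the component [y_1] is indexed by [true]. *)
Definition fsol (q y : bool -> R -> C) := (forall i, cacont (y i)) /\
  {ae mu, forall x : R, 0 < x < 1 -> forall i,
    has_cderiv (y i) x ('i * (bb i)%:C * lambda * y i x + q i x * y (~~ i) x)}.

Definition wronskian (y z : bool -> R -> C) x := y true x * z false x - y false x * z true x.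

(** The off-diagonal terms cancel in the derivative of the Wronskian, which is therefore the trace i
    (b_1 + b_2) lambda times the Wronskian. Multiplied by the inverse exponential it has derivative
    zero almost everywhere. *)
Lemma wronskian1 q y z : fsol q y -> fsol q z ->
  wronskian y z 1 = cexp ('i * (b1 + b2)%:C * lambda) * wronskian y z 0.
Proof.
move=> [acy dy] [acz dz].
pose kappa := 'i * (b1 + b2)%:C * lambda.
pose g x := cexp (- kappa * x%:C) * wronskian y z x.
have acg : cacont g.
  apply: cacontM; first exact: cacont_cexp.
  by apply: cacontB; exact: cacontM.
have dg : {ae mu, forall x : R, 0 < x < 1 -> has_cderiv g x 0}.
  apply: ae_mono2 dy dz => x dy dz x01.
  have dyx := dy x01; have dzx := dz x01.
  apply: has_cderiv_eq.
    apply: has_cderivM; first exact: has_cderiv_cexp.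
    by apply: has_cderivB; apply: has_cderivM => //.
  rewrite /= /wronskian /kappa rmorphD /=; ring.
have := cacont_zero_deriv acg dg; rewrite /g mulr1 mulr0 cexp0 mul1r => <-.
by rewrite mulrA -cexpD subrr cexp0 mul1r.
Qed.

Lemma wronskian_cramer (y1 y2 z : bool -> R -> C) x i :
  wronskian y1 y2 x * z i x = wronskian z y2 x * y1 i x + wronskian y1 z x * y2 i x.
Proof. by case: i; rewrite /wronskian; ring. Qed.

Lemma cexp_neq0 (z : C) : cexp z != 0.
Proof.
apply/eqP => z0; have := cexpN_mul z; rewrite z0 mulr0 => /eqP.
by rewrite eq_sym oner_eq0.
Qed.

Definition delta (k i : bool) : C := (i == k)%:R.

(** Liouville's formula takes the place of Gronwall's inequality: all Wronskians at 1 are fixed by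
    the initial values, mixed ones between [y] and [z] included, and Cramer's rule recovers the
    solutions from them since the Wronskian of the columns of [y] is nonzero. *)
Lemma fsol_unique q (y z : bool -> bool -> R -> C) :
  (forall k, fsol q (y k)) -> (forall k, fsol q (z k)) ->
  (forall k i, y k i 0 = delta k i) -> (forall k i, z k i 0 = delta k i) ->
  forall k i, y k i 1 = z k i 1.
Proof.
move=> fy fz y0 z0 k i.
have W k1 k2 : wronskian (y k1) (y k2) 1 = wronskian (z k1) (y k2) 1.
  by rewrite (wronskian1 (fy _) (fy _)) (wronskian1 (fz _) (fy _)) /wronskian !y0 !z0.
have W' k1 k2 : wronskian (y k1) (y k2) 1 = wronskian (y k1) (z k2) 1.
  by rewrite (wronskian1 (fy _) (fy _)) (wronskian1 (fy _) (fz _)) /wronskian !y0 !z0.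
have W0 : wronskian (y true) (y false) 1 != 0.
  rewrite (wronskian1 (fy _) (fy _)) /wronskian !y0 /delta /= mulr0 subr0 !mulr1.
  exact: cexp_neq0.
apply: (mulfI W0).
rewrite (wronskian_cramer (y true) (y false) (z k)) (wronskian_cramer (y true) (y false) (y k)).
by rewrite W W'.
Qed.

Section Existence.
Variable w : R -> R.
Hypothesis mw : measurable_fun setT w.
Hypothesis w0 : forall t, 0 <= w t.
Hypothesis wsupp : forall t, ~~ (0 <= t <= 1) -> w t = 0.
Hypothesis wi : mu.-integrable setT (EFin \o w).
Hypothesis kmaj_lim_fin : (\int[mu]_tau kmaj_lim w tau < +oo)%E.
Variables (q : bool -> R -> C) (cc : bool -> C).
Hypothesis mq : forall i, cmeas (q i).
Hypothesis qw : forall i t, N (q i t) <= w t.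
Hypothesis cc1 : forall i, N (cc i) <= 1.

Definition ephase (i : bool) : C := 'i * (bb (~~ i) - bb i)%:C * lambda.

(** The ansatz y_i = e^{i b_i lambda x} U_i removes the diagonal of the system and leaves U_i' = q_i
    E_i U_j, whose integrated form [sol] satisfies. *)
Lemma fsol_exists : exists2 y : bool -> R -> C, fsol q y & forall i,
  [/\ y i 0 = cc i,
      cintegrable (fun tau => kern_lim w q cc i tau * cexp (ephase i * tau%:C)) &
      y i 1 = cexp ('i * (bb i)%:C * lambda) *
       (cc i + cint (fun tau => kern_lim w q cc i tau * cexp (ephase i * tau%:C)))].
Proof.
pose E i (t : R) := cexp (ephase i * t%:C).
have mE i : cmeas (E i) by apply: cmeas_cexp; exact: cmeas_lin.
have EB i (t tau : R) : E i (t - tau) = E i t * E (~~ i) tau.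
  rewrite /E -cexpD; congr cexp; rewrite /ephase negbK !rmorphB /=; ring.
have [M M0 EM] : exists2 M : R, 0 <= M & forall i t, 0 <= t <= 1 -> N (E i t) <= M.
  have [M1 M10 h1] := cexp_lin_bound (ephase true).
  have [M2 M20 h2] := cexp_lin_bound (ephase false).
  exists (M1 + M2); first exact: addr_ge0.
  move=> [] t t01; first by rewrite (le_trans (h1 t t01))// lerDl.
  by rewrite (le_trans (h2 t t01))// lerDr.
pose f i t := q i t * E i t * sol q cc E (~~ i) t.
have fi i : cintegrable (f i) by exact: (cintegrable_sol mw w0 wsupp wi mq qw cc1 mE EB M0 EM).
(* Equal to [sol] on [0, 1], but visibly a constant plus a primitive, hence absolutely continuous
   and differentiable almost everywhere. *)
pose U i x := cc i + cprim (f i) x.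
have Usol i x : 0 <= x <= 1 -> U i x = sol q cc E i x.
  move=> x01; have [_ ->] := sol_integral_restrict mw w0 wsupp wi mq qw cc1 mE EB M0 EM i x01.
  by rewrite /U.
pose e i (x : R) := cexp ('i * (bb i)%:C * lambda * x%:C).
have eE i x : e i x * E i x = e (~~ i) x.
  rewrite /e /E -cexpD; congr cexp; rewrite /ephase !rmorphB /=; ring.
have f_supp i t : t < 0 -> f i t = 0.
  move=> t0; rewrite /f (q_supp wsupp qw) ?mul0r//.
  by rewrite negb_and -ltNge t0.
have U0 i : U i 0 = cc i.
  rewrite /U -[RHS]addr0; congr (_ + _); apply: ReIm_eq.
    by rewrite (cprim_ReIm _ _).1 primitive0// => t t0; rewrite f_supp.
  by rewrite (cprim_ReIm _ _).2 primitive0// => t t0; rewrite f_supp.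
exists (fun i x => e i x * U i x).
  split=> [i|].
    apply: cacontM; first exact: cacont_cexp.
    by apply: cacontD; [exact: cacont_cst|exact: cacont_cprim].
  have d1 := has_cderiv_cprim (fi true); have d2 := has_cderiv_cprim (fi false).
  apply: ae_mono2 d1 d2 => x d1 d2 /andP[x0 x1] i.
  have x01 : 0 <= x <= 1 by rewrite !ltW.
  have di : has_cderiv (cprim (f i)) x (f i x) by case: i.
  apply: has_cderiv_eq.
    apply: has_cderivM; first exact: has_cderiv_cexp.
    by apply: has_cderivD; [exact: has_cderiv_cst|exact: di].
  rewrite -[cexp _]/(e i x) -[in RHS]eE [in RHS](Usol (~~ i))// /f /U; ring.
move=> i; split.
- by rewrite /e mulr0 cexp0 mul1r U0.
- exact: (sol1_kern_lim mw w0 wsupp wi mq qw cc1 mE M0 EM kmaj_lim_fin i).1.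
- rewrite /e mulr1 Usol ?ler01 ?lexx//.
  by rewrite (sol1_kern_lim mw w0 wsupp wi mq qw cc1 mE M0 EM kmaj_lim_fin i).2.
Qed.
End Existence.

Hypotheses (b10 : b1 != 0) (b20 : b2 != 0).

(** Components are indexed by booleans because the other component is then [~~ i]; [ix] returns to
    matrix indices. *)
Definition ix (i : bool) : 'I_2 := if i then ord0 else ord_max.

Lemma ixK (j : 'I_2) : ix (j == ord0) = j.
Proof. by apply/val_inj; case: j => [[|[|]]]. Qed.

Lemma ix_eq0 i : (ix i == ord0) = i. Proof. by case: i. Qed.

Lemma sum_ix (F : 'I_2 -> C) i : \sum_j F j = F (ix i) + F (ix (~~ i)).
Proof.
rewrite big_ord_recl big_ord1; have -> : lift ord0 ord0 = ord_max :> 'I_2 by exact/val_inj.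
by case: i => //=; rewrite addrC.
Qed.

Lemma bb_neq0 i : (bb i)%:C != 0 :> C.
Proof. by rewrite fmorph_eq0; case: i. Qed.

Lemma invmx_Bmx_mul n (D : 'M[C]_(2, n)) i k :
  (invmx (Bmx b1 b2) *m D) (ix i) k = ((bb i)%:C)^-1 * D (ix i) k.
Proof.
pose Bi : 'M[C]_2 := diag_mx (\row_j ((if j == ord0 then b1 else b2)%:C)^-1).
have BBi : Bmx b1 b2 *m Bi = 1%:M.
  rewrite /Bmx mulmx_diag; apply/matrixP => r s; rewrite !mxE.
  case: (r == s); rewrite ?mulr0n ?mulr1n// mulfV//.
  by rewrite fmorph_eq0; case: ifP.
have -> : invmx (Bmx b1 b2) = Bi.
  have [uB _] := mulmx1_unit BBi.
  by rewrite -[LHS]mulmx1 -BBi mulKmx.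
by rewrite mul_diag_mx !mxE; case: i.
Qed.

(** With zero diagonal, row i of Q Phi contains a single product, and multiplication by i b_i solves
    the equation for the derivative; the matrix equation is one system [fsol] per column. *)
Lemma is_fundamentalP (Q : R -> 'M[C]_2) (q : bool -> R -> C) (Phi : R -> 'M[C]_2) :
  (forall x, 0 <= x <= 1 -> forall i, Q x i i = 0) ->
  (forall x, 0 <= x <= 1 -> forall i, q i x = - 'i * (bb i)%:C * Q x (ix i) (ix (~~ i))) ->
  is_fundamental b1 b2 Q lambda Phi <->
  ((forall k, fsol q (fun i x => Phi x (ix i) (ix k))) /\ Phi 0 = 1%:M).
Proof.
move=> Q0 qE.
have ii : 'i * 'i = -1 :> C by apply: ReIm_eq => /=; ring.
have QPhi x (i k : bool) : 0 <= x <= 1 ->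
    (Q x *m Phi x) (ix i) (ix k) = Q x (ix i) (ix (~~ i)) * Phi x (ix (~~ i)) (ix k).
  by move=> x01; rewrite mxE (sum_ix _ i) Q0// mul0r add0r.
split=> [[acP dP P0]|[fP P0]]; split => //.
- move=> k; split => [i|]; first by apply/abs_continuous01P; exact: acP.
  apply: ae_mono dP => x dP x01; have [D dD eqD] := dP x01; move=> i.
  have {}x01 : 0 <= x <= 1 by case/andP: x01 => ? ?; rewrite !ltW.
  apply: has_cderiv_eq; first exact: dD.
  have := congr1 (fun M : 'M[C]_2 => M (ix i) (ix k)) eqD; rewrite qE//=.
  rewrite [LHS]mxE [X in X + _]mxE [RHS]mxE invmx_Bmx_mul QPhi//.
  move: (bb i)%:C (bb_neq0 i) => B B0; set d := D _ _; set p := Phi x (ix i) _.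
  set p' := Phi x _ _; set e := Q x _ _ => h.
  have dE : d = 'i * B * (- 'i * (B^-1 * d)).
    rewrite [RHS](_ : _ = - ('i * 'i) * (B * B^-1) * d); last by ring.
    by rewrite ii opprK mulfV// !mul1r.
  by rewrite [LHS]dE -(addrK (e * p') (- 'i * _)) h; ring.
- by move=> j k; apply/abs_continuous01P; rewrite -(ixK j) -(ixK k); have [h _] := fP (k == ord0); exact: h.
- have [_ h1] := fP true; have [_ h2] := fP false.
  apply: ae_mono2 h1 h2 => x h1 h2 x01.
  have {}x01' : 0 <= x <= 1 by case/andP: x01 => ? ?; rewrite !ltW.
  have key (i k : bool) : has_cderiv (fun t => Phi t (ix i) (ix k)) x
    ('i * (bb i)%:C * lambda * Phi x (ix i) (ix k) + q i x * Phi x (ix (~~ i)) (ix k)).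
    by case: k; [exact: h1|exact: h2].
  exists (\matrix_(j, k) ('i * (bb (j == ord0))%:C * lambda * Phi x (ix (j == ord0)) (ix (k == ord0))
     + q (j == ord0) x * Phi x (ix (~~ (j == ord0))) (ix (k == ord0)))).
    by move=> j k; rewrite mxE; have := key (j == ord0) (k == ord0); rewrite !ixK.
  apply/matrixP => j k; rewrite -(ixK j) -(ixK k); move: (j == ord0) (k == ord0) => i l.
  rewrite [LHS]mxE [X in X + _]mxE [RHS]mxE invmx_Bmx_mul QPhi// mxE !ix_eq0 qE//.
  move: (bb i)%:C (bb_neq0 i) => B B0; set p := Phi x (ix i) _.
  set p' := Phi x _ _; set e := Q x _ _.
  rewrite [LHS](_ : _ = - ('i * 'i) * (B^-1 * B) * (lambda * p) +
    ('i * 'i) * (B^-1 * B) * (e * p') + e * p'); last by ring.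
  by rewrite ii mulVf//; ring.
Qed.
End FirstOrderSystem.

(** * The determinant in terms of the fundamental matrix *)

Section CharacteristicDeterminant.
Variable R : realType.
Local Notation C := R[i].
Local Notation mu := (@lebesgue_measure R).
Local Notation N := (@cabs1 R).
Variables (b1 b2 : R).
Hypotheses (b10 : b1 != 0) (b20 : b2 != 0).
Local Notation bb := (bb b1 b2).

Lemma cabs1_delta k i : N (delta R k i) <= 1.
Proof. by rewrite /delta /N; case: (i == k); rewrite /= ?normr1 normr0 ?addr0. Qed.

Section Majorized.
Variable w : R -> R.
Hypothesis mw : measurable_fun setT w.
Hypothesis w0 : forall t, 0 <= w t.
Hypothesis wsupp : forall t, ~~ (0 <= t <= 1) -> w t = 0.
Hypothesis wi : mu.-integrable setT (EFin \o w).
Hypothesis kmaj_lim_fin : (\int[mu]_tau kmaj_lim w tau < +oo)%E.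

Section OnePotential.
Variables (Q : R -> 'M[C]_2) (q : bool -> R -> C).
Hypothesis Q0 : forall x, 0 <= x <= 1 -> forall i, Q x i i = 0.
Hypothesis qE : forall x, 0 <= x <= 1 ->
  forall i, q i x = - 'i * (bb i)%:C * Q x (ix i) (ix (~~ i)).
Hypothesis mq : forall i, cmeas (q i).
Hypothesis qw : forall i t, N (q i t) <= w t.

(** The constructed columns show that there is a fundamental matrix to choose, and [fsol_unique]
    forces the chosen one to have their values at 1. The last clause is Liouville's formula. *)
Lemma fundamental_values lambda :
  let Phi := fundamental b1 b2 Q lambda in
  [/\ Phi 0 = 1%:M,
    forall i k, Phi 1 (ix i) (ix k) = cexp ('i * (bb i)%:C * lambda) * (delta R k i +
      cint (fun tau => kern_lim w q (delta R k) i tau * cexp (ephase b1 b2 lambda i * tau%:C))) &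
    Phi 1 (ix true) (ix true) * Phi 1 (ix false) (ix false) -
    Phi 1 (ix false) (ix true) * Phi 1 (ix true) (ix false) =
    cexp ('i * (b1 + b2)%:C * lambda)].
Proof.
move=> Phi.
have ex k := fsol_exists b1 b2 lambda mw w0 wsupp wi kmaj_lim_fin mq qw (cabs1_delta k).
have [y fy hy] : exists2 y : bool -> bool -> R -> C, (forall k, fsol b1 b2 lambda q (y k)) &
   forall k i, [/\ y k i 0 = delta R k i, 
     cintegrable (fun tau => kern_lim w q (delta R k) i tau * cexp (ephase b1 b2 lambda i * tau%:C)) &
     y k i 1 = cexp ('i * (bb i)%:C * lambda) * (delta R k i +
      cint (fun tau => kern_lim w q (delta R k) i tau * cexp (ephase b1 b2 lambda i * tau%:C)))].
  have [y1 f1 h1] := ex true; have [y2 f2 h2] := ex false.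
  by exists (fun k => if k then y1 else y2) => -[].
have P1 (Psi : R -> 'M[C]_2) : Psi 0 = 1%:M -> forall k i, Psi 0 (ix i) (ix k) = delta R k i.
  by move=> -> k i; rewrite mxE /delta; case: k; case: i.
have : is_fundamental b1 b2 Q lambda Phi.
  rewrite /Phi /fundamental; apply: xgetPex.
  exists (fun x => \matrix_(j, k) y (k == ord0) (j == ord0) x) => /=.
  apply/(is_fundamentalP lambda b10 b20 _ Q0 qE); split.
    move=> k; have -> // : (fun i x => (\matrix_(j, k0) y (k0 == ord0) (j == ord0) x) (ix i) (ix k)) = y k.
    by apply/funext => i; apply/funext => x; rewrite mxE !ix_eq0.
  apply/matrixP => j k; rewrite !mxE; have [-> _ _] := hy (k == ord0) (j == ord0).
  by rewrite /delta -[in LHS](ixK j) -[in LHS](ixK k) !ix_eq0 -[in RHS](ixK j) -[in RHS](ixK k); case: (j == ord0); case: (k == ord0).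
move=> /(is_fundamentalP lambda b10 b20 _ Q0 qE) [fP P0]; split => //.
  move=> i k; have [_ _ <-] := hy k i.
  apply: (@fsol_unique _ b1 b2 lambda q (fun k i x => Phi x (ix i) (ix k)) y) => //.
    by move=> k' i'; exact: P1.
  by move=> k' i'; have [] := hy k' i'.
have := wronskian1 (fP true) (fP false); rewrite /wronskian !(P1 _ P0) /delta /= => ->.
by rewrite mulr1 mulr0 subr0 mulr1.
Qed.

(** The case lambda = 0 of the integrability in [fsol_exists], where the exponential is 1. *)
Lemma cintegrable_kern_lim k i : cintegrable (kern_lim w q (delta R k) i).
Proof.
have [y _ hy] := fsol_exists b1 b2 0 mw w0 wsupp wi kmaj_lim_fin mq qw (cabs1_delta k).
have [_ + _] := hy i; congr cintegrable; apply/funext => t.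
by rewrite /ephase mulr0 mul0r cexp0 mulr1.
Qed.

Lemma cintegrable_kern_limE lambda k i :
  cintegrable (fun tau => kern_lim w q (delta R k) i tau * cexp (ephase b1 b2 lambda i * tau%:C)).
Proof.
have [y _ hy] := fsol_exists b1 b2 lambda mw w0 wsupp wi kmaj_lim_fin mq qw (cabs1_delta k).
by have [_ + _] := hy i.
Qed.

End OnePotential.

Lemma kern_lim_q0 cc i tau : kern_lim w (fun _ _ => 0) cc i tau = 0.
Proof.
have k0 n j (p : R * R) : kern (fun _ _ => 0) cc n j p = 0.
  case: n => [|n] /=; first by rewrite mulr0 if_same.
  by rewrite -[RHS]cint0; apply: eq_cint => t; rewrite mul0r if_same.
rewrite /kern_lim; case: ifP => // _.
apply: (@ccvg_unique _ (fun K => \sum_(n < K) kern (fun _ _ => 0) cc n i (1, tau))).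
  have [] := @csum_cvg _ (fun n => kern (fun _ _ => 0) cc n i (1, tau)) 0 _ => // n.
  by rewrite big1// => m _; rewrite k0 cabs1_0.
have -> : (fun K => \sum_(n < K) kern (fun _ _ => 0) cc n i (1, tau)) = fun=> 0.
  by apply/funext => K; rewrite big1.
exact: ccvg_cst.
Qed.

Variable A : 'M[C]_(2, 4).
Definition Al : 'M[C]_2 := lsubmx (A : 'M[C]_(2, 2 + 2)).
Definition Ar : 'M[C]_2 := rsubmx (A : 'M[C]_(2, 2 + 2)).

Lemma bformE (y : R -> 'cV[C]_2) : bform A y = Al *m y 0 + Ar *m y 1.
Proof. by rewrite /bform /Al /Ar -mul_row_col hsubmxK. Qed.

Lemma charDetE Q lambda : fundamental b1 b2 Q lambda 0 = 1%:M ->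
  charDet b1 b2 A Q lambda = \det (Al + Ar *m fundamental b1 b2 Q lambda 1).
Proof.
move=> P0; rewrite /charDet; congr (\det _); apply/matrixP => j k.
rewrite mxE bformE P0 [LHS]mxE [RHS]mxE -[Al j k](congr1 (fun M : 'M[C]_2 => M j k) (mulmx1 Al)).
by congr (_ + _); rewrite !mxE; apply: eq_bigr => l _; rewrite !mxE.
Qed.

(** The coefficient of entry (i, k) of S in the linear part of det (Al + Ar S): the determinant of
    [Al] with column k replaced by column i of [Ar]. *)
Definition dcoef (i k : bool) : C :=
  match i, k with
  | true, true => Ar 0 0 * Al 1 1 - Al 0 1 * Ar 1 0
  | false, true => Ar 0 1 * Al 1 1 - Al 0 1 * Ar 1 1
  | true, false => Al 0 0 * Ar 1 0 - Ar 0 0 * Al 1 0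
  | false, false => Al 0 0 * Ar 1 1 - Ar 0 1 * Al 1 0
  end.

Lemma det_2x2 (M : 'M[C]_2) : \det M = M 0 0 * M 1 1 - M 0 1 * M 1 0.
Proof.
rewrite (expand_det_row _ 0) !big_ord_recl big_ord0 addr0 /cofactor !det_mx11 !mxE /=.
rewrite expr0 mul1r expr1 mulN1r mulrN; congr (M _ _ * M _ _ - M _ _ * M _ _); exact/val_inj.
Qed.

(* The quadratic part of the determinant is a multiple of [\det S]. *)
Lemma det_diff (S S' : 'M[C]_2) :
  S 0 0 * S 1 1 - S 1 0 * S 0 1 = S' 0 0 * S' 1 1 - S' 1 0 * S' 0 1 ->
  \det (Al + Ar *m S) - \det (Al + Ar *m S') =
  \sum_(i : bool) \sum_(k : bool) dcoef i k * (S (ix i) (ix k) - S' (ix i) (ix k)).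
Proof.
move=> SS; rewrite !big_bool /ix /= !det_2x2.
have o1 : ord_max = 1 :> 'I_2 by exact/val_inj.
have ME (T : 'M[C]_2) j k : (Al + Ar *m T) j k = Al j k + (Ar j 0 * T 0 k + Ar j 1 * T 1 k).
  by rewrite mxE [X in _ + X]mxE (sum_ix _ true) /ix /= o1.
rewrite o1 [ord0](_ : _ = 0)//.
rewrite !ME.
apply/eqP; rewrite -subr_eq0; apply/eqP.
transitivity ((Ar 0 0 * Ar 1 1 - Ar 0 1 * Ar 1 0) *
  ((S 0 0 * S 1 1 - S 1 0 * S 0 1) - (S' 0 0 * S' 1 1 - S' 1 0 * S' 0 1))); first by ring.
by rewrite SS subrr mulr0.
Qed.
End Majorized.
End CharacteristicDeterminant.

(** * Fourier densities of the characteristic determinant *)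

Section Density.
Variable R : realType.
Local Notation C := R[i].
Local Notation mu := (@lebesgue_measure R).
Local Notation N := (@cabs1 R).
Local Notation I01 := (`[0%R, 1%R]%classic : set R).

Lemma cintegral01E (f : R -> C) :
  cintegral I01 f = cint (fun t => if 0 <= t <= 1 then f t else 0).
Proof.
apply: ReIm_eq => /=; rewrite Rintegral_mkcond; apply: eq_Rintegral => t _;
  by rewrite patchE mem_setE in_itv /=; case: ifP.
Qed.

Lemma cintegrable_le_norm (f g : R -> C) : cmeas f -> (forall t, N (f t) <= N (g t)) ->
  cintegrable g -> cintegrable f.
Proof.
move=> mf fg [mg gi]; apply: (@cintegrable_le _ f (fun t => (N (g t))%:E)) => //.
exact: measurable_cabs1E.
Qed.

Variables (b1 b2 : R).
Hypotheses (b10 : b1 < 0) (b20 : 0 < b2).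

Definition alpha : R := - b1 / (b2 - b1).

Lemma alpha_itv : 0 < alpha < 1.
Proof.
rewrite /alpha; have [h1 h2] := (b10, b20); have b12 : 0 < b2 - b1 by lra.
by rewrite divr_gt0 ?oppr_gt0//= ltr_pdivrMr// mul1r; lra.
Qed.

(* The frequency [b1 + (b2 - b1) tau] vanishes at [tau = alpha]; on either side it is
   [b1 t], respectively [b2 t], with [t] running through [[0, 1]]. *)
Definition lpart (H : R -> C) (t : R) : C :=
  alpha%:C * (if - alpha * t + alpha <= alpha then H (- alpha * t + alpha) else 0).
Definition rpart (H : R -> C) (t : R) : C :=
  (1 - alpha)%:C * (if (1 - alpha) * t + alpha <= alpha then 0 else H ((1 - alpha) * t + alpha)).

(** The two substitutions are the affine maps in [lpart] and [rpart], where their Jacobians already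
    appear as factors. They carry t >= 0 onto either side of [alpha], and t > 1 out of the support
    of [H]. *)
Lemma fourier01_split (H : R -> C) lambda :
  (forall tau, ~~ (0 <= tau <= 1) -> H tau = 0) ->
  cintegrable (fun tau => H tau * cexp ('i * (b1 + (b2 - b1) * tau)%:C * lambda)) ->
  cint (fun tau => H tau * cexp ('i * (b1 + (b2 - b1) * tau)%:C * lambda)) =
  fourier01 b1 (lpart H) lambda + fourier01 b2 (rpart H) lambda.
Proof.
move=> Hsupp; set F := (fun tau => _) => Fi.
have /andP[a0 a1] := alpha_itv.
have b12 : b2 - b1 != 0 by rewrite gt_eqF// subr_gt0 (lt_trans b10).
pose F1 tau := if tau <= alpha then F tau else 0.
pose F2 tau := if tau <= alpha then 0 else F tau.
have mle : measurable_fun setT (fun t : R => t <= alpha).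
  by apply: measurable_fun_ler => //; exact: measurable_cst.
have F1i : cintegrable F1.
  apply: (cintegrable_le_norm _ _ Fi); last by move=> t; rewrite /F1; case: ifP => // _; rewrite cabs1_0 cabs1_ge0.
  by apply: cmeas_if; [exact: mle|exact: Fi.1|exact: cmeas_cst].
have F2i : cintegrable F2.
  apply: (cintegrable_le_norm _ _ Fi); last by move=> t; rewrite /F2; case: ifP => // _; rewrite cabs1_0 cabs1_ge0.
  by apply: cmeas_if; [exact: mle|exact: cmeas_cst|exact: Fi.1].
have -> : cint F = cint F1 + cint F2.
  by rewrite -cintD//; apply: eq_cint => t; rewrite /F1 /F2; case: ifP; rewrite ?addr0 ?add0r.
have an0 : - alpha != 0 by rewrite oppr_eq0 gt_eqF.
have an1 : 1 - alpha != 0 by rewrite subr_eq0 gt_eqF.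
rewrite (cint_affine alpha an0 F1i) (cint_affine alpha an1 F2i).
rewrite normrN (gtr0_norm a0) (@gtr0_norm _ (1 - alpha)) ?subr_gt0//.
rewrite -!cintZ; last 2 first.
- exact: cintegrable_affine.
- exact: cintegrable_affine.
rewrite /fourier01 !cintegral01E; congr (_ + _); apply: eq_cint => t.
  rewrite /F1 /lpart /F; have [t01|t01] := boolP (0 <= t <= 1); last first.
    case: ifPn => ta; last by rewrite mulr0.
    rewrite Hsupp ?mul0r ?mulr0//; apply: contra t01 => /andP[h1 h2].
    rewrite -(ler_pM2l a0) mulr0 -[X in _ && X](ler_pM2l a0) mulr1.
    by apply/andP; split; lra.
  case: ifP => _; last by rewrite mulr0 mul0r.
  rewrite mulrA; congr (_ * cexp _).
  have -> : b1 + (b2 - b1) * (- alpha * t + alpha) = b1 * t by rewrite /alpha; field.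
  by rewrite rmorphM /=; ring.
rewrite /F2 /rpart /F; have [t01|t01] := boolP (0 <= t <= 1); last first.
  case: ifPn => ta; first by rewrite mulr0.
  rewrite Hsupp ?mul0r ?mulr0//; apply: contra t01 => /andP[h1 h2].
  have a1' : 0 < 1 - alpha by rewrite subr_gt0.
  rewrite -(ler_pM2l a1') mulr0 -[X in _ && X](ler_pM2l a1') mulr1.
  by rewrite -ltNge in ta; apply/andP; split; lra.
case: ifP => _; first by rewrite mulr0 mul0r.
rewrite mulrA; congr (_ * cexp _).
have -> : b1 + (b2 - b1) * ((1 - alpha) * t + alpha) = b2 * t by rewrite /alpha; field.
by rewrite rmorphM /=; ring.
Qed.

Lemma cintegrable_lpart (H : R -> C) : cintegrable H -> cintegrable (lpart H).
Proof.
move=> Hi; have /andP[a0 a1] := alpha_itv.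
have an0 : - alpha != 0 by rewrite oppr_eq0 gt_eqF.
have mle : measurable_fun setT (fun t : R => t <= alpha).
  by apply: measurable_fun_ler => //; exact: measurable_cst.
apply: cintegrableZ.
apply: (@cintegrable_affine _ (- alpha) alpha (fun tau => if tau <= alpha then H tau else 0) an0).
apply: (cintegrable_le_norm _ _ Hi); last by move=> t; case: ifP => // _; rewrite cabs1_0 cabs1_ge0.
by apply: cmeas_if; [exact: mle|exact: Hi.1|exact: cmeas_cst].
Qed.

Lemma cintegrable_rpart (H : R -> C) : cintegrable H -> cintegrable (rpart H).
Proof.
move=> Hi; have /andP[a0 a1] := alpha_itv.
have an1 : 1 - alpha != 0 by rewrite subr_eq0 gt_eqF.
have mle : measurable_fun setT (fun t : R => t <= alpha).
  by apply: measurable_fun_ler => //; exact: measurable_cst.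
apply: cintegrableZ.
apply: (@cintegrable_affine _ (1 - alpha) alpha (fun tau => if tau <= alpha then 0 else H tau) an1).
apply: (cintegrable_le_norm _ _ Hi); last by move=> t; case: ifP => // _; rewrite cabs1_0 cabs1_ge0.
by apply: cmeas_if; [exact: mle|exact: cmeas_cst|exact: Hi.1].
Qed.

Lemma measurable_normc (D : set R) (f : R -> C) :
  measurable_fun D (fun t => complex.Re (f t)) -> measurable_fun D (fun t => complex.Im (f t)) ->
  measurable_fun D (fun t => Normc.normc (f t)).
Proof.
move=> m1 m2; under eq_fun do rewrite normc_ReIm.
apply: (measurableT_comp (f := @Num.sqrt R)).
  exact: (continuous_measurable_fun (@sqrt_continuous R)).
by apply: measurable_funD; apply: measurable_funX.
Qed.

Lemma measurable_normc_restrict (f : R -> C) :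
  measurable_fun I01 (fun t => complex.Re (f t)) -> measurable_fun I01 (fun t => complex.Im (f t)) ->
  measurable_fun setT ((fun t => Normc.normc (f t)) \_ I01).
Proof.
move=> m1 m2; apply/(measurable_restrictT _ _).1; first exact: measurable_itv.
exact: measurable_normc.
Qed.

Lemma inLp1_cintegrable (f : R -> C) : cintegrable f -> inLp 1%E f.
Proof.
move=> [[m1 m2] fi].
have k1 : measurable_fun I01 (fun t => complex.Re (f t)) by apply: measurable_funTS.
have k2 : measurable_fun I01 (fun t => complex.Im (f t)) by apply: measurable_funTS.
split => //; rewrite /Lpnorm Lnorm1; apply: le_lt_trans fi; apply: ge0_le_integralT => //.
- apply: measurableT_comp => //; apply/measurable_EFinP.
  exact: measurable_normc_restrict.
- by apply/measurable_EFinP; exact: measurable_cabs1.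
- move=> t /=; rewrite patchE; case: ifP => _; last by rewrite normr0 lee_fin cabs1_ge0.
  by rewrite lee_fin ger0_norm ?normc_ge0// normc_le_cabs1.
Qed.

Section Potential.
Variable w : R -> R.
Hypothesis mw : measurable_fun setT w.
Hypothesis w0 : forall t, 0 <= w t.
Hypothesis wsupp : forall t, ~~ (0 <= t <= 1) -> w t = 0.
Hypothesis wi : mu.-integrable setT (EFin \o w).
Hypothesis kmaj_lim_fin : (\int[mu]_tau kmaj_lim w tau < +oo)%E.
Variable A : 'M[C]_(2, 4).

(** Row 1 of Phi(1) has frequencies b_1 + (b_2 - b_1) tau, row 2 has b_2 + (b_1 - b_2) tau. The
    reflection to 1 - tau brings the second row to the frequencies of the first, so that a single
    density describes the determinant. *)
Definition dens_kern (q : bool -> R -> C) (tau : R) : C :=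
  \sum_(k : bool) (dcoef A true k * kern_lim w q (delta R k) true tau +
    dcoef A false k * kern_lim w q (delta R k) false (1 - tau)).

Definition dcoef_norm : R := \sum_(k : bool) (N (dcoef A true k) + N (dcoef A false k)).

Lemma kmaj_lim_supp tau : ~~ (0 <= tau <= 1) -> kmaj_lim w tau = 0%E.
Proof.
move=> t01; rewrite /kmaj_lim; apply/cvg_lim => //.
have -> : (fun M => kmaj_sum w M (1, tau)) = fun=> 0%E.
  by apply/funext => M; rewrite /kmaj_sum big1// => n _; rewrite kmaj_supp.
exact: cvg_cst.
Qed.

Section OnePotential.
Variables (Q : R -> 'M[C]_2) (q : bool -> R -> C).
Hypothesis Q0 : forall x, 0 <= x <= 1 -> forall i, Q x i i = 0.
Hypothesis qE : forall x, 0 <= x <= 1 ->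
  forall i, q i x = - 'i * (bb b1 b2 i)%:C * Q x (ix i) (ix (~~ i)).
Hypothesis mq : forall i, cmeas (q i).
Hypothesis qw : forall i t, N (q i t) <= w t.

Lemma kern_lim_supp k i tau : ~~ (0 <= tau <= 1) -> kern_lim w q (delta R k) i tau = 0.
Proof.
move=> t01; apply: cabs1_eq0; have := kern_lim_le mw w0 mq qw (@cabs1_delta R k) i tau.
by rewrite kmaj_lim_supp.
Qed.

Lemma dens_kern_supp tau : ~~ (0 <= tau <= 1) -> dens_kern q tau = 0.
Proof.
move=> t01; rewrite /dens_kern big1// => k _; rewrite !kern_lim_supp ?mulr0 ?addr0//.
by apply: contra t01 => /andP[h1 h2]; apply/andP; split; lra.
Qed.

Lemma cintegrable_reflect (f : R -> C) x : cintegrable f -> cintegrable (fun t => f (x - t)).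
Proof.
move=> fi; have n1 : (-1 : R) != 0 by rewrite oppr_eq0 oner_eq0.
by have := cintegrable_affine x n1 fi; under eq_fun do rewrite mulN1r addrC.
Qed.

Let b1n : b1 != 0. Proof. by rewrite lt_eqF. Qed.
Let b2n : b2 != 0. Proof. by rewrite gt_eqF. Qed.

Lemma cintegrable_dens_kern : cintegrable (dens_kern q).
Proof.
rewrite /dens_kern; under eq_fun do rewrite big_bool /=.
by apply: cintegrableD; apply: cintegrableD; apply: cintegrableZ => //;
  try apply: cintegrable_reflect;
  exact: (cintegrable_kern_lim b1 b2 mw w0 wsupp wi kmaj_lim_fin mq qw).
Qed.

Lemma charDet_dens_kern lambda :
  cintegrable (fun tau => dens_kern q tau * cexp ('i * (b1 + (b2 - b1) * tau)%:C * lambda)) /\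
  charDet b1 b2 A Q lambda - charDet b1 b2 A (fun=> 0) lambda =
  cint (fun tau => dens_kern q tau * cexp ('i * (b1 + (b2 - b1) * tau)%:C * lambda)).
Proof.
have [P0 P1 PW] := fundamental_values b1n b2n mw w0 wsupp wi kmaj_lim_fin Q0 qE mq qw lambda.
have z0 (x : R) : 0 <= x <= 1 -> forall i, (0 : 'M[C]_2) i i = 0 by move=> _ i; rewrite mxE.
have zE (x : R) : 0 <= x <= 1 -> forall i, 0 = - 'i * (bb b1 b2 i)%:C * (0 : 'M[C]_2) (ix i) (ix (~~ i)).
  by move=> _ i; rewrite mxE mulr0.
have zm (i : bool) : cmeas (fun _ : R => 0 : C) by exact: cmeas_cst.
have zw (i : bool) (t : R) : N 0 <= w t by rewrite cabs1_0.
(* The zero potential is treated with the same weight; its kernels vanish and only the diagonal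
   exponentials remain. *)
have [P0' P1' PW'] := @fundamental_values _ b1 b2 b1n b2n w mw w0 wsupp wi kmaj_lim_fin
  (fun=> 0) (fun _ _ => 0) z0 zE zm zw lambda.
pose P (tau : R) := cexp ('i * (b1 + (b2 - b1) * tau)%:C * lambda).
pose L k i := kern_lim w q (delta R k) i.
have S0 i k : fundamental b1 b2 (fun=> 0) lambda 1 (ix i) (ix k) =
    cexp ('i * (bb b1 b2 i)%:C * lambda) * delta R k i.
  rewrite P1' (@eq_cint _ _ (fun=> 0)); first by rewrite cint0 addr0.
  by move=> tau; rewrite kern_lim_q0 mul0r.
have DD i k : fundamental b1 b2 Q lambda 1 (ix i) (ix k) -
    fundamental b1 b2 (fun=> 0) lambda 1 (ix i) (ix k) =
    cexp ('i * (bb b1 b2 i)%:C * lambda) * cint (fun tau => L k i tau * cexp (ephase b1 b2 lambda i * tau%:C)).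
  by rewrite P1 S0 mulrDr addrC addKr.
have Li k i := cintegrable_kern_limE b1 b2 mw w0 wsupp wi kmaj_lim_fin mq qw lambda k i.
have XE k : cintegrable (fun tau => L k true tau * P tau) /\
    fundamental b1 b2 Q lambda 1 (ix true) (ix k) - fundamental b1 b2 (fun=> 0) lambda 1 (ix true) (ix k) =
    cint (fun tau => L k true tau * P tau).
  have E : (fun tau => cexp ('i * b1%:C * lambda) * (L k true tau * cexp (ephase b1 b2 lambda true * tau%:C))) =
    (fun tau => L k true tau * P tau).
    apply/funext => tau; rewrite mulrCA -cexpD; congr (_ * cexp _).
    by rewrite /ephase /= !(rmorphD, rmorphM, rmorphB, rmorphN) /=; ring.
  rewrite -E DD; split; first exact: cintegrableZ (Li k true).
  by rewrite cintZ//; exact: Li.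
have YE k : cintegrable (fun tau => L k false (1 - tau) * P tau) /\
    fundamental b1 b2 Q lambda 1 (ix false) (ix k) - fundamental b1 b2 (fun=> 0) lambda 1 (ix false) (ix k) =
    cint (fun tau => L k false (1 - tau) * P tau).
  have E : (fun tau : R => cexp ('i * b2%:C * lambda) * (L k false (1 - tau) *
      cexp (ephase b1 b2 lambda false * (1 - tau)%:C))) =
    (fun tau => L k false (1 - tau) * P tau).
    apply/funext => tau; rewrite mulrCA -cexpD; congr (_ * cexp _).
    by rewrite /ephase /= !(rmorphD, rmorphM, rmorphB, rmorphN, rmorph1) /=; ring.
  have Lr := cintegrable_reflect 1 (Li k false).
  rewrite -E DD -(cint_reflect 1 (Li k false)); split; first exact: cintegrableZ Lr.
  by rewrite -cintZ.
(* The side condition says that both matrices have the same determinant, which is Liouville's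
   formula for each. *)
rewrite !charDetE// det_diff; last first.
  have o1 : 1 = ix false :> 'I_2 by exact/val_inj.
  have o0 : 0 = ix true :> 'I_2 by [].
  by rewrite o1 o0 PW PW'.
have HE : (fun tau => dens_kern q tau * P tau) = (fun tau =>
   (dcoef A true true * (L true true tau * P tau) + dcoef A false true * (L true false (1 - tau) * P tau)) +
   (dcoef A true false * (L false true tau * P tau) + dcoef A false false * (L false false (1 - tau) * P tau))).
  by apply/funext => tau; rewrite /dens_kern big_bool /= /L; ring.
have [X1 X1E] := XE true; have [X2 X2E] := XE false.
have [Y1 Y1E] := YE true; have [Y2 Y2E] := YE false.
have Z1 := cintegrableD (cintegrableZ (dcoef A true true) X1) (cintegrableZ (dcoef A false true) Y1).
have Z2 := cintegrableD (cintegrableZ (dcoef A true false) X2) (cintegrableZ (dcoef A false false) Y2).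
rewrite -[X in cintegrable X]/(fun tau => dens_kern q tau * P tau) HE; split.
  exact: (cintegrableD Z1 Z2).
rewrite !big_bool X1E X2E Y1E Y2E.
have W1 := cintD (cintegrableZ (dcoef A true true) X1) (cintegrableZ (dcoef A false true) Y1).
have W2 := cintD (cintegrableZ (dcoef A true false) X2) (cintegrableZ (dcoef A false false) Y2).
rewrite (cintD Z1 Z2) W1 W2 (cintZ _ X1) (cintZ _ X2) (cintZ _ Y1) (cintZ _ Y2) /=.
move: (cint (fun tau => L true true tau * P tau)) (cint (fun tau => L false true tau * P tau))
  (cint (fun tau => L true false (1 - tau) * P tau))
  (cint (fun tau => L false false (1 - tau) * P tau))
  (dcoef A true true) (dcoef A true false) (dcoef A false true) (dcoef A false false).
move=> x1 x2 y1 y2 d1 d2 d3 d4; ring.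
Qed.
End OnePotential.
End Potential.
End Density.

(** * Uniqueness of the densities *)

Section LaplaceUniqueness.
Variable R : realType.
Local Notation mu := (@lebesgue_measure R).

Lemma bernoulli_ge (x : R) m : 0 <= x <= 1 -> 1 - m%:R * x <= (1 - x) ^+ m.
Proof.
move=> /andP[x0 x1]; elim: m => [|m IH]; first by rewrite mul0r subr0 expr0.
have h : 0 <= m%:R * x by rewrite mulr_ge0.
have : (1 - m%:R * x) * (1 - x) <= (1 - x) ^+ m.+1.
  by rewrite exprSr ler_wpM2r// subr_ge0.
apply: le_trans; rewrite -natr1.
have : 0 <= m%:R * x * x by rewrite mulr_ge0.
lra.
Qed.

Lemma bernoulli_le (x : R) m : 0 <= x <= 1 -> (1 - x) ^+ m * (1 + m%:R * x) <= 1.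
Proof.
move=> /andP[x0 x1].
have h : 1 + m%:R * x <= (1 + x) ^+ m.
  elim: m => [|m IH]; first by rewrite mul0r addr0 expr0.
  rewrite exprSr -natr1; have : 0 <= m%:R * x * x by rewrite !mulr_ge0.
  have : (1 + m%:R * x) * (1 + x) <= (1 + x) ^+ m * (1 + x) by rewrite ler_wpM2r// addr_ge0.
  lra.
have p0 : 0 <= (1 - x) ^+ m by rewrite exprn_ge0// subr_ge0.
rewrite (le_trans (ler_wpM2l p0 h))// -exprMn exprn_ile1//; nra.
Qed.

(* On [[0, 1]] these converge boundedly to the indicator of [z < 1/2]. *)
Definition step_poly n : {poly R} := (1 - 'X^n) ^+ (2 ^ n).

Lemma step_polyE n (z : R) : (step_poly n).[z] = (1 - z ^+ n) ^+ (2 ^ n).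
Proof. by rewrite /step_poly !hornerE. Qed.

Lemma step_poly_itv n (z : R) : 0 <= z <= 1 -> 0 <= (step_poly n).[z] <= 1.
Proof.
move=> /andP[z0 z1]; rewrite step_polyE.
have h0 : 0 <= z ^+ n by rewrite exprn_ge0.
have h1 : z ^+ n <= 1 by rewrite exprn_ile1.
by rewrite exprn_ge0 ?exprn_ile1 ?subr_ge0//; lra.
Qed.

(** With x = z^n and m = 2^n, so that m x = (2 z)^n, Bernoulli's inequalities bound the value from
    below by 1 - (2 z)^n and from above by (2 z)^-n. At z = 1/2 the limit would be 1/e. *)
Lemma step_poly_cvg (z : R) : 0 <= z <= 1 -> z != 2^-1 ->
  (step_poly n).[z] @[n --> \oo] --> ((z < 2^-1)%R%:R : R).
Proof.
move=> /andP[z0 z1] z2.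
have zn n : 0 <= z ^+ n <= 1 by rewrite exprn_ge0// exprn_ile1.
have E n : (2 ^ n)%:R * z ^+ n = (2 * z) ^+ n by rewrite natrX exprMn.
case: ltgtP z2 => // zlt _ /=.
  have c : (1 - (2 * z) ^+ n) @[n --> \oo] --> (1 - 0 : R).
    apply: cvgB; first exact: cvg_cst.
    by apply: cvg_expr; rewrite ger0_norm ?mulr_ge0//; lra.
  rewrite subr0 in c; apply: (squeeze_cvgr _ c (cvg_cst _)).
  apply: nearW => n; have /andP[_ ->] := @step_poly_itv n z ltac:(by rewrite z0 z1).
  by rewrite andbT step_polyE -E; exact: bernoulli_ge.
have c : ((2 * z)^-1) ^+ n @[n --> \oo] --> (0 : R).
  apply: cvg_expr; rewrite normfV ger0_norm ?mulr_ge0// invf_lt1; lra.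
apply: (squeeze_cvgr _ (cvg_cst _) c).
apply: nearW => n; have /andP[p0 _] := @step_poly_itv n z ltac:(by rewrite z0 z1).
rewrite p0/=; have := @bernoulli_le (z ^+ n) (2 ^ n) (zn n).
rewrite -step_polyE E exprVn => h.
have y0 : 0 < (2 * z) ^+ n by rewrite exprn_gt0//; lra.
by rewrite -[X in _ <= X]mul1r ler_pdivlMr//; lra.
Qed.

Lemma cvg_Rintegral_bounded (h : R -> R) (phi : nat -> R -> R) (psi : R -> R) :
  mu.-integrable setT (EFin \o h) -> (forall n, measurable_fun setT (phi n)) ->
  measurable_fun setT psi -> (forall n t, `|h t * phi n t| <= `|h t|) ->
  {ae mu, forall t : R, h t * phi n t @[n --> \oo] --> h t * psi t} ->
  (\int[mu]_t (h t * phi n t)) @[n --> \oo] --> \int[mu]_t (h t * psi t).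
Proof.
move=> hi mphi mpsi hb hc.
have mh : measurable_fun setT h by apply/measurable_EFinP; exact: measurable_int hi.
have [] := @dominated_convergence _ _ _ mu setT measurableT
  (fun n t => (h t * phi n t)%:E) (fun t => (h t * psi t)%:E) (fun t => `|h t|%:E).
- by move=> n; apply/measurable_EFinP; apply: measurable_funM => //; exact: mphi.
- by apply/measurable_EFinP; apply: measurable_funM.
- apply: ae_mono hc => t hc _; apply/fine_cvgP; split; last exact: hc.
  by apply: nearW.
- exact: (integrable_abse hi).
- by apply: nearW => t n; rewrite /= lee_fin.
- move=> ki _ c; apply: fine_cvg; rewrite fineK; first exact: c.
  exact: integrable_fin_num.
Qed.

Lemma measurable_ltr_nat (f g : R -> R) : measurable_fun setT f -> measurable_fun setT g ->
  measurable_fun setT (fun t => (f t < g t)%R%:R : R).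
Proof.
move=> mf mg; rewrite [X in measurable_fun _ X](_ : _ = fun t => if f t < g t then 1 else 0).
  by apply: measurable_fun_ifT => //; exact: measurable_fun_ltr.
by apply/funext => t; case: ltP.
Qed.

Lemma ae_neq (t0 : R) : {ae mu, forall t : R, t != t0}.
Proof.
exists [set t0]; split => //; first exact: lebesgue_measure_set1.
by move=> t /= /negP; rewrite negbK => /eqP.
Qed.

Lemma Rintegral_neq (f g : R -> R) (t0 : R) : measurable_fun setT f -> measurable_fun setT g ->
  (forall t, t != t0 -> f t = g t) -> \int[mu]_t f t = \int[mu]_t g t.
Proof.
move=> mf mg fg; congr fine; apply: ae_eq_integral => //; try exact/measurable_EFinP.
by apply: ae_mono (ae_neq t0) => t /fg -> .
Qed.

Variables (b1 b2 : R).
Hypotheses (b10 : b1 < 0) (b20 : 0 < b2).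
Variables (h1 h2 : R -> R).
Hypotheses (h1i : mu.-integrable setT (EFin \o h1)) (h2i : mu.-integrable setT (EFin \o h2)).
Hypotheses (h1s : forall t, ~~ (0 <= t <= 1) -> h1 t = 0)
  (h2s : forall t, ~~ (0 <= t <= 1) -> h2 t = 0).
Hypothesis laplace0 : forall eta : R,
  \int[mu]_t (h1 t * expR (b1 * eta * t)) + \int[mu]_t (h2 t * expR (b2 * eta * t)) = 0.

Lemma integrable_bounded_mul (h phi : R -> R) (M : R) : mu.-integrable setT (EFin \o h) ->
  measurable_fun setT phi -> (forall t, `|h t * phi t| <= M * `|h t|) ->
  mu.-integrable setT (EFin \o (fun t => h t * phi t)).
Proof.
move=> hi mphi hb.
have mh : measurable_fun setT h by apply/measurable_EFinP; exact: measurable_int hi.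
apply: le_integrable (integrableZl measurableT `|M| hi) => //.
  by apply/measurable_EFinP; exact: measurable_funM.
move=> t _ /=; rewrite lee_fin (le_trans (hb t))// [leRHS]normrM normr_id.
by rewrite ler_wpM2r// ler_norm.
Qed.

Section Threshold.
Variable s0 : R.
Hypothesis s0b1 : b1 < s0.

(** Chosen so that [zz b t] crosses 1/2 exactly where b t = s0. Since b1 is the least value of b t
    on [0, 1] for both frequencies, [zz] stays in [0, 1] there. *)
Let theta := ln 2 / (s0 - b1).
Let theta0 : 0 < theta.
Proof. by rewrite divr_gt0 ?subr_gt0// ln_gt0// ltr1n. Qed.
Let zz (b t : R) := expR (- theta * (b * t - b1)).

Let measurable_zz b : measurable_fun setT (zz b).
Proof.
apply: (measurableT_comp (f := expR)) => //; apply: measurable_funM => //.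
by apply: measurable_funB => //; apply: measurable_funM.
Qed.

Let zz_itv b t : b1 <= b * t -> 0 <= zz b t <= 1.
Proof.
move=> bt; rewrite /zz expR_ge0/= -(expR0 R) ler_expR mulNr oppr_le0 mulr_ge0 ?subr_ge0//.
exact: ltW.
Qed.

Let zz_half b t : (zz b t < 2^-1) = (s0 < b * t).
Proof.
have -> : 2^-1 = expR (- ln 2) :> R by rewrite expRN lnK// posrE.
rewrite /zz ltr_expR mulNr ltrN2 -[X in X < _](_ : theta * (s0 - b1) = _); last first.
  by rewrite /theta divfK// gt_eqF// subr_gt0.
by rewrite ltr_pM2l// ltrD2r.
Qed.

Let zz_half_eq b t : (zz b t == 2^-1) = (s0 == b * t).
Proof.
have -> : 2^-1 = expR (- ln 2) :> R by rewrite expRN lnK// posrE.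
rewrite /zz (inj_eq (@expR_inj R)) mulNr eqr_opp eq_sym -[X in X == _](_ : theta * (s0 - b1) = _); last first.
  by rewrite /theta divfK// gt_eqF// subr_gt0.
by rewrite (inj_eq (mulfI (lt0r_neq0 theta0))) (inj_eq (addIr _)).
Qed.

(** Powers of [zz] are exponentials e^{b eta t} times a constant that does not depend on [b]. The
    same coefficients thus occur for both frequencies, and the vanishing Laplace sums can be
    combined linearly. *)
Let horner_zz_integrable (p : {poly R}) b h : mu.-integrable setT (EFin \o h) ->
  (forall t, ~~ (0 <= t <= 1) -> h t = 0) -> b = b1 \/ b = b2 ->
  mu.-integrable setT (EFin \o (fun t => h t * p.[zz b t])) /\
  \int[mu]_t (h t * p.[zz b t]) =
  \sum_(i < size p) p`_i * expR (theta * b1 * i%:R) * \int[mu]_t (h t * expR (b * (- theta * i%:R) * t)).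
Proof.
move=> hi hs _.
have zE i t : zz b t ^+ i = expR (theta * b1 * i%:R) * expR (b * (- theta * i%:R) * t).
  by rewrite /zz -expRM_natr -expRD; congr expR; ring.
have hE eta t : `|h t * expR (b * eta * t)| <= expR `|b * eta| * `|h t|.
  have [/andP[t0 t1]|/hs ->] := boolP (0 <= t <= 1); last by rewrite mul0r normr0 mulr0.
  rewrite normrM mulrC ler_wpM2r// (ger0_norm (expR_ge0 _)) ler_expR.
  rewrite (le_trans (ler_norm _))// normrM (ger0_norm t0).
  by rewrite ler_piMr.
have ei eta : mu.-integrable setT (EFin \o (fun t => h t * expR (b * eta * t))).
  apply: integrable_bounded_mul (hE eta) => //.
  apply: (measurableT_comp (f := expR)) => //; exact: measurable_funM.
pose c i := p`_i * expR (theta * b1 * i%:R).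
have E t : h t * p.[zz b t] =
    \sum_(i < size p) c i * (h t * expR (b * (- theta * i%:R) * t)).
  rewrite horner_coef mulr_sumr; apply: eq_bigr => i _; rewrite zE /c; ring.
rewrite (funext E).
elim: (size p) => [|n [IH1 IH2]].
  under eq_fun do rewrite big_ord0; rewrite big_ord0; split; last by rewrite Rintegral_cst// mul0r.
  exact: integrable0.
under eq_fun do rewrite big_ord_recr; rewrite big_ord_recr/= -IH2.
have ci := integrableZl measurableT (c n) (ei (- theta * n%:R)).
split; first exact: (integrableD measurableT IH1 ci).
by rewrite RintegralD// RintegralZl.
Qed.

Let horner_zz0 (p : {poly R}) :
  \int[mu]_t (h1 t * p.[zz b1 t]) + \int[mu]_t (h2 t * p.[zz b2 t]) = 0.
Proof.
have [_ ->] := horner_zz_integrable p h1i h1s (or_introl erefl).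
have [_ ->] := horner_zz_integrable p h2i h2s (or_intror erefl).
rewrite -big_split/= big1// => i _; rewrite -mulrDr laplace0 mulr0//.
Qed.

Lemma threshold0 : \int[mu]_t (h1 t * (s0 < b1 * t)%R%:R) +
  \int[mu]_t (h2 t * (s0 < b2 * t)%R%:R) = 0.
Proof.
have cv b h : b != 0 -> mu.-integrable setT (EFin \o h) -> (forall t, ~~ (0 <= t <= 1) -> h t = 0) ->
    (forall t, 0 <= t <= 1 -> b1 <= b * t) ->
    (\int[mu]_t (h t * (step_poly n).[zz b t])) @[n --> \oo] -->
    \int[mu]_t (h t * (s0 < b * t)%R%:R).
  move=> b0 hi hs hb; apply: cvg_Rintegral_bounded => //.
  - move=> n; apply: (measurableT_comp (f := horner (step_poly n))) => //.
    by apply: continuous_measurable_fun; exact: continuous_horner.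
  - apply: measurable_ltr_nat; [exact: measurable_cst|exact: measurable_funM].
  - move=> n t; have [t01|/hs ->] := boolP (0 <= t <= 1); last by rewrite !mul0r.
    have /andP[p0 p1] := step_poly_itv n (zz_itv (hb t t01)).
    by rewrite normrM (ger0_norm p0) ler_piMr.
  (* The one point where [zz] equals 1/2 has to be discarded. *)
  - apply: ae_mono (ae_neq (s0 / b)) => t ts0.
    have [t01|/hs ->] := boolP (0 <= t <= 1); last first.
      by rewrite mul0r; under eq_fun do rewrite mul0r; exact: cvg_cst.
    apply: cvgM; first exact: cvg_cst.
    rewrite -zz_half; apply: step_poly_cvg; first exact: zz_itv (hb t t01).
    rewrite zz_half_eq; apply: contra ts0 => /eqP ->; rewrite mulrC mulKf//.
have cc := cvgD (cv b1 h1 (ltr0_neq0 b10) h1i h1s _) (cv b2 h2 (lt0r_neq0 b20) h2i h2s _).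
have {}cc := cc _ _.
have hb1 (t : R) : 0 <= t <= 1 -> b1 <= b1 * t by move=> /andP[t0 t1]; have := b10; nra.
have hb2 (t : R) : 0 <= t <= 1 -> b1 <= b2 * t by move=> /andP[t0 t1]; have [] := (b10, b20); nra.
have {}cc := cc (@filter_filter _ _ eventually_filter) hb1 hb2.
rewrite [X in X @ _](_ : _ = cst 0) in cc; last by apply/funext => n; exact: horner_zz0.
have c0 : (fun _ : nat => 0 : R) @ \oo --> (0 : R) by exact: cvg_cst.
by apply/esym; exact: cvg_unique c0 cc.
Qed.
End Threshold.

(** A nonnegative threshold does not see the first function, as b_1 t <= 0. *)
Let int2 y : 0 <= y -> \int[mu]_t (h2 t * (y < t)%R%:R) = 0.
Proof.
move=> y0; have := @threshold0 (b2 * y) (lt_le_trans b10 (mulr_ge0 (ltW b20) y0)).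
rewrite [X in X + _](_ : _ = 0) ?add0r; last first.
  under eq_Rintegral => t _.
    rewrite (_ : _ * _ = 0); first over.
    have [/andP[t0 t1]|/h1s ->] := boolP (0 <= t <= 1); last by rewrite mul0r.
    rewrite (_ : (_ < _) = false) ?mulr0//; apply/negbTE; rewrite -leNgt.
    by rewrite (le_trans (mulr_le0_ge0 (ltW b10) t0))// mulr_ge0// ltW.
  by rewrite Rintegral_cst// mul0r.
by under eq_Rintegral do rewrite ltr_pM2l//.
Qed.

Let mh1 : measurable_fun setT h1.
Proof. by apply/measurable_EFinP; exact: measurable_int h1i. Qed.
Let mh2 : measurable_fun setT h2.
Proof. by apply/measurable_EFinP; exact: measurable_int h2i. Qed.

Let int2T : \int[mu]_t h2 t = 0.
Proof.
rewrite -(int2 (lexx 0)); apply: (@Rintegral_neq _ _ 0) => //.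
  apply: measurable_funM => //; apply: measurable_ltr_nat => //.
move=> t t0; have [/andP[t1 _]|/h2s ->] := boolP (0 <= t <= 1); last by rewrite mul0r.
by rewrite lt_neqAle eq_sym t0 t1 mulr1.
Qed.

Let primitive2 y : 0 <= y -> primitive h2 y = 0.
Proof.
move=> y0; rewrite primitiveE.
have mi : measurable_fun setT (fun t : R => (y < t)%R%:R : R) by exact: measurable_ltr_nat.
have hi : mu.-integrable setT (EFin \o (fun t => h2 t * (y < t)%R%:R)).
  apply: (@integrable_bounded_mul _ _ 1) => // t.
  by rewrite mul1r normrM; case: (y < t); rewrite ?normr1 ?normr0 ?mulr0 ?mulr1.
have := RintegralB measurableT h2i hi; rewrite int2// int2T subrr => h; rewrite -[RHS]h.
by apply: eq_Rintegral => t _; rewrite leNgt; case: (y < t); rewrite ?mulr1 ?mulr0 ?subrr ?subr0.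
Qed.

(** A negative threshold captures the whole of [h2], whose integral is already known to vanish; y <
    1 keeps the threshold above b1. *)
Let primitive1 y : 0 < y < 1 -> primitive h1 y = 0.
Proof.
move=> /andP[y0 y1]; have s0b1 : b1 < b1 * y by have := b10; nra.
have := threshold0 s0b1; rewrite [X in _ + X](_ : _ = 0) ?addr0; last first.
  rewrite -int2T; apply: eq_Rintegral => t _.
  have [/andP[t0 t1]|/h2s ->] := boolP (0 <= t <= 1); last by rewrite mul0r.
  rewrite (_ : (_ < _) = true) ?mulr1//.
  by rewrite (@lt_le_trans _ _ 0)// ?nmulr_rlt0// mulr_ge0// ltW.
move=> h; rewrite primitiveE -[RHS]h; apply: (@Rintegral_neq _ _ y).
- apply: measurable_fun_ifT => //; exact: measurable_fun_ler.
- apply: measurable_funM => //; apply: measurable_ltr_nat => //; exact: measurable_funM.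
- by move=> t ty; rewrite ltr_nM2l// le_eqVlt (negbTE ty)/=; case: (t < y); rewrite ?mulr1 ?mulr0.
Qed.

(** By Lebesgue differentiation [h] is almost everywhere the derivative of its primitive, which is
    constant near every interior point. *)
Let derive_zero_on h : mu.-integrable setT (EFin \o h) -> (forall t, ~~ (0 <= t <= 1) -> h t = 0) ->
  (forall y, 0 < y < 1 -> primitive h y = 0) -> {ae mu, forall t : R, h t = 0}.
Proof.
move=> hi hs hp; have d := is_derive_primitive hi.
have hn := ae_mono2 (fun t a b => conj a b) (ae_neq 0) (ae_neq 1).
apply: ae_mono2 hn d => t [t0 t1] dt.
have [/andP[h0 h1']|/hs ->//] := boolP (0 <= t <= 1).
have t01 : 0 < t < 1 by rewrite !lt_neqAle eq_sym t0 h0 t1 h1'.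
have dc : is_derive t (1 : R) (cst 0 : R -> R) 0 by exact: is_derive_cst.
rewrite -(@derive_val _ _ _ _ _ _ _ dt) -(@derive_val _ _ _ _ _ _ _ dc).
apply: near_eq_derive.
have := near_in_itvoo t01.
by apply: filterS => y; rewrite in_itv/= => /hp.
Qed.

Lemma laplace_unique : {ae mu, forall t : R, h1 t = 0} /\ {ae mu, forall t : R, h2 t = 0}.
Proof.
split; apply: derive_zero_on => //.
by move=> y /andP[y0 _]; exact: primitive2 (ltW y0).
Qed.
End LaplaceUniqueness.

(** * From real exponents to Fourier densities *)

Section FourierUniqueness.
Variable R : realType.
Local Notation C := R[i].
Local Notation mu := (@lebesgue_measure R).
Local Notation N := (@cabs1 R).
Local Notation I01 := (`[0%R, 1%R]%classic : set R).

Definition trunc01 (g : R -> C) (t : R) : C := if 0 <= t <= 1 then g t else 0.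

Lemma cmeas_trunc01 (g : R -> C) : measurable_fun I01 (fun t => complex.Re (g t)) ->
  measurable_fun I01 (fun t => complex.Im (g t)) -> cmeas (trunc01 g).
Proof.
have E (f : C -> R) : f 0 = 0 -> (fun t => f (trunc01 g t)) = (fun t => f (g t)) \_ I01.
  move=> f0; apply/funext => t; rewrite patchE mem_setE in_itv /trunc01 /=.
  by case: ifP.
move=> m1 m2; split; rewrite E//; apply/(measurable_restrictT _ _).1 => //.
Qed.

Lemma cintegrable_trunc01 (g : R -> C) : inLp 1%E g -> cintegrable (trunc01 g).
Proof.
move=> [m1 m2 gfin]; have mg := cmeas_trunc01 m1 m2; split => //.
move: gfin; rewrite /Lpnorm Lnorm1 => gfin.
pose h := (fun t => Normc.normc (g t)) \_ I01.
have mh : measurable_fun setT h by exact: measurable_normc_restrict.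
have mah : measurable_fun setT (fun t => `|(EFin \o h) t|%E).
  by apply: measurableT_comp => //; exact/measurable_EFinP.
apply: (@le_lt_trans _ _ (\int[mu]_t (2%:E * `|(EFin \o h) t|))%E).
  apply: ge0_le_integralT => //.
  - by move=> t; rewrite lee_fin cabs1_ge0.
  - exact: measurable_cabs1E.
  - by apply: measurable_funeM.
  - move=> t; rewrite /= -EFinM lee_fin /h patchE mem_setE in_itv /trunc01 /=.
    case: ifP => _; last by rewrite cabs1_0 normr0 mulr0.
    by rewrite ger0_norm ?normc_ge0// cabs1_le_normc.
by rewrite (@ge0_integralZl _ _ _ mu _ measurableT _ mah 2%:E)// lte_mul_pinfty.
Qed.

Lemma fourier01_trunc b (g : R -> C) lambda :
  fourier01 b g lambda = cint (fun t => trunc01 g t * cexp ('i * b%:C * lambda * t%:C)).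
Proof.
by rewrite /fourier01 cintegral01E; apply: eq_cint => t; rewrite /trunc01; case: ifP => // _;
  rewrite mul0r.
Qed.

Lemma fourier01_laplace b (g : R -> C) (eta : R) : fourier01 b g (- 'i * eta%:C) =
  cint (fun t => trunc01 g t * (expR (b * eta * t))%:C).
Proof.
rewrite fourier01_trunc; apply: eq_cint => t; congr (_ * _).
have -> : 'i * b%:C * (- 'i * eta%:C) * t%:C = (b * eta * t)%:C.
  by apply: ReIm_eq; rewrite !(ReM, ImM, ReN, ImN) /=; ring.
by rewrite /cexp /= cos0 sin0 mulr1 mulr0.
Qed.

Variables (b1 b2 : R).
Hypotheses (b10 : b1 < 0) (b20 : 0 < b2).

(** On the imaginary axis the exponentials are real, so that real and imaginary parts of the
    densities separate and [laplace_unique] applies to each. *)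
Lemma fourier01_unique (g1 g2 : R -> C) : inLp 1%E g1 -> inLp 1%E g2 ->
  (forall lambda, fourier01 b1 g1 lambda + fourier01 b2 g2 lambda = 0) ->
  {ae mu, forall t, trunc01 g1 t = 0} /\ {ae mu, forall t, trunc01 g2 t = 0}.
Proof.
move=> /cintegrable_trunc01 g1i /cintegrable_trunc01 g2i h.
have supp (g : R -> C) (t : R) : ~~ (0 <= t <= 1) -> trunc01 g t = 0.
  by rewrite /trunc01 => /negbTE ->.
have L eta : cint (fun t => trunc01 g1 t * (expR (b1 * eta * t))%:C) +
    cint (fun t => trunc01 g2 t * (expR (b2 * eta * t))%:C) = 0.
  by rewrite -!fourier01_laplace.
have Re_scale (g : R -> C) b eta :
    complex.Re (cint (fun t => g t * (expR (b * eta * t))%:C)) =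
    \int[mu]_t (complex.Re (g t) * expR (b * eta * t)).
  by apply: eq_Rintegral => t _; rewrite ReM /= mulr0 subr0.
have Im_scale (g : R -> C) b eta :
    complex.Im (cint (fun t => g t * (expR (b * eta * t))%:C)) =
    \int[mu]_t (complex.Im (g t) * expR (b * eta * t)).
  by apply: eq_Rintegral => t _; rewrite ImM /= mulr0 add0r mulrC.
have [re1 re2] : {ae mu, forall t : R, complex.Re (trunc01 g1 t) = 0} /\
    {ae mu, forall t : R, complex.Re (trunc01 g2 t) = 0}.
  apply: (laplace_unique b10 b20); [exact: cintegrable_Re|exact: cintegrable_Re|..].
  - by move=> t /supp ->.
  - by move=> t /supp ->.
  - by move=> eta; rewrite -!Re_scale -ReD L.
have [im1 im2] : {ae mu, forall t : R, complex.Im (trunc01 g1 t) = 0} /\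
    {ae mu, forall t : R, complex.Im (trunc01 g2 t) = 0}.
  apply: (laplace_unique b10 b20); [exact: cintegrable_Im|exact: cintegrable_Im|..].
  - by move=> t /supp ->.
  - by move=> t /supp ->.
  - by move=> eta; rewrite -!Im_scale -ImD L.
split; [apply: ae_mono2 re1 im1 => t u v|apply: ae_mono2 re2 im2 => t u v]; exact: ReIm_eq.
Qed.
End FourierUniqueness.

(** * Bounds on L^p norms *)

Section Gauge.
Variable R : realType.
Local Notation mu := (@lebesgue_measure R).

Lemma lebesgue_measure01 : mu (`[0%R, 1%R]%classic : set R) = 1%E.
Proof. by rewrite -[LHS]/(lebesgue_measure _) lebesgue_measure_itv/= lte_fin ltr01 oppr0 adde0. Qed.

Lemma integral_indic01 : (\int[mu]_t (\1_(`[0%R, 1%R]%classic : set R) t)%:E = 1)%E.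
Proof. by rewrite integral_indic// setIT; exact: lebesgue_measure01. Qed.

Variable p : \bar R.
Hypothesis p1 : (1 <= p)%E.

(* For nonnegative [f] this says [Lnorm mu p f <= c]; when [p = +oo], the sup norm is
   approached through all finite exponents. *)
Definition gauge (c : R) (f : R -> \bar R) : Prop := forall s : R, 1 <= s ->
  p = +oo%E \/ p = s%:E -> (\int[mu]_t ((f t * (c^-1)%:E) `^ s) <= 1)%E.

Lemma measurable_gauge (f : R -> \bar R) (c s : R) : measurable_fun setT f ->
  measurable_fun setT (fun t => ((f t * c%:E) `^ s)%E).
Proof.
move=> mf; apply: (measurableT_comp (f := fun x : \bar R => (x `^ s)%E)).
  exact: measurable_poweR.
by apply: emeasurable_funM => //; exact: measurable_cst.
Qed.

Lemma gauge_le (c : R) (f g : R -> \bar R) : 0 < c ->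
  measurable_fun setT f -> measurable_fun setT g -> (forall t, (0 <= f t)%E) ->
  {ae mu, forall t : R, (f t <= g t)%E} -> gauge c g -> gauge c f.
Proof.
move=> c0 mf mg f0 fg Gg s s1 ps; apply: le_trans (Gg s s1 ps).
have ci : (0 <= (c^-1)%:E)%E by rewrite lee_fin invr_ge0 ltW.
apply: ae_ge0_le_integral => //.
- by move=> t _; exact: poweR_ge0.
- exact: measurable_gauge.
- by move=> t _; exact: poweR_ge0.
- exact: measurable_gauge.
apply: ae_mono fg => t fg _; apply: le_poweR; first exact: le_trans s1.
- by rewrite mule_ge0.
- by rewrite lee_wpmul2r.
Qed.

Lemma gauge_scale (a c : R) (f : R -> \bar R) : 0 < a -> 0 < c ->
  gauge c f -> gauge (a * c) (fun t => (a%:E * f t)%E).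
Proof.
move=> a0 c0 Gf s s1 ps; have := Gf s s1 ps; congr (_ <= _)%E.
apply: eq_integral => t _; congr (_ `^ _)%E.
rewrite [RHS]muleAC -EFinM [RHS]muleC; congr (_ * _%:E)%E; rewrite invfM mulrA mulfV ?mul1r//.
by rewrite gt_eqF.
Qed.

Lemma gauge_mono (c c' : R) (f : R -> \bar R) : 0 < c -> c <= c' ->
  measurable_fun setT f -> (forall t, (0 <= f t)%E) -> gauge c f -> gauge c' f.
Proof.
move=> c0 cc' mf f0 Gf s s1 ps; apply: le_trans (Gf s s1 ps).
have c'0 : 0 < c' by exact: lt_le_trans cc'.
apply: ge0_le_integralT.
- by move=> t; exact: poweR_ge0.
- exact: measurable_gauge.
- exact: measurable_gauge.
move=> t; apply: le_poweR; first exact: le_trans s1.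
  by rewrite mule_ge0// lee_fin invr_ge0 ltW.
by rewrite lee_wpmul2l// lee_fin lef_pV2.
Qed.

Lemma poweR_midpoint (s : R) (x y : \bar R) : 1 <= s -> (0 <= x)%E -> (0 <= y)%E ->
  (((x + y) * (2^-1)%:E) `^ s <= (2^-1)%:E * (x `^ s) + (2^-1)%:E * (y `^ s))%E.
Proof.
move=> s1; have s0 : s != 0 by rewrite gt_eqF// (lt_le_trans _ s1).
have h2 : (0 < (2^-1 : R)%:E)%E by rewrite lte_fin invr_gt0.
have ny (z : \bar R) : (0 <= z)%E -> ((2^-1)%:E * (z `^ s) != -oo)%E.
  by move=> z0; rewrite -ltNye (lt_le_trans ltNy0)// mule_ge0 ?poweR_ge0// ltW.
case: x => [x| |//] x0; last first.
  by move=> y0; rewrite (poweRyr s0) gt0_muley// [leRHS]addye ?leey ?ny.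
case: y => [y| |//] y0; last by rewrite (poweRyr s0) gt0_muley// [leRHS]addey ?leey ?ny.
rewrite !poweR_EFin -!EFinM -!EFinD lee_fin.
have h0 : 0 <= (2^-1 : R) by rewrite invr_ge0.
have h1 : (2^-1 : R) <= 1 by rewrite invf_le1 ?ler1n.
have E1 : unstable.onem 2^-1 = 2^-1 :> R by rewrite /unstable.onem; field.
have E2 : conv (Itv01 h0 h1) (x : R^o) (y : R^o) = (x + y) / 2 :> R.
  rewrite -[LHS]/(2^-1 * x + unstable.onem 2^-1 * y) E1; ring.
have xI : (x : R) \in (`[0, +oo[%classic : set R) by rewrite inE/= in_itv/= andbT.
have yI : (y : R) \in (`[0, +oo[%classic : set R) by rewrite inE/= in_itv/= andbT.
have h : ((x + y) / 2) `^ s <= 2^-1 * x `^ s + unstable.onem 2^-1 * y `^ s.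
  by rewrite -E2; exact: (@convex_powR R s s1 (Itv01 h0 h1) x y xI yI).
by rewrite E1 in h.
Qed.

(** Midpoint convexity of the power: (f + g) / (2 c) is the mean of f / c and g / c. With equal
    bounds nothing is lost against Minkowski's inequality. *)
Lemma gauge_add (c : R) (f g : R -> \bar R) : 0 < c ->
  measurable_fun setT f -> measurable_fun setT g ->
  (forall t, (0 <= f t)%E) -> (forall t, (0 <= g t)%E) ->
  gauge c f -> gauge c g -> gauge (2 * c) (fun t => (f t + g t)%E).
Proof.
move=> c0 mf mg f0 g0 Gf Gg s s1 ps.
have ci : (0 <= (c^-1)%:E)%E by rewrite lee_fin invr_ge0 ltW.
have h2 : (0 <= (2^-1 : R)%:E)%E by rewrite lee_fin invr_ge0.
pose F t := ((f t * (c^-1)%:E) `^ s)%E; pose G t := ((g t * (c^-1)%:E) `^ s)%E.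
have mF : measurable_fun setT F by exact: measurable_gauge.
have mG : measurable_fun setT G by exact: measurable_gauge.
apply: (@le_trans _ _ (\int[mu]_t ((2^-1)%:E * F t + (2^-1)%:E * G t))%E).
  apply: ge0_le_integralT.
  - by move=> t; exact: poweR_ge0.
  - by apply: measurable_gauge; exact: emeasurable_funD.
  - by apply: emeasurable_funD; exact: measurable_funeM.
  - move=> t; rewrite [X in (X `^ _)%E](_ : _ =
      ((f t * (c^-1)%:E + g t * (c^-1)%:E) * (2^-1)%:E)%E); last first.
      by rewrite -ge0_muleDl// -muleA -EFinM invfM mulrC.
    by apply: poweR_midpoint => //; rewrite mule_ge0.
rewrite ge0_integralD//; last 4 first.
- by move=> t _; rewrite mule_ge0// poweR_ge0.
- exact: measurable_funeM.
- by move=> t _; rewrite mule_ge0// poweR_ge0.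
- exact: measurable_funeM.
rewrite (@ge0_integralZl _ _ _ mu _ measurableT _ mF _ (fun t _ => poweR_ge0 _ _) h2).
rewrite (@ge0_integralZl _ _ _ mu _ measurableT _ mG _ (fun t _ => poweR_ge0 _ _) h2).
apply: (@le_trans _ _ ((2^-1)%:E * 1 + (2^-1)%:E * 1)%E).
  by apply: leeD; apply: lee_wpmul2l => //; [exact: Gf|exact: Gg].
by rewrite !mule1 -EFinD lee_fin; lra.
Qed.

(** The change of variable costs a factor 1 / |a|, and |a|^s <= |a| pays for it because |a| <= 1 <=
    s. *)
Lemma gauge_affine (a b c : R) (f : R -> \bar R) : 0 < `|a| <= 1 -> 0 < c ->
  measurable_fun setT f -> (forall t, (0 <= f t)%E) ->
  gauge c f -> gauge c (fun t => (`|a|%:E * f (a * t + b)%R)%E).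
Proof.
move=> /andP[a0 a1] c0 mf f0 Gf s s1 ps; apply: le_trans (Gf s s1 ps).
have an0 : a != 0 by rewrite -normr_gt0.
have ci : (0 <= (c^-1)%:E)%E by rewrite lee_fin invr_ge0 ltW.
have mF : measurable_fun setT (fun t => ((f t * (c^-1)%:E) `^ s)%E) by exact: measurable_gauge.
have mf' : measurable_fun setT (fun t => f (a * t + b)).
  by apply: (measurableT_comp mf); exact: measurable_affine.
rewrite (@ge0_integral_affine _ a b (fun t => ((f t * (c^-1)%:E) `^ s)%E) an0 mF) => [|t]; last exact: poweR_ge0.
rewrite -ge0_integralZl//; last 2 first.
- by apply: (measurableT_comp mF); exact: measurable_affine.
- by move=> t _; exact: poweR_ge0.
apply: ge0_le_integralT.
- by move=> t; exact: poweR_ge0.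
- by apply: measurable_gauge; exact: measurable_funeM.
- by apply: measurable_funeM; apply: (measurableT_comp mF); exact: measurable_affine.
move=> t; rewrite -muleA (@poweRM _ `|a|%:E) ?mule_ge0// lee_wpmul2r ?poweR_ge0//.
by rewrite poweR_EFin lee_fin ge1r_powR// a0.
Qed.

(** On [0, 1] integrate x <= 1 + x^s with x = f / c: the right-hand side has integral at most 2. For
    [p = +oo] any exponent will do. *)
Lemma gauge_integral (c : R) (f : R -> \bar R) : 0 < c -> measurable_fun setT f ->
  (forall t, (0 <= f t)%E) -> (forall t, ~~ (0 <= t <= 1) -> f t = 0%E) ->
  gauge c f -> (\int[mu]_t f t <= (2 * c)%:E)%E.
Proof.
move=> c0 mf f0 fs Gf.
have ci : (0 <= (c^-1)%:E)%E by rewrite lee_fin invr_ge0 ltW.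
have [s [s1 ps]] : exists s : R, 1 <= s /\ (p = +oo%E \/ p = s%:E).
  by move: p1; case: p => [s s1| _|//]; [exists s|exists 1]; split => //; [right|left].
pose F t := ((f t * (c^-1)%:E) `^ s)%E.
have mF : measurable_fun setT F by exact: measurable_gauge.
have mI : measurable_fun setT (fun t : R => (\1_(`[0%R, 1%R]%classic) t)%:E : \bar R).
  by apply/measurable_EFinP; exact: measurable_indic.
have h : (\int[mu]_t (f t * (c^-1)%:E) <= 2%:E)%E.
  apply: (@le_trans _ _ (\int[mu]_t ((\1_(`[0%R, 1%R]%classic) t)%:E + F t))%E).
    apply: ge0_le_integralT.
    - by move=> t; rewrite mule_ge0.
    - by apply: emeasurable_funM => //; exact: measurable_cst.
    - exact: emeasurable_funD.
    move=> t; rewrite indicE mem_setE in_itv/=.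
    have [t01|t01] := boolP (0 <= t <= 1); first by apply: le_1DpoweR => //; rewrite mule_ge0.
    by rewrite fs// mul0e add0e poweR_ge0.
  rewrite ge0_integralD//; last by move=> t _; exact: poweR_ge0.
  rewrite integral_indic01.
  apply: (@le_trans _ _ (1 + 1)%E); first by rewrite leeD2l//; exact: Gf.
  by rewrite -EFinD lee_fin.
have mfc : measurable_fun setT (fun t => (f t * (c^-1)%:E)%E).
  by apply: emeasurable_funM => //; exact: measurable_cst.
have -> : (\int[mu]_t f t = c%:E * \int[mu]_t (f t * (c^-1)%:E))%E.
  rewrite -(@ge0_integralZl _ _ _ mu _ measurableT _ mfc)//; last 2 first.
  - by move=> t _; rewrite mule_ge0.
  - by rewrite lee_fin ltW.
  apply: eq_integral => t _; rewrite muleCA -EFinM mulfV ?mule1//; exact: lt0r_neq0.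
by rewrite mulrC EFinM lee_wpmul2l// lee_fin ltW.
Qed.

Lemma Lnorm_pinfty_le (c : R) (f : R -> R) : (forall t, 0 <= f t) ->
  (Lnorm mu +oo%E (EFin \o f) <= c%:E)%E <-> {ae mu, forall t : R, f t <= c}.
Proof.
(* The norm with infinite exponent is an essential supremum only on a space of positive measure. *)
move=> f0; have mu0 : (0 < mu [set: R])%E.
  apply: (@lt_le_trans _ _ (mu (`[0%R, 1%R]%classic : set R))).
    by rewrite lebesgue_measure01.
  by apply: le_measure => //; rewrite inE.
rewrite Lnorm.unlock mu0; split => [/ess_supP|] h; last apply/ess_supP; apply: ae_mono h => t.
  by rewrite /= ger0_norm// lee_fin.
by rewrite /= ger0_norm// lee_fin.
Qed.

Lemma integral_poweR_gauge (c s : R) (f : R -> R) : 0 < c -> 1 <= s ->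
  measurable_fun setT f -> (forall t, 0 <= f t) ->
  (\int[mu]_t (((f t)%:E * (c^-1)%:E) `^ s) =
   (Lnorm mu s%:E (EFin \o f) * (c^-1)%:E) `^ s)%E.
Proof.
move=> c0 s1 mf f0; have s0 : 0 < s by exact: lt_le_trans s1.
have ci : (0 <= (c^-1)%:E)%E by rewrite lee_fin invr_ge0 ltW.
have mF : measurable_fun setT (fun t => ((f t)%:E `^ s)%E).
  apply: (measurableT_comp (f := fun x : \bar R => (x `^ s)%E)).
    exact: measurable_poweR.
  exact/measurable_EFinP.
rewrite poweRM ?Lnorm_ge0// poweR_Lnorm ?gt_eqF//.
have -> : (\int[mu]_t (`|(EFin \o f) t| `^ s) = \int[mu]_t ((f t)%:E `^ s))%E.
  by apply: eq_integral => t _; rewrite /= ger0_norm.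
rewrite -(@ge0_integralZr _ _ _ mu _ measurableT _ mF) ?poweR_ge0//; last first.
  by move=> t _; exact: poweR_ge0.
by apply: eq_integral => t _; rewrite poweRM ?lee_fin.
Qed.

(** For infinite [p], f / c is at most 1 almost everywhere and lives on an interval of length one,
    which bounds the integral of each of its powers. *)
Lemma Lnorm_gauge (c : R) (f : R -> R) : 0 < c -> measurable_fun setT f ->
  (forall t, 0 <= f t) -> (forall t, ~~ (0 <= t <= 1) -> f t = 0) ->
  (Lnorm mu p (EFin \o f) <= c%:E)%E -> gauge c (EFin \o f).
Proof.
move=> c0 mf f0 fs Nf s s1 ps.
have ci : (0 <= (c^-1)%:E)%E by rewrite lee_fin invr_ge0 ltW.
have s0 : 0 < s by exact: lt_le_trans s1.
have s0' : 0 <= s by exact: ltW.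
case: ps Nf => -> Nf; last first.
  rewrite integral_poweR_gauge// -(poweR1r s) le_poweR ?mule_ge0 ?Lnorm_ge0//.
  by rewrite -(@mulfV _ c) ?gt_eqF// EFinM lee_wpmul2r.
move/Lnorm_pinfty_le : Nf => /(_ f0) fc.
have mI : measurable_fun setT (fun t : R => (\1_(`[0%R, 1%R]%classic) t)%:E : \bar R).
  by apply/measurable_EFinP; exact: measurable_indic.
apply: (@le_trans _ _ (\int[mu]_t (\1_(`[0%R, 1%R]%classic) t)%:E)%E); last first.
  by rewrite integral_indic01.
apply: ae_ge0_le_integral => //.
- by move=> t _; exact: poweR_ge0.
- by apply: measurable_gauge; exact/measurable_EFinP.
apply: ae_mono fc => t ft _; rewrite indicE mem_setE in_itv/=.
have [t01|t01] := boolP (0 <= t <= 1); last first.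
  by rewrite fs// mul0r powR0// gt_eqF.
rewrite lee_fin (_ : true%:R = 1 `^ s); last by rewrite powR1.
rewrite ge0_ler_powR ?nnegrE ?mulr_ge0 ?invr_ge0 ?(ltW c0)//.
by rewrite ler_pdivrMr ?mul1r.
Qed.

(** For infinite [p], Chebyshev's inequality at exponent m gives (1 + e)^m mu(f >= c (1 + e)) <= 1
    for every m, so that set is null. A sequence of e tending to zero then gives f <= c almost
    everywhere. *)
Lemma gauge_Lnorm (c : R) (f : R -> R) : 0 < c -> measurable_fun setT f ->
  (forall t, 0 <= f t) ->
  gauge c (EFin \o f) -> (Lnorm mu p (EFin \o f) <= c%:E)%E.
Proof.
rewrite /gauge; case: p p1 => [s| |//] s1 c0 mf f0 Gf.
  rewrite lee_fin in s1; have s0 : 0 < s by exact: lt_le_trans s1.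
  have := Gf s s1 (or_intror erefl); rewrite integral_poweR_gauge// => h.
  have ci : (0 <= (c^-1)%:E)%E by rewrite lee_fin invr_ge0 ltW.
  have sV0 : 0 <= s^-1 by rewrite invr_ge0 ltW.
  have := le_poweR sV0 (poweR_ge0 _ _) h.
  rewrite -poweRrM mulfV ?gt_eqF// poweRe1 ?mule_ge0 ?Lnorm_ge0// poweR1r => {}h.
  have := lee_wpmul2r (_ : (0 <= c%:E)%E) h; rewrite lee_fin => /(_ (ltW c0)).
  by rewrite -muleA -EFinM mulVf ?gt_eqF// mule1 mul1e.
apply/(Lnorm_pinfty_le _ f0).
have hk (k : nat) : {ae mu, forall t : R, f t <= c * (1 + k.+1%:R^-1)}.
  set e := k.+1%:R^-1; have e0 : 0 < e by rewrite invr_gt0.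
  pose E := [set t : R | c * (1 + e) <= f t].
  have mE : measurable E.
    have -> : E = setT `&` f @^-1` `[c * (1 + e), +oo[%classic.
      by apply/seteqP; split => t /=; rewrite in_itv/= andbT => //; case.
    by apply: mf => //; exact: measurable_itv.
  suff E0 : mu E = 0%E.
    exists E; split => // t /= /negP; rewrite -ltNge; exact: ltW.
  have hm m : ((1 + m.+1%:R * e)%:E * mu E <= 1)%E.
    have m1 : 1 <= m.+1%:R :> R by rewrite ler1n.
    have a0 : 0 < (1 + e) `^ m.+1%:R by rewrite powR_gt0// addr_gt0.
    have mg : measurable_fun setT (fun t => (((f t)%:E * (c^-1)%:E) `^ m.+1%:R)%E).
      by apply: measurable_gauge; exact/measurable_EFinP.
    have := le_integral_abse mu measurableT mg a0.
    under eq_integral => t _ do rewrite (gee0_abs (poweR_ge0 _ _)).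
    move=> /le_trans /(_ (Gf _ m1 (or_introl erefl))); apply: le_trans.
    apply: lee_pmul => //.
    + by rewrite lee_fin addr_ge0// mulr_ge0// ltW.
    + rewrite lee_fin powR_mulrn ?addr_ge0 ?(ltW e0)//.
      elim: m.+1 => [|n IH]; first by rewrite mul0r addr0 expr0.
      rewrite exprSr -natr1; have : 0 <= n%:R * e * e by rewrite !mulr_ge0// ltW.
      have := ler_wpM2r (_ : 0 <= 1 + e) IH; rewrite addr_ge0 ?(ltW e0)// => /(_ erefl).
      lra.
    + apply: le_measure; rewrite ?inE//; last first.
        move=> t Et; split => //=; rewrite ger0_norm ?powR_ge0// lee_fin.
        rewrite ge0_ler_powR ?nnegrE ?ler0n ?addr_ge0 ?(ltW e0)//.
          by rewrite mulr_ge0// invr_ge0 ltW.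
        by rewrite ler_pdivlMr// mulrC.
      have mag : measurable_fun setT (fun t => `|((f t)%:E * (c^-1)%:E) `^ m.+1%:R|%E).
        exact: (measurableT_comp (f := abse) _ mg).
      have -> : forall a : \bar R, [set t | (a <= `|((f t)%:E * (c^-1)%:E) `^ m.+1%:R|)%E] =
          (fun t => `|((f t)%:E * (c^-1)%:E) `^ m.+1%:R|%E) @^-1` `[a, +oo[%classic.
        by move=> a; apply/seteqP; split => t /=; rewrite in_itv/= andbT.
      by apply: mag => //; exact: emeasurable_itv.
  apply/eqP; rewrite eq_le measure_ge0 andbT leNgt; apply/negP => mu0.
  have mu1 : (mu E < +oo)%E.
    apply: (@le_lt_trans _ _ 1%E); last exact: ltry.
    apply: le_trans (hm 0%N); rewrite -[leLHS]mul1e lee_wpmul2r//.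
    by rewrite lee_fin lerDl mulr_ge0 ?ler0n ?(ltW e0).
  have fE : (mu E \is a fin_num)%E by rewrite (ge0_fin_numE (measure_ge0 _ _)) mu1.
  move: mu0 hm; rewrite -(fineK fE); move: (fine _) => x; rewrite lte_fin => x0 hm.
  have ex0 : 0 < e * x by rewrite mulr_gt0.
  have := archi_boundP (_ : 0 <= (e * x)^-1); rewrite invr_ge0 (ltW ex0) => /(_ erefl).
  set m := Num.bound _ => hbm; have := hm m; rewrite -EFinM lee_fin.
  have := ltr_pM2r ex0 (e * x)^-1 m%:R; rewrite hbm mulVf ?gt_eqF// => hlt.
  rewrite -natr1 => hle; have : 1 < m%:R * (e * x) by rewrite hlt.
  nra.
have := ae_foralln hk.
apply: ae_mono => t h; apply/ler_addgt0Pr => d d0.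
have [k hk'] : exists k : nat, c / d < k.+1%:R.
  exists (Num.bound (c / d)).
  apply: lt_trans (archi_boundP _) _; first by rewrite divr_ge0 ?(ltW c0) ?(ltW d0).
  by rewrite ltr_nat.
apply: le_trans (h k) _; rewrite mulrDr mulr1 lerD2l ler_pdivrMr ?ltr0n//.
by rewrite mulrC -ler_pdivrMr// ltW.
Qed.
End Gauge.

(** * Modulus of matrix-valued functions *)

Section MatrixModulus.
Variable R : realType.
Local Notation C := R[i].
Local Notation I01 := (`[0%R, 1%R]%classic : set R).

Lemma mxmod_ge0 (M : 'M[C]_2) : 0 <= mxmod M.
Proof. exact: bigmax_ge_id. Qed.

Lemma le_mxmod (M : 'M[C]_2) i j : Normc.normc (M i j) <= mxmod M.
Proof.
rewrite /mxmod (le_trans _ (le_bigmax _ _ i))//.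
exact: (le_bigmax _ (fun j => Normc.normc (M i j)) j).
Qed.

Lemma mxmodB (M M' : 'M[C]_2) : mxmod (M - M') <= mxmod M + mxmod M'.
Proof.
have h0 : 0 <= mxmod M + mxmod M' by rewrite addr_ge0 ?mxmod_ge0.
apply: bigmax_le => // i _; apply: bigmax_le => // j _.
rewrite !mxE; apply: le_trans (lerD (le_mxmod M i j) (le_mxmod M' i j)).
have := le_normcD (M i j) (- M' i j).
by rewrite normcN.
Qed.

Definition mxm (Q : R -> 'M[C]_2) (t : R) : R := if 0 <= t <= 1 then mxmod (Q t) else 0.

Lemma mxmE (Q : R -> 'M[C]_2) : (fun t => mxmod (Q t)) \_ I01 = mxm Q.
Proof. by apply/funext => t; rewrite patchE mem_setE in_itv /mxm /=. Qed.

Lemma mxm_ge0 (Q : R -> 'M[C]_2) t : 0 <= mxm Q t.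
Proof. by rewrite /mxm; case: ifP => // _; exact: mxmod_ge0. Qed.

Lemma mxm_supp (Q : R -> 'M[C]_2) (t : R) : ~~ (0 <= t <= 1) -> mxm Q t = 0.
Proof. by rewrite /mxm => /negbTE ->. Qed.

Lemma measurable_mxm (Q : R -> 'M[C]_2) :
  (forall i j, measurable_fun I01 (fun t => complex.Re (Q t i j))) ->
  (forall i j, measurable_fun I01 (fun t => complex.Im (Q t i j))) ->
  measurable_fun setT (mxm Q).
Proof.
move=> mRe mIm; rewrite -mxmE; apply/(measurable_restrictT _ _).1; first exact: measurable_itv.
have mN i j : measurable_fun I01 (fun t => Normc.normc (Q t i j)) by exact: measurable_normc.
have -> : (fun t => mxmod (Q t)) = fun t =>
    Num.max (Num.max (Normc.normc (Q t 0 0)) (Normc.normc (Q t 0 1)))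
            (Num.max (Normc.normc (Q t 1 0)) (Normc.normc (Q t 1 1))).
  have o1 : 1 = lift 0 0 :> 'I_2 by exact/val_inj.
  apply/funext => t; rewrite /mxmod !big_ord_recl !big_ord0 o1.
  by rewrite ![Num.max _ 0]max_l ?le_max ?normc_ge0.
by apply: measurable_maxr; apply: measurable_maxr.
Qed.
End MatrixModulus.

(** * Identification of the chosen densities *)

Section CharDensity.
Variable R : realType.
Local Notation C := R[i].
Local Notation mu := (@lebesgue_measure R).
Local Notation N := (@cabs1 R).
Local Notation I01 := (`[0%R, 1%R]%classic : set R).

Lemma eq_inLp (p : \bar R) (f g : R -> C) : (forall t : R, 0 <= t <= 1 -> f t = g t) ->
  inLp p f -> inLp p g.
Proof.
move=> fg [m1 m2 h]; have fgI (t : R) : t \in I01 -> f t = g t.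
  by rewrite inE/= in_itv/=; exact: fg.
split.
- by apply: eq_measurable_fun m1 => t /fgI ->.
- by apply: eq_measurable_fun m2 => t /fgI ->.
rewrite /Lpnorm (_ : (fun t => Normc.normc (g t)) \_ I01 = (fun t => Normc.normc (f t)) \_ I01)//.
by apply/funext => t; rewrite !patchE; case: ifPn => // /fgI ->.
Qed.

Lemma inLp1_trunc01 (f : R -> C) : cintegrable (trunc01 f) -> inLp 1%E f.
Proof. by move/inLp1_cintegrable; apply: eq_inLp => t t01; rewrite /trunc01 t01. Qed.

Lemma inLp1B (f g : R -> C) : inLp 1%E f -> inLp 1%E g -> inLp 1%E (fun t => f t - g t).
Proof.
move=> /cintegrable_trunc01 fi /cintegrable_trunc01 gi; apply: inLp1_trunc01.
have -> : trunc01 (fun t => f t - g t) = (fun t => trunc01 f t + (-1) * trunc01 g t).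
  by apply/funext => t; rewrite /trunc01; case: ifP => _; ring.
by apply: cintegrableD => //; exact: cintegrableZ.
Qed.

Lemma cabs1_scale (a : R) (z : C) : 0 <= a -> N (a%:C * z) = a * N z.
Proof.
by move=> a0; rewrite /N ReM ImM /= !mul0r subr0 addr0 !normrM (ger0_norm a0) mulrDr.
Qed.

Lemma cintegrable_fourier01 b (f : R -> C) lambda : inLp 1%E f ->
  cintegrable (fun t => trunc01 f t * cexp ('i * b%:C * lambda * t%:C)).
Proof.
move=> /cintegrable_trunc01 fi; set z := 'i * _ * _.
pose M := 2 * expR `|complex.Re z|.
apply: (@cintegrable_le_norm _ _ (fun t => M%:C * trunc01 f t)).
- by apply: cmeasM; [exact: fi.1|apply: cmeas_cexp; exact: cmeas_lin].
- move=> t; rewrite cabs1_scale ?mulr_ge0 ?expR_ge0//.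
  rewrite (le_trans (cabs1M _ _))// mulrC /trunc01; case: ifP => [/andP[t0 t1]|_]; last by rewrite cabs1_0 !mulr0.
  rewrite ler_wpM2r ?cabs1_ge0// (le_trans (cabs1_cexp_le _))// ler_wpM2l// ler_expR.
  rewrite ReM /= mulr0 subr0 (le_trans (ler_norm _))// normrM (ger0_norm t0).
  by rewrite ler_piMr.
- exact: cintegrableZ.
Qed.

Lemma fourier01B b (f g : R -> C) lambda : inLp 1%E f -> inLp 1%E g ->
  fourier01 b (fun t => f t - g t) lambda = fourier01 b f lambda - fourier01 b g lambda.
Proof.
move=> fi gi; have f1 := cintegrable_fourier01 b lambda fi.
have g1 := cintegrable_fourier01 b lambda gi.
rewrite !fourier01_trunc -cintB//; apply: eq_cint => t.
by rewrite /trunc01; case: ifP => _; ring.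
Qed.

Variables (b1 b2 : R).
Hypotheses (b10 : b1 < 0) (b20 : 0 < b2).
Variable A : 'M[C]_(2, 4).

Lemma charDensity_unique (Q : R -> 'M[C]_2) g g' :
  is_charDensity b1 b2 A Q g -> is_charDensity b1 b2 A Q g' ->
  {ae mu, forall t : R, 0 <= t <= 1 -> g.1 t = g'.1 t} /\
  {ae mu, forall t : R, 0 <= t <= 1 -> g.2 t = g'.2 t}.
Proof.
move=> [g1 g2 gE] [g1' g2' gE'].
have [] := fourier01_unique b10 b20 (inLp1B g1 g1') (inLp1B g2 g2').
  move=> lambda; rewrite !fourier01B//; have h := gE lambda.
  rewrite gE' -!addrA in h; move/addrI in h.
  by rewrite addrACA -opprD -h subrr.
by move=> h1 h2; split; [move: h1|move: h2]; apply: ae_mono => t + t01; rewrite /trunc01 t01 => /subr0_eq.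
Qed.

Section Existence.
Variable w : R -> R.
Hypothesis mw : measurable_fun setT w.
Hypothesis w0 : forall t, 0 <= w t.
Hypothesis wsupp : forall t, ~~ (0 <= t <= 1) -> w t = 0.
Hypothesis wi : mu.-integrable setT (EFin \o w).
Hypothesis kmaj_lim_fin : (\int[mu]_tau kmaj_lim w tau < +oo)%E.
Variables (Q : R -> 'M[C]_2) (q : bool -> R -> C).
Hypothesis Q0 : forall x, 0 <= x <= 1 -> forall i, Q x i i = 0.
Hypothesis qE : forall x, 0 <= x <= 1 ->
  forall i, q i x = - 'i * (bb b1 b2 i)%:C * Q x (ix i) (ix (~~ i)).
Hypothesis mq : forall i, cmeas (q i).
Hypothesis qw : forall i t, N (q i t) <= w t.

Lemma is_charDensity_dens_kern : is_charDensity b1 b2 A Q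
  (lpart b1 b2 (dens_kern w A q), rpart b1 b2 (dens_kern w A q)).
Proof.
have Hi := cintegrable_dens_kern b1 b2 mw w0 wsupp wi kmaj_lim_fin A mq qw.
split => /=.
- by apply: inLp1_cintegrable; exact: cintegrable_lpart.
- by apply: inLp1_cintegrable; exact: cintegrable_rpart.
move=> lambda.
have [hi hE] := charDet_dens_kern b10 b20 mw w0 wsupp wi kmaj_lim_fin A Q0 qE mq qw lambda.
rewrite -addrA -(fourier01_split b10 b20 _ hi) -?hE; first by rewrite addrC subrK.
by move=> tau; apply: dens_kern_supp.
Qed.

Lemma charDensityP : is_charDensity b1 b2 A Q (charDensity b1 b2 A Q).
Proof. by apply: xgetPex; exists (lpart b1 b2 (dens_kern w A q), rpart b1 b2 (dens_kern w A q)); exact: is_charDensity_dens_kern. Qed.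
End Existence.
End CharDensity.

(** * Stability *)

Section Estimate.
Variable R : realType.
Local Notation C := R[i].
Local Notation mu := (@lebesgue_measure R).
Local Notation N := (@cabs1 R).
Local Notation I01 := (`[0%R, 1%R]%classic : set R).
Variable p : \bar R.
Hypothesis p1 : (1 <= p)%E.

Lemma Lpnorm_le_gauge (c : R) (g : R -> C) (G : R -> \bar R) : 0 < c ->
  measurable_fun I01 (fun t => complex.Re (g t)) ->
  measurable_fun I01 (fun t => complex.Im (g t)) ->
  measurable_fun setT G -> (forall t, (0 <= G t)%E) -> gauge p c G ->
  {ae mu, forall t : R, 0 <= t <= 1 -> ((N (g t))%:E <= G t)%E} -> (Lpnorm p g <= c%:E)%E.
Proof.
move=> c0 m1 m2 mG G0 GG gG.
have mh : measurable_fun setT ((fun t => Normc.normc (g t)) \_ I01) by exact: measurable_normc_restrict.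
have h0 (t : R) : 0 <= ((fun t => Normc.normc (g t)) \_ I01) t.
  by rewrite patchE; case: ifP => // _; exact: normc_ge0.
apply: gauge_Lnorm => //; apply: gauge_le mG _ _ GG => //.
- by apply/measurable_EFinP.
- apply: ae_mono gG => t h; rewrite /= patchE mem_setE in_itv/=.
  case: ifPn => // t01; apply: le_trans (h t01); rewrite lee_fin; exact: normc_le_cabs1.
Qed.

Section Weight.
Variable w : R -> R.
Hypothesis mw : measurable_fun setT w.
Hypothesis w0 : forall t, 0 <= w t.
Hypothesis wsupp : forall t, ~~ (0 <= t <= 1) -> w t = 0.
Variable c : R.
Hypothesis c0 : 0 < c.
Hypothesis Gw : gauge p c (EFin \o w).

Lemma gauge_weight_integral : (\int[mu]_t (w t)%:E <= (2 * c)%:E)%E.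
Proof.
apply: (gauge_integral p1 c0) Gw => //; first exact/measurable_EFinP.
by move=> t /wsupp /= ->.
Qed.

Lemma gauge_weight_integrable : mu.-integrable setT (EFin \o w).
Proof.
apply/integrableP; split; first exact/measurable_EFinP.
apply: (@le_lt_trans _ _ (2 * c)%:E); last exact: ltry.
apply: le_trans gauge_weight_integral; rewrite le_eqVlt; apply/orP; left; apply/eqP.
by apply: eq_integral => t _; rewrite /= ger0_norm.
Qed.
Let wi := gauge_weight_integrable.

(** [kbound] at 1 is c exp (int w), and int w <= 2 c by [gauge_integral]. *)
Definition kgauge : R := c * expR (2 * c).

Lemma kgauge_gt0 : 0 < kgauge. Proof. by rewrite mulr_gt0 ?expR_gt0. Qed.

Lemma kmaj_lim_gauge : gauge p kgauge (kmaj_lim w).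
Proof.
have b0 : 0 < kbound w c 1 by exact: kbound_gt0.
have bK : kbound w c 1 <= kgauge.
  rewrite /kbound ler_wpM2l ?(ltW c0)// ler_expR (le_trans (primitive_le _ wi w0))//.
  rewrite -lee_fin /Rintegral fineK; last exact: integrable_fin_num.
  exact: gauge_weight_integral.
apply: (gauge_mono b0 bK); [exact: measurable_kmaj_lim|by move=> t; exact: kmaj_lim_ge0|].
move=> s s1 ps; apply: (kmaj_lim_bound mw w0 wsupp wi c0 s1).
have := Gw s1 ps; congr (_ <= _)%E.
Qed.

Lemma gauge_kmaj_lim_fin : (\int[mu]_tau kmaj_lim w tau < +oo)%E.
Proof.
apply: (@le_lt_trans _ _ (2 * kgauge)%:E); last exact: ltry.
apply: (gauge_integral p1 kgauge_gt0) kmaj_lim_gauge.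
- exact: measurable_kmaj_lim.
- by move=> t; exact: kmaj_lim_ge0.
- by move=> t; exact: kmaj_lim_supp.
Qed.

(** Each density is controlled by the majorant at tau and at 1 - tau, both affine in [t], with a
    Jacobian in front; this is the common shape of the two bounds. *)
Definition kmaj_pair (a b a' b' : R) (t : R) : \bar R :=
  (`|a|%:E * kmaj_lim w (a * t + b)%R + `|a'|%:E * kmaj_lim w (a' * t + b')%R)%E.

Lemma kmaj_pair_gauge a b a' b' : 0 < `|a| <= 1 -> 0 < `|a'| <= 1 ->
  [/\ measurable_fun setT (kmaj_pair a b a' b'), forall t, (0 <= kmaj_pair a b a' b' t)%E &
      gauge p (2 * kgauge) (kmaj_pair a b a' b')].
Proof.
move=> a1 a1'; have mk : measurable_fun setT (kmaj_lim w) by exact: measurable_kmaj_lim.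
have k0 t : (0 <= kmaj_lim w t)%E by exact: kmaj_lim_ge0.
have m (x y : R) : measurable_fun setT (fun t => (`|x|%:E * kmaj_lim w (x * t + y)%R)%E).
  by apply: measurable_funeM; apply: (measurableT_comp mk); exact: measurable_affine.
have g0 (x y t : R) : (0 <= `|x|%:E * kmaj_lim w (x * t + y)%R)%E by rewrite mule_ge0.
split; first exact: emeasurable_funD.
- by move=> t; rewrite adde_ge0.
- apply: gauge_add => //; first exact: kgauge_gt0.
  + by apply: gauge_affine => //; [exact: kgauge_gt0|exact: kmaj_lim_gauge].
  + by apply: gauge_affine => //; [exact: kgauge_gt0|exact: kmaj_lim_gauge].
Qed.

Variables (q q' : bool -> R -> C) (d : R) (A : 'M[C]_(2, 4)).
Hypotheses (mq : forall i, cmeas (q i)) (mq' : forall i, cmeas (q' i)).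
Hypotheses (qw : forall i t, N (q i t) <= w t / 2) (q'w : forall i t, N (q' i t) <= w t / 2).
Hypothesis qq' : forall i t, N (q i t - q' i t) <= d * (w t / 2).
Hypothesis d0 : 0 < d.

Lemma dens_kern_lipschitz tau :
  ((N (dens_kern w A q tau - dens_kern w A q' tau))%:E <=
   (d * (dcoef_norm A + 1))%:E * (kmaj_lim w tau + kmaj_lim w (1 - tau)%R))%E.
Proof.
have L k i t := kern_lim_lipschitz mw w0 mq mq' qw q'w qq' (@cabs1_delta R k) d0 i t.
have k0 t : (0 <= kmaj_lim w t)%E by exact: kmaj_lim_ge0.
(* Adding 1 to [dcoef_norm A] makes the factor positive, so an infinite majorant gives an infinite
   right-hand side. *)
have [|] := ltP (kmaj_lim w tau + kmaj_lim w (1 - tau)%R)%E +oo%E; last first.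
  rewrite leye_eq => /eqP ->; rewrite gt0_muley ?leey// lte_fin mulr_gt0// ltr_wpDl//.
  by rewrite sumr_ge0// => k _; rewrite addr_ge0 ?cabs1_ge0.
move=> XYoo; have Xfin : kmaj_lim w tau \is a fin_num.
  by rewrite ge0_fin_numE// (le_lt_trans _ XYoo)// leeDl.
have Yfin : kmaj_lim w (1 - tau) \is a fin_num.
  by rewrite ge0_fin_numE// (le_lt_trans _ XYoo)// leeDr.
have LX k i := L k i tau; have LY k i := L k i (1 - tau).
move: (k0 tau) (k0 (1 - tau)) LX LY; rewrite -(fineK Xfin) -(fineK Yfin).
move: (fine _) (fine _) => y x x0 y0 LX LY; rewrite lee_fin in x0; rewrite lee_fin in y0.
rewrite -EFinD -EFinM lee_fin /dens_kern -sumrB (le_trans (cabs1_sum _ _ _))//.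
apply: (@le_trans _ _ (\sum_(k : bool) (d * (N (dcoef A true k) + N (dcoef A false k)) * (x + y)))).
  apply: ler_sum => k _.
  have := LX k true; rewrite -EFinM lee_fin => hX.
  have := LY k false; rewrite -EFinM lee_fin => hY.
  move: hX hY.
  move: (kern_lim w q _ true _) (kern_lim w q' _ true _).
  move: (kern_lim w q _ false _) (kern_lim w q' _ false _).
  move: (dcoef A true k) (dcoef A false k) => a a' v v' u u' hX hY.
  have -> : a * u + a' * v - (a * u' + a' * v') = a * (u - u') + a' * (v - v') by ring.
  rewrite (le_trans (cabs1D _ _))//.
  have h1 : N (a * (u - u')) <= N a * (d * (x + y)).
    rewrite (le_trans (cabs1M _ _))// ler_wpM2l ?cabs1_ge0// (le_trans hX)//.
    by rewrite ler_wpM2l ?(ltW d0)// lerDl.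
  have h2 : N (a' * (v - v')) <= N a' * (d * (x + y)).
    rewrite (le_trans (cabs1M _ _))// ler_wpM2l ?cabs1_ge0// (le_trans hY)//.
    by rewrite ler_wpM2l ?(ltW d0)// lerDr.
  by apply: le_trans (lerD h1 h2) _; rewrite -mulrDl mulrCA mulrA.
rewrite -mulr_suml -mulr_sumr ler_wpM2r ?addr_ge0// ler_wpM2l ?(ltW d0)//.
by rewrite /dcoef_norm lerDl.
Qed.

Definition lip_const : R := (d * (dcoef_norm A + 1)) * (2 * kgauge).

Variables (b1 b2 : R).
Hypotheses (b10 : b1 < 0) (b20 : 0 < b2).
Local Notation al := (alpha b1 b2).

Let H tau := dens_kern w A q tau.
Let H' tau := dens_kern w A q' tau.

Let Gam0 : 0 < d * (dcoef_norm A + 1).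
Proof.
by rewrite mulr_gt0// ltr_wpDl// sumr_ge0// => k _; rewrite addr_ge0 ?cabs1_ge0.
Qed.

(** [P] tells on which side of [alpha] the argument lies, which serves both parts at once. *)
Lemma scaled_dens_kern_lipschitz (a t : R) (P : bool) : 0 <= a ->
  ((N (a%:C * (if P then H t else 0) - a%:C * (if P then H' t else 0)))%:E <=
   (d * (dcoef_norm A + 1))%:E * (a%:E * kmaj_lim w t + a%:E * kmaj_lim w (1 - t)%R))%E.
Proof.
move=> a0; have k0 x : (0 <= kmaj_lim w x)%E by exact: kmaj_lim_ge0.
have aE : (0 <= a%:E)%E by rewrite lee_fin.
have GE : (0 <= (d * (dcoef_norm A + 1))%:E)%E by rewrite lee_fin ltW.
case: P; last by rewrite subrr cabs1_0 !mule_ge0// adde_ge0// mule_ge0.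
rewrite -mulrBr cabs1_scale// EFinM -ge0_muleDr// muleCA lee_wpmul2l//.
exact: dens_kern_lipschitz.
Qed.

Lemma lpart_lipschitz t : ((N (lpart b1 b2 H t - lpart b1 b2 H' t))%:E <=
   (d * (dcoef_norm A + 1))%:E * kmaj_pair (- al) al al (1 - al) t)%E.
Proof.
have /andP[a0 a1] := alpha_itv b10 b20.
have -> : kmaj_pair (- al) al al (1 - al) t =
    (al%:E * kmaj_lim w (- al * t + al)%R + al%:E * kmaj_lim w (1 - (- al * t + al))%R)%E.
  rewrite /kmaj_pair normrN (ger0_norm (ltW a0)).
  by rewrite (_ : 1 - (- al * t + al) = al * t + (1 - al)); last by ring.
exact: (scaled_dens_kern_lipschitz (- al * t + al) (- al * t + al <= al) (ltW a0)).
Qed.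

Lemma rpart_lipschitz t : ((N (rpart b1 b2 H t - rpart b1 b2 H' t))%:E <=
   (d * (dcoef_norm A + 1))%:E * kmaj_pair (1 - al) al (al - 1) (1 - al) t)%E.
Proof.
have /andP[a0 a1] := alpha_itv b10 b20.
have a1' : 0 <= 1 - al by rewrite subr_ge0 ltW.
have -> : kmaj_pair (1 - al) al (al - 1) (1 - al) t =
    ((1 - al)%:E * kmaj_lim w ((1 - al) * t + al)%R +
     (1 - al)%:E * kmaj_lim w (1 - ((1 - al) * t + al))%R)%E.
  rewrite /kmaj_pair (distrC al) (ger0_norm a1').
  by rewrite (_ : 1 - ((1 - al) * t + al) = (al - 1) * t + (1 - al)); last by ring.
have := scaled_dens_kern_lipschitz ((1 - al) * t + al) (~~ ((1 - al) * t + al <= al)) a1'.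
by rewrite /rpart; case: (_ <= al).
Qed.

(** By uniqueness the chosen densities agree almost everywhere with the explicit ones built from
    [dens_kern], for which the pointwise bounds are available. *)
Lemma Lpnorm_density_diff (Q Q' : R -> 'M[C]_2) :
  (forall x, 0 <= x <= 1 -> forall i, Q x i i = 0) ->
  (forall x, 0 <= x <= 1 -> forall i, Q' x i i = 0) ->
  (forall x, 0 <= x <= 1 -> forall i, q i x = - 'i * (bb b1 b2 i)%:C * Q x (ix i) (ix (~~ i))) ->
  (forall x, 0 <= x <= 1 -> forall i, q' i x = - 'i * (bb b1 b2 i)%:C * Q' x (ix i) (ix (~~ i))) ->
  let g1 := fun t => (charDensity b1 b2 A Q).1 t - (charDensity b1 b2 A Q').1 t in
  let g2 := fun t => (charDensity b1 b2 A Q).2 t - (charDensity b1 b2 A Q').2 t in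
  [/\ is_charDensity b1 b2 A Q (charDensity b1 b2 A Q),
      is_charDensity b1 b2 A Q' (charDensity b1 b2 A Q'),
      (Lpnorm p g1 <= lip_const%:E)%E & (Lpnorm p g2 <= lip_const%:E)%E].
Proof.
move=> Q0 Q'0 qE q'E g1 g2.
have w2 (u : bool -> R -> C) : (forall i t, N (u i t) <= w t / 2) -> forall i t, N (u i t) <= w t.
  by move=> uw i t; rewrite (le_trans (uw i t))// ler_pdivrMr// mulr_natr mulr2n lerDl.
have kfin := gauge_kmaj_lim_fin.
have PQ := charDensityP b10 b20 A mw w0 wsupp wi kfin Q0 qE mq (w2 _ qw).
have PQ' := charDensityP b10 b20 A mw w0 wsupp wi kfin Q'0 q'E mq' (w2 _ q'w).
have DQ := is_charDensity_dens_kern b10 b20 A mw w0 wsupp wi kfin Q0 qE mq (w2 _ qw).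
have DQ' := is_charDensity_dens_kern b10 b20 A mw w0 wsupp wi kfin Q'0 q'E mq' (w2 _ q'w).
have [U1 U2] := charDensity_unique b10 b20 PQ DQ.
have [U1' U2'] := charDensity_unique b10 b20 PQ' DQ'.
have [[P1 P2 _] [P1' P2' _]] := (PQ, PQ').
have [g1m1 g1m2 _] := inLp1B P1 P1'; have [g2m1 g2m2 _] := inLp1B P2 P2'.
have /andP[a0 a1] := alpha_itv b10 b20.
have n1 : 0 < `|al| <= 1 by rewrite (ger0_norm (ltW a0)) a0 ltW.
have n2 : 0 < `|1 - al| <= 1.
  by rewrite ger0_norm ?subr_gt0 ?a1 ?subr_ge0 ?(ltW a1)// gerBl ltW.
have n3 : 0 < `|- al| <= 1 by rewrite normrN.
have n4 : 0 < `|al - 1| <= 1 by rewrite distrC.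
have [mL L0 GL] := kmaj_pair_gauge al (1 - al) n3 n1.
have [mM M0 GM] := kmaj_pair_gauge al (1 - al) n2 n4.
have K0 : 0 < 2 * kgauge by rewrite mulr_gt0// kgauge_gt0.
have C0 : 0 < lip_const by rewrite mulr_gt0.
have GE : (0 <= (d * (dcoef_norm A + 1))%:E)%E by rewrite lee_fin ltW.
have subst2 (x x' y y' : C) (z : \bar R) : x = y -> x' = y' ->
    ((N (y - y'))%:E <= z)%E -> ((N (x - x'))%:E <= z)%E by move=> -> ->.
have ae1 : {ae mu, forall t : R, 0 <= t <= 1 ->
    ((N (g1 t))%:E <= (d * (dcoef_norm A + 1))%:E * kmaj_pair (- al) al al (1 - al) t)%E}.
  move: U1 U1'; apply: ae_mono2 => t u u' t01.
  exact: (subst2 _ _ _ _ _ (u t01) (u' t01) (lpart_lipschitz t)).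
have ae2 : {ae mu, forall t : R, 0 <= t <= 1 ->
    ((N (g2 t))%:E <= (d * (dcoef_norm A + 1))%:E * kmaj_pair (1 - al) al (al - 1) (1 - al) t)%E}.
  move: U2 U2'; apply: ae_mono2 => t u u' t01.
  exact: (subst2 _ _ _ _ _ (u t01) (u' t01) (rpart_lipschitz t)).
split => //.
- apply: (Lpnorm_le_gauge C0 g1m1 g1m2 _ _ (gauge_scale Gam0 K0 GL) ae1).
  + exact: measurable_funeM.
  + by move=> t; rewrite mule_ge0.
- apply: (Lpnorm_le_gauge C0 g2m1 g2m2 _ _ (gauge_scale Gam0 K0 GM) ae2).
  + exact: measurable_funeM.
  + by move=> t; rewrite mule_ge0.
Qed.
End Weight.
End Estimate.

(** * Potentials in a ball and the final constant *)

Section Final.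
Variable R : realType.
Local Notation C := R[i].
Local Notation mu := (@lebesgue_measure R).
Local Notation N := (@cabs1 R).
Local Notation I01 := (`[0%R, 1%R]%classic : set R).
Variables (b1 b2 : R).
Hypotheses (b10 : b1 < 0) (b20 : 0 < b2).
Variable p : \bar R.
Hypothesis p1 : (1 <= p)%E.
Variable r : R.
Hypothesis r0 : 0 < r.

Definition qcoef (Q : R -> 'M[C]_2) (i : bool) (t : R) : C :=
  (- 'i * (bb b1 b2 i)%:C) * trunc01 (fun x => Q x (ix i) (ix (~~ i))) t.

Lemma qcoefE (Q : R -> 'M[C]_2) (x : R) : 0 <= x <= 1 ->
  forall i, qcoef Q i x = - 'i * (bb b1 b2 i)%:C * Q x (ix i) (ix (~~ i)).
Proof. by move=> x01 i; rewrite /qcoef /trunc01 x01. Qed.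

Local Notation bet := (`|b1| + `|b2|).
Let bet0 : 0 < bet. Proof. by rewrite ltr_wpDr ?normr_ge0// normr_gt0 lt_eqF. Qed.

(** The factor 2 is the price of the l^1 modulus; |b1| + |b2| stands for the larger of the two. *)
Lemma cabs1_qcoef_le (Q : R -> 'M[C]_2) i t : N (qcoef Q i t) <= 2 * bet * mxm Q t.
Proof.
rewrite /qcoef /mxm /trunc01; case: ifP => _; last by rewrite mulr0 cabs1_0 mulr0.
rewrite (le_trans (cabs1_le_normc _))// -[leRHS]mulrA ler_wpM2l// !Normc.normcM normcN.
have -> : Normc.normc ('i : C) = 1 by rewrite normc_ReIm /= expr0n/= expr1n add0r sqrtr1.
rewrite mul1r ler_pM ?normc_ge0 ?le_mxmod//.
rewrite normc_ReIm /= expr0n/= addr0 sqrtr_sqr /bb.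
by case: i; rewrite ?lerDl ?lerDr.
Qed.

Lemma cmeas_qcoef (Q : R -> 'M[C]_2) i : (forall i j, inLp 1%E (fun x => Q x i j)) -> cmeas (qcoef Q i).
Proof.
by move=> Qi; apply: cmeasM; [exact: cmeas_cst|exact: (cintegrable_trunc01 (Qi _ _)).1].
Qed.

Lemma qcoefB (Q Qt : R -> 'M[C]_2) i t : qcoef Q i t - qcoef Qt i t = qcoef (fun x => Q x - Qt x) i t.
Proof. by rewrite /qcoef /trunc01 -mulrBr; congr (_ * _); case: ifP => _; rewrite ?mxE ?subrr. Qed.

Lemma potential_measurable_mxm (Q : R -> 'M[C]_2) : potential Q -> measurable_fun setT (mxm Q).
Proof. by move=> [_ Qi]; apply: measurable_mxm => i j; have [] := Qi i j. Qed.

Lemma potentialB (Q Qt : R -> 'M[C]_2) : potential Q -> potential Qt -> potential (fun x => Q x - Qt x).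
Proof.
move=> [Q0 Qi] [Qt0 Qti]; split; first by move=> x x01 i; rewrite !mxE Q0// Qt0// subrr.
by move=> i j; apply: eq_inLp (inLp1B (Qi i j) (Qti i j)) => t _; rewrite !mxE.
Qed.

Lemma mxLpnorm_gauge (c : R) (Q : R -> 'M[C]_2) : 0 < c -> potential Q -> (mxLpnorm p Q <= c%:E)%E ->
  gauge p c (EFin \o mxm Q).
Proof.
move=> c0 PQ; rewrite /mxLpnorm mxmE => h; apply: Lnorm_gauge => //.
- exact: potential_measurable_mxm.
- by move=> t; exact: mxm_ge0.
- by move=> t; exact: mxm_supp.
Qed.

(** Makes the distance of the potentials finite, so that it can be approached from above by real
    numbers. *)
Lemma mxLpnormB_le (Q Qt : R -> 'M[C]_2) : Uball p r Q -> Uball p r Qt ->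
  (mxLpnorm p (fun x => (Q x - Qt x)%R) <= (2 * r)%:E)%E.
Proof.
move=> [PQ hQ] [PQt hQt]; have PD := potentialB PQ PQt.
have mQ := potential_measurable_mxm PQ; have mQt := potential_measurable_mxm PQt.
have mD := potential_measurable_mxm PD.
have r20 : 0 < 2 * r by rewrite mulr_gt0.
rewrite /mxLpnorm mxmE; apply: gauge_Lnorm => //; first by move=> t; exact: mxm_ge0.
have GQ := mxLpnorm_gauge r0 PQ hQ; have GQt := mxLpnorm_gauge r0 PQt hQt.
have e0 (Q' : R -> 'M[C]_2) t : (0 <= (EFin \o mxm Q') t)%E by rewrite lee_fin mxm_ge0.
have m (Q' : R -> 'M[C]_2) : measurable_fun setT (mxm Q') -> measurable_fun setT (EFin \o mxm Q').
  by move=> ?; exact/measurable_EFinP.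
have G := gauge_add r0 (m _ mQ) (m _ mQt) (e0 Q) (e0 Qt) GQ GQt.
apply: gauge_le r20 (m _ mD) _ (e0 _) _ G; first by apply: emeasurable_funD; exact: m.
apply: nearW => t; rewrite -EFinD lee_fin /mxm; case: ifP => _; last by rewrite addr0.
exact: mxmodB.
Qed.

(* Dividing the difference by a bound [D] of its norm keeps the norm of the weight bounded
   while every difference of kernels is at most [D] times the majorant. *)
Definition weight (Q Qt : R -> 'M[C]_2) (D t : R) : R :=
  4 * bet * (mxm Q t + mxm Qt t + D^-1 * mxm (fun x => Q x - Qt x) t).

(** Each of the two additions in [weight] doubles the gauge. Starting from r + 1 instead of [r]
    ensures 2 (r + 1) >= 1, the gauge of the normalized difference. *)
Definition weight_bound : R := 4 * bet * (2 * (2 * (r + 1))).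

Lemma weight_gauge (Q Qt : R -> 'M[C]_2) D : Uball p r Q -> Uball p r Qt -> 0 < D ->
  (mxLpnorm p (fun x => (Q x - Qt x)%R) <= D%:E)%E ->
  gauge p weight_bound (EFin \o weight Q Qt D).
Proof.
move=> [PQ hQ] [PQt hQt] D0 hD; have PD := potentialB PQ PQt.
have mQ := potential_measurable_mxm PQ; have mQt := potential_measurable_mxm PQt.
have mD := potential_measurable_mxm PD.
have e0 (Q' : R -> 'M[C]_2) t : (0 <= (EFin \o mxm Q') t)%E by rewrite lee_fin mxm_ge0.
have m (Q' : R -> 'M[C]_2) : measurable_fun setT (mxm Q') -> measurable_fun setT (EFin \o mxm Q').
  by move=> ?; exact/measurable_EFinP.
have r1 : 0 < r + 1 by rewrite addr_gt0.
have rr1 : r <= r + 1 by rewrite lerDl.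
have GQ := gauge_mono r0 rr1 (m _ mQ) (e0 _) (mxLpnorm_gauge r0 PQ hQ).
have GQt := gauge_mono r0 rr1 (m _ mQt) (e0 _) (mxLpnorm_gauge r0 PQt hQt).
have Di : 0 < D^-1 by rewrite invr_gt0.
have GD := gauge_scale Di D0 (mxLpnorm_gauge D0 PD hD).
have DD : D^-1 * D = 1 by rewrite mulVf// gt_eqF.
rewrite DD in GD.
have D1 : 1 <= 2 * (r + 1) by have := r0; lra.
have mDD : measurable_fun setT (fun t => ((D^-1)%:E * (EFin \o mxm (fun x => Q x - Qt x)%R) t)%E).
  by apply: measurable_funeM; exact: m.
have D0' t : (0 <= (D^-1)%:E * (EFin \o mxm (fun x => Q x - Qt x)%R) t)%E.
  by rewrite mule_ge0// lee_fin ltW.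
have {}GD := gauge_mono ltr01 D1 mDD D0' GD.
have G1 := gauge_add r1 (m _ mQ) (m _ mQt) (e0 _) (e0 _) GQ GQt.
have r2 : 0 < 2 * (r + 1) by rewrite mulr_gt0.
have m1 : measurable_fun setT (fun t => ((EFin \o mxm Q) t + (EFin \o mxm Qt) t)%E).
  by apply: emeasurable_funD; exact: m.
have G2 := gauge_add r2 m1 mDD (fun t => adde_ge0 (e0 Q t) (e0 Qt t)) D0' G1 GD.
have b4 : 0 < 4 * bet by rewrite mulr_gt0.
have r4 : 0 < 2 * (2 * (r + 1)) by rewrite mulr_gt0.
exact: (gauge_scale b4 r4 G2).
Qed.

Variable A : 'M[C]_(2, 4).

(** The leading 2 counts the two densities; the rest is [lip_const] without its factor [d]. *)
Definition stability_const : R := 2 * ((dcoef_norm A + 1) * (2 * kgauge weight_bound)).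

Lemma stability_const_gt0 : 0 < stability_const.
Proof.
have r1 : 0 < r + 1 by rewrite addr_gt0.
have G0 : 0 <= dcoef_norm A by rewrite sumr_ge0// => k _; rewrite addr_ge0 ?cabs1_ge0.
have w0 : 0 < weight_bound by do 3!rewrite mulr_gt0//.
by rewrite /stability_const mulr_gt0// mulr_gt0 ?ltr_wpDl// mulr_gt0// kgauge_gt0.
Qed.

(** The weight is divided by [d], and the distance of the potentials may be zero. The bound is
    therefore proved for every [d] above the distance; since the gauge of the weight does not depend
    on [d], letting [d] decrease gives a bound linear in the distance. *)
Lemma density_stability (Q Qt : R -> 'M[C]_2) : Uball p r Q -> Uball p r Qt ->
  let g1 := fun t => (charDensity b1 b2 A Q).1 t - (charDensity b1 b2 A Qt).1 t in
  let g2 := fun t => (charDensity b1 b2 A Q).2 t - (charDensity b1 b2 A Qt).2 t in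
  [/\ is_charDensity b1 b2 A Q (charDensity b1 b2 A Q),
      is_charDensity b1 b2 A Qt (charDensity b1 b2 A Qt),
      (Lpnorm p g1 < +oo)%E, (Lpnorm p g2 < +oo)%E &
      (Lpnorm p g1 + Lpnorm p g2 <=
         stability_const%:E * mxLpnorm p (fun x => Q x - Qt x)%R)%E].
Proof.
move=> UQ UQt g1 g2; have [[PQ _] [PQt _]] := (UQ, UQt).
have PD := potentialB PQ PQt; have hD := mxLpnormB_le UQ UQt.
set D := mxLpnorm p _ in hD *.
have D0 : (0 <= D)%E by exact: Lnorm_ge0.
have Dfin : D \is a fin_num by rewrite ge0_fin_numE// (le_lt_trans hD)// ltry.
have r1 : 0 < r + 1 by rewrite addr_gt0.
have K d : fine D < d ->
  [/\ is_charDensity b1 b2 A Q (charDensity b1 b2 A Q),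
      is_charDensity b1 b2 A Qt (charDensity b1 b2 A Qt),
      (Lpnorm p g1 <= (lip_const weight_bound d A)%:E)%E &
      (Lpnorm p g2 <= (lip_const weight_bound d A)%:E)%E].
  move=> Dd; have d0 : 0 < d by rewrite (le_lt_trans _ Dd)// fine_ge0.
  have Dd' : (D <= d%:E)%E by rewrite -(fineK Dfin) lee_fin ltW.
  have mQ := potential_measurable_mxm PQ; have mQt := potential_measurable_mxm PQt.
  have mD := potential_measurable_mxm PD.
  have dI : 0 <= d^-1 by rewrite invr_ge0 ltW.
  have b4 : 0 <= 4 * bet by rewrite mulr_ge0// ltW.
  have wge (Q' : R -> 'M[C]_2) t : mxm Q' t <= mxm Q t + mxm Qt t + d^-1 * mxm (fun x => Q x - Qt x) t ->
      forall i, N (qcoef Q' i t) <= weight Q Qt d t / 2.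
    (* The 4 in [weight] is the 2 of [cabs1_qcoef_le] times the 2 needed to stay below half the
       weight. *)
    move=> h i; rewrite (le_trans (cabs1_qcoef_le _ _ _))// ler_pdivlMr// mulrAC.
    rewrite (_ : 2 * bet * 2 = 4 * bet); last by ring.
    by rewrite ler_wpM2l.
  apply: (@Lpnorm_density_diff _ _ p1 (weight Q Qt d) _ _ _ weight_bound _ _ (qcoef Q) (qcoef Qt)).
  - by apply: measurable_funM => //; apply: measurable_funD; [exact: measurable_funD|exact: measurable_funM].
  - by move=> t; rewrite mulr_ge0// !addr_ge0 ?mxm_ge0// mulr_ge0 ?mxm_ge0.
  - by move=> t t01; rewrite /weight !mxm_supp// mulr0 !addr0 mulr0.
  - by rewrite !mulr_gt0.
  - exact: weight_gauge.
  - by move=> i; exact: cmeas_qcoef PQ.2.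
  - by move=> i; exact: cmeas_qcoef PQt.2.
  - by move=> i t; apply: wge; rewrite -addrA lerDl addr_ge0 ?mxm_ge0// mulr_ge0 ?mxm_ge0.
  - by move=> i t; apply: wge; rewrite addrAC lerDr addr_ge0 ?mxm_ge0// mulr_ge0 ?mxm_ge0.
  - move=> i t; rewrite qcoefB (le_trans (cabs1_qcoef_le _ _ _))//.
    have hm : mxm (fun x => Q x - Qt x) t <=
        d * (mxm Q t + mxm Qt t + d^-1 * mxm (fun x => Q x - Qt x) t).
      rewrite mulrDr mulrA mulfV ?gt_eqF// mul1r lerDr.
      by rewrite mulr_ge0 ?(ltW d0)// addr_ge0 ?mxm_ge0.
    rewrite /weight; move: hm; move: (mxm _ t) (mxm Q t + _ + _) => x y hm.
    have -> : d * (4 * bet * y / 2) = 2 * bet * (d * y) by field.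
    by rewrite ler_wpM2l// mulr_ge0// ltW.
  - exact: d0.
  - exact: b10.
  - exact: b20.
  - exact: PQ.1.
  - exact: PQt.1.
  - exact: qcoefE.
  - exact: qcoefE.
have [c1 c2 h1 h2] := K (fine D + 1) (ltr_pwDr ltr01 (lexx _)).
(* Membership in L^p needs only one admissible [d]; for the estimate [d] exceeds the distance by
   [e / stability_const], with [e] arbitrary. *)
split => //; [exact: le_lt_trans h1 (ltry _)|exact: le_lt_trans h2 (ltry _)|].
apply/lee_addgt0Pr => e e0.
have S0 := stability_const_gt0.
have [_ _ k1 k2] := K (fine D + e / stability_const) (ltr_pwDr (divr_gt0 e0 S0) (lexx _)).
apply: le_trans (leeD k1 k2) _.
rewrite -(fineK Dfin) -EFinD -EFinM -EFinD lee_fin.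
have -> : stability_const * fine D + e = stability_const * (fine D + e / stability_const).
  by rewrite mulrDr mulrCA mulfV ?gt_eqF// mulr1.
rewrite le_eqVlt; apply/orP; left; apply/eqP.
move: (fine D + e / stability_const) => x; rewrite /stability_const /lip_const; ring.
Qed.
End Final.

Theorem lemma1p1 (R : realType) (b1 b2 : R) (hb1 : b1 < 0) (hb2 : 0 < b2)
    (A : 'M[R[i]]_(2, 4)) (hA : row_free A)
    (p : \bar R) (hp : (1 <= p)%E) (r : R) (hr : 0 < r) :
  exists2 C : R, 0 < C &
    forall Q Qt : R -> 'M[R[i]]_2, Uball p r Q -> Uball p r Qt ->
    let g1 := fun t : R =>
      (charDensity b1 b2 A Q).1 t - (charDensity b1 b2 A Qt).1 t : R[i] in
    let g2 := fun t : R =>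
      (charDensity b1 b2 A Q).2 t - (charDensity b1 b2 A Qt).2 t : R[i] in
    [/\ forall lambda : R[i],
          charDet b1 b2 A Q lambda - charDet b1 b2 A Qt lambda =
          fourier01 b1 g1 lambda + fourier01 b2 g2 lambda,
        inLp p g1, inLp p g2 &
        (Lpnorm p g1 + Lpnorm p g2 <=
           C%:E * mxLpnorm p (fun x => (Q x - Qt x)%R))%E].
Proof.
exists (stability_const b1 b2 r A); first exact: stability_const_gt0.
move=> Q Qt UQ UQt g1 g2.
have [[c1 c2 cE] [c1' c2' cE'] h1 h2 hS] := density_stability hb1 hb2 hp hr A UQ UQt.
have [m1 m1' _] := inLp1B c1 c1'; have [m2 m2' _] := inLp1B c2 c2'.
split => // lambda; rewrite cE cE'.
have -> : fourier01 b1 g1 lambda = _ := fourier01B b1 lambda c1 c1'.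
have -> : fourier01 b2 g2 lambda = _ := fourier01B b2 lambda c2 c2'.
have cancel (u x y x' y' : R[i]) : u + x + y - (u + x' + y') = (x - x') + (y - y') by ring.
exact: cancel.
Qed.
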